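(* Let $\beta>1$, $\mathbf{b}\in\mathbb{C}^n\setminus\{0\}$, $L\in Q_{\mathbf{b},\beta}(\mathbb{B}_n)$, $p\in\mathbb{N}$, and let $g_0,\ldots,g_p,h$ be analytic in $\mathbb{B}_n$ functions of bounded $L$-index in the direction $\mathbf{b}$. Suppose $\mathbb{B}_n\setminus G^{\mathbf{b}}_\beta(g_0)\ne\emptyset$ and that for every $r\in(0,\beta]$ there exists $T=T(r)>0$ such that for each $z\in\mathbb{B}_n\setminus G^{\mathbf{b}}_r(g_0)$ and each $j=1,\ldots,p$ $$|g_j(z)|\le T L^j(z)|g_0(z)|.$$ Then every analytic function $F$ in $\mathbb{B}_n$ which satisfies $$g_0(z)\frac{\partial^pF(z)}{\partial\mathbf{b}^p}+g_1(z)\frac{\partial^{p-1}F(z)}{\partial\mathbf{b}^{p-1}}+\ldots+g_p(z)F(z)=h(z),\qquad z\in\mathbb{B}_n,$$ is of bounded $L$-index in the direction $\mathbf{b}$.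
   Context: $|\cdot|$ is the Euclidean norm on $\mathbb{C}^n$, $\mathbb{B}_n=\{z\in\mathbb{C}^n:|z|<1\}$, $\mathbb{R}_+=(0,\infty)$, $\mathbb{Z}_+=\{0,1,2,\dots\}$. For $z\in\mathbb{C}^n$, $S_z=\{t\in\mathbb{C}: z+t\mathbf{b}\in\mathbb{B}_n\}$. Directional derivatives: $\frac{\partial^0F}{\partial\mathbf{b}^0}=F$, $\frac{\partial F}{\partial\mathbf{b}}=\sum_{j=1}^n\frac{\partial F}{\partial z_j}b_j$, $\frac{\partial^kF}{\partial\mathbf{b}^k}=\frac{\partial}{\partial\mathbf{b}}\big(\frac{\partial^{k-1}F}{\partial\mathbf{b}^{k-1}}\big)$ for $k\ge2$. For a positive continuous $L$ on $\mathbb{B}_n$, an analytic function $F$ in $\mathbb{B}_n$ is of bounded $L$-index in the direction $\mathbf{b}$ if there is $m_0\in\mathbb{Z}_+$ such that for all $m\in\mathbb{Z}_+$ and all $z\in\mathbb{B}_n$ $$\frac{1}{m!L^m(z)}\left|\frac{\partial^mF(z)}{\partial\mathbf{b}^m}\right|\le\max\left\{\frac{1}{k!L^k(z)}\left|\frac{\partial^kF(z)}{\partial\mathbf{b}^k}\right|:0\le k\le m_0\right\}.$$ Class $Q_{\mathbf{b},\beta}(\mathbb{B}_n)$: the set of continuous $L:\mathbb{B}_n\to\mathbb{R}_+$ with $L(z)>\frac{\beta|\mathbf{b}|}{1-|z|}$ for all $z\in\mathbb{B}_n$ and such that $0<\lambda_1^{\mathbf{b}}(\eta)\le\lambda_2^{\mathbf{b}}(\eta)<+\infty$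 for every $\eta\in[0,\beta]$, where $\lambda_1^{\mathbf{b}}(\eta)$ and $\lambda_2^{\mathbf{b}}(\eta)$ are respectively the infimum and the supremum of $\frac{L(z+t\mathbf{b})}{L(z+t_0\mathbf{b})}$ over all $z\in\mathbb{B}_n$, $t_0\in S_z$ and $t\in\mathbb{C}$ with $|t-t_0|\le\frac{\eta}{L(z+t_0\mathbf{b})}$ (for such $t$ one has $z+t\mathbf{b}\in\mathbb{B}_n$). Sets $G^{\mathbf{b}}_r(f)$ for $f$ analytic in $\mathbb{B}_n$ and $r>0$: for $z^0\in\mathbb{B}_n$ consider $t\mapsto f(z^0+t\mathbf{b})$, $t\in S_{z^0}$. If it has no zeros in $S_{z^0}$, put $G^{\mathbf{b}}_r(f,z^0)=\emptyset$; if it is identically $0$, put $G^{\mathbf{b}}_r(f,z^0)=\{z^0+t\mathbf{b}:t\in S_{z^0}\}$; otherwise, with $a_k^0$ its zeros, put $G^{\mathbf{b}}_r(f,z^0)=\bigcup_k\big\{z^0+t\mathbf{b}:|t-a_k^0|\le\frac{r}{L(z^0+a_k^0\mathbf{b})}\big\}$. Finally $G^{\mathbf{b}}_r(f)=\bigcup_{z^0\in\mathbb{B}_n}G^{\mathbf{b}}_r(f,z^0)$. *)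

(* Defs.v *)
From mathcomp Require Import all_boot all_order all_algebra.
From mathcomp Require Import all_classical all_reals all_analysis.
From mathcomp Require Import complex.
Set Implicit Arguments.
Unset Strict Implicit.
Unset Printing Implicit Defensive.
Import Order.TTheory GRing.Theory Num.Theory numFieldNormedType.Exports.

Local Open Scope classical_set_scope.
Local Open Scope ring_scope.

(* The complex field R[i], packed as a numClosedFieldType so that its topology
   and the normed-module structure of 'rV[CC R]_n are inferred. *)
Definition CC (R : realType) : numClosedFieldType := R[i]%C.

(* The modulus as an element of R; the generic `|t| of t : CC R lies in CC R. *)
Definition cabs (R : realType) (t : CC R) : R := ComplexField.Normc.normc t.

(* The Euclidean norm; the library norm `|z| on 'rV[CC R]_n is the sup norm,
   which induces the same topology. *)
Definition enorm (R : realType) (n : nat) (z : 'rV[CC R]_n) : R :=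
  Num.sqrt (\sum_(j < n) cabs (z 0 j) ^+ 2).

Definition unit_ball (R : realType) (n : nat) : set 'rV[CC R]_n :=
  [set z | enorm z < 1].

Definition slice_dom (R : realType) (n : nat) (b z : 'rV[CC R]_n) :
  set (CC R) := [set t | unit_ball (z + t *: b)].

Definition monomial (R : realType) (n : nat) (al : {ffun 'I_n -> nat})
  (w : 'rV[CC R]_n) : CC R := \prod_(j < n) w 0 j ^+ al j.

(* F is the sum of an absolutely convergent power series in w = z - a for
   |w| < r.  By absolute convergence the order of summation is irrelevant; the
   sum is taken here through the partial sums over the multi-indices with all
   entries < N. *)
Definition analytic_at (R : realType) (n : nat) (F : 'rV[CC R]_n -> CC R)
    (a : 'rV[CC R]_n) : Prop :=
  exists (r : R) (c : {ffun 'I_n -> nat} -> CC R), 0 < r /\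
    forall w : 'rV[CC R]_n, enorm w < r ->
      summable [set: {ffun 'I_n -> nat}]
        (fun al => (cabs (c al * monomial al w))%:E) /\
      (fun N : nat => \sum_(al : {ffun 'I_n -> 'I_N})
          c [ffun j => al j : nat] * monomial [ffun j => al j : nat] w) @ \oo
        --> F (a + w).

(* Functions on the ball are represented by total functions whose values outside
   the ball are irrelevant. *)
Definition analytic_in_ball (R : realType) (n : nat)
    (F : 'rV[CC R]_n -> CC R) : Prop :=
  forall a, unit_ball a -> analytic_at F a.

Definition dirD (R : realType) (n : nat) (b : 'rV[CC R]_n)
    (F : 'rV[CC R]_n -> CC R) : 'rV[CC R]_n -> CC R :=
  fun z => \sum_(j < n) 'D_(delta_mx 0 j) F z * b 0 j.

Definition dirDn (R : realType) (n : nat) (b : 'rV[CC R]_n) (k : nat)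
    (F : 'rV[CC R]_n -> CC R) : 'rV[CC R]_n -> CC R :=
  iter k (dirD b) F.

Definition index_term (R : realType) (n : nat) (L : 'rV[CC R]_n -> R)
    (b : 'rV[CC R]_n) (F : 'rV[CC R]_n -> CC R) (z : 'rV[CC R]_n)
    (k : nat) : R :=
  (k`!%:R * L z ^+ k)^-1 * cabs (dirDn b k F z).

(* The terms are nonnegative, so 0 is a harmless default for the maximum. *)
Definition bounded_index (R : realType) (n : nat) (L : 'rV[CC R]_n -> R)
    (b : 'rV[CC R]_n) (F : 'rV[CC R]_n -> CC R) : Prop :=
  exists m0 : nat, forall (m : nat) (z : 'rV[CC R]_n), unit_ball z ->
    index_term L b F z m <= \big[Num.max/0]_(k < m0.+1) index_term L b F z k.

Definition slice_ratios (R : realType) (n : nat) (L : 'rV[CC R]_n -> R)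
    (b : 'rV[CC R]_n) (eta : R) : set R :=
  [set x | exists (z : 'rV[CC R]_n) (t0 t : CC R),
    [/\ unit_ball z, slice_dom b z t0,
        cabs (t - t0) <= eta / L (z + t0 *: b) &
        x = L (z + t *: b) / L (z + t0 *: b)]].

Definition lambda1 (R : realType) (n : nat) (L : 'rV[CC R]_n -> R)
    (b : 'rV[CC R]_n) (eta : R) : \bar R :=
  ereal_inf (EFin @` slice_ratios L b eta).

Definition lambda2 (R : realType) (n : nat) (L : 'rV[CC R]_n -> R)
    (b : 'rV[CC R]_n) (eta : R) : \bar R :=
  ereal_sup (EFin @` slice_ratios L b eta).

Definition class_Q (R : realType) (n : nat) (b : 'rV[CC R]_n) (beta : R)
    (L : 'rV[CC R]_n -> R) : Prop :=
  [/\ {within @unit_ball R n, continuous L},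
      forall z, unit_ball z -> 0 < L z,
      forall z, unit_ball z -> beta * enorm b / (1 - enorm z) < L z &
      forall eta : R, 0 <= eta <= beta ->
        [/\ (0 < lambda1 L b eta)%E,
            (lambda1 L b eta <= lambda2 L b eta)%E &
            (lambda2 L b eta < +oo)%E]].

Definition slice_zeros (R : realType) (n : nat) (b : 'rV[CC R]_n)
    (f : 'rV[CC R]_n -> CC R) (z0 : 'rV[CC R]_n) : set (CC R) :=
  [set a | slice_dom b z0 a /\ f (z0 + a *: b) = 0].

Definition Gset_at (R : realType) (n : nat) (L : 'rV[CC R]_n -> R)
    (b : 'rV[CC R]_n) (r : R) (f : 'rV[CC R]_n -> CC R)
    (z0 : 'rV[CC R]_n) : set 'rV[CC R]_n :=
  if `[< slice_zeros b f z0 = set0 >] then set0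
  else if `[< forall t, slice_dom b z0 t -> f (z0 + t *: b) = 0 >] then
    [set z0 + t *: b | t in slice_dom b z0]
  else
    \bigcup_(a in slice_zeros b f z0)
      [set z0 + t *: b | t in [set t | cabs (t - a) <= r / L (z0 + a *: b)]].

Definition Gset (R : realType) (n : nat) (L : 'rV[CC R]_n -> R)
    (b : 'rV[CC R]_n) (r : R) (f : 'rV[CC R]_n -> CC R) :
  set 'rV[CC R]_n :=
  \bigcup_(z0 in @unit_ball R n) Gset_at L b r f z0.

(* Main.v *)
(** On each slice write [F] as a power series in [s = (t - t0) L(z0)].  Bounded
    index of the [g_j] and [h] means that these coefficients are dominated by
    the first [m0 + 1]; truncating and factoring the resulting polynomials gives
    a circle of controlled radius near which no [g_j], [h] vanishes, unless
    identically on the slice, and on which their logarithmic derivatives are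
    bounded.  Differentiating the
    equation once yields, on that circle, a bound for the derivative of order
    [p + 1] of [F] by its lower derivatives.  Parseval's identity on the same
    circle turns this into a bound of all Taylor coefficients of [F] at the
    centre, of geometric growth [rho^-k], by finitely many of them (Hayman's
    criterion), and Cauchy's estimates at the points of larger circles improve
    [rho] step by step until it exceeds 1, which is possible because [beta > 1].
    Slices on which [g_0] vanishes identically are limits of the other ones. *)

Require Import Defs.
From mathcomp Require Import all_boot all_order all_algebra.
From mathcomp Require Import all_classical all_reals all_analysis.
From mathcomp Require Import complex ring lra.
From mathcomp Require Import cyclic separable cyclotomic.
Import Order.TTheory GRing.Theory Num.Theory numFieldNormedType.Exports.
Set Implicit Arguments.
Unset Strict Implicit.
Unset Printing Implicit Defensive.
Local Open Scope classical_set_scope.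
Local Open Scope ring_scope.

(** * Complex modulus and Parseval for polynomials *)

(** The hypotheses compare g_j with g_0 only away from the zeros of g_0, so the differential
    inequality for F holds on a well chosen circle but may fail between the centre and that circle,
    and it cannot be integrated outwards. Its mean square over the circle is enough: in the mean of
    |f^(k)|^2 the coefficient a_j carries the square of j(j-1)...(j-k+1), so that for large j the
    order p + 1 outweighs all lower orders and the tail is absorbed. The equation is differentiated
    because h is not comparable with F: on the circle |h'| <= P L |h|, and the equation itself
    bounds |h| by derivatives of F, which leaves a homogeneous inequality. The radius rho so
    obtained is less than 1, whereas bounded index needs late coefficients below the maximum of the
    early ones, hence a radius above 1. No integral occurs: circles are replaced by roots of unity,
    exact for polynomials of degree below their number, and analytic functions by polynomials with
    an error that tends to 0. *)

Section ComplexModulus.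
Variable R : realType.
Implicit Types x y z : CC R.
Local Notation rC := (real_complex R : R -> CC R).

Lemma normE x : `|x| = rC (cabs x).
Proof. by case: x => a c; rewrite /Num.norm /=. Qed.

Lemma rC_le (a c : R) : (rC a <= rC c) = (a <= c).
Proof. exact: lecR. Qed.

Lemma rC_lt (a c : R) : (rC a < rC c) = (a < c).
Proof. exact: ltcR. Qed.

Lemma cabs_ge0 x : 0 <= cabs x.
Proof. by rewrite -rC_le -normE normr_ge0. Qed.

Lemma cabs0 : cabs (0 : CC R) = 0.
Proof. exact: ComplexField.Normc.normc0. Qed.

Lemma cabs1 : cabs (1 : CC R) = 1.
Proof. exact: ComplexField.Normc.normc1. Qed.

Lemma cabs_eq0 x : (cabs x == 0) = (x == 0).
Proof.
apply/eqP/eqP => [/ComplexField.Normc.eq0_normc //|->]; exact: cabs0.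
Qed.

Lemma cabs_gt0 x : (0 < cabs x) = (x != 0).
Proof. by rewrite lt_def cabs_ge0 andbT cabs_eq0. Qed.

Lemma cabsM x y : cabs (x * y) = cabs x * cabs y.
Proof. exact: ComplexField.Normc.normcM. Qed.

Lemma cabsV x : cabs x^-1 = (cabs x)^-1.
Proof. exact: ComplexField.Normc.normcV. Qed.

Lemma cabsX x n : cabs (x ^+ n) = cabs x ^+ n.
Proof.
by elim: n => [|n IHn]; rewrite ?expr0 ?cabs1 // !exprS cabsM IHn.
Qed.

Lemma cabsD x y : cabs (x + y) <= cabs x + cabs y.
Proof. by rewrite -rC_le rmorphD -!normE ler_normD. Qed.

Lemma cabsN x : cabs (- x) = cabs x.
Proof. by apply/eqP; rewrite eq_le -!rC_le -!normE normrN lexx. Qed.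

Lemma cabsB x y : cabs (x - y) <= cabs x + cabs y.
Proof. by rewrite -(cabsN y); apply: cabsD. Qed.

Lemma cabs_distC x y : cabs (x - y) = cabs (y - x).
Proof. by rewrite -cabsN opprB. Qed.

Lemma cabs_dist x y z : cabs (x - z) <= cabs (x - y) + cabs (y - z).
Proof. by rewrite (_ : x - z = (x - y) + (y - z)) ?cabsD //; ring. Qed.

Lemma cabs_sum (I : Type) (r : seq I) (P : pred I) (f : I -> CC R) :
  cabs (\sum_(i <- r | P i) f i) <= \sum_(i <- r | P i) cabs (f i).
Proof.
elim/big_ind2 : _ => [|a c x y Hx Hy|//]; first by rewrite cabs0.
by apply: le_trans (cabsD _ _) _; apply: lerD.
Qed.

Lemma cabs_prod (I : Type) (r : seq I) (P : pred I) (f : I -> CC R) :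
  cabs (\prod_(i <- r | P i) f i) = \prod_(i <- r | P i) cabs (f i).
Proof. by apply: (big_morph _ cabsM cabs1). Qed.

Lemma cabs_real (a : R) : cabs (rC a) = `|a|.
Proof. by rewrite /cabs /ComplexField.Normc.normc /= expr0n /= addr0 sqrtr_sqr. Qed.

Lemma cabs_realp (a : R) : 0 <= a -> cabs (rC a) = a.
Proof. by move=> a0; rewrite cabs_real ger0_norm. Qed.

Lemma cabs_nat (n : nat) : cabs (n%:R : CC R) = n%:R.
Proof. by rewrite -(cabs_realp (ler0n R n)) rmorph_nat. Qed.

Lemma cabs_Re_le x : `|complex.Re x| <= cabs x.
Proof.
by case: x => a c; rewrite -sqrtr_sqr ler_sqrt ?lerDl ?sqr_ge0 // addr_ge0 ?sqr_ge0.
Qed.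

Lemma cabs_Im_le x : `|complex.Im x| <= cabs x.
Proof.
by case: x => a c; rewrite -sqrtr_sqr ler_sqrt ?lerDr ?sqr_ge0 // addr_ge0 ?sqr_ge0.
Qed.

Lemma cabs_ReIm x : cabs x <= `|complex.Re x| + `|complex.Im x|.
Proof.
case: x => a c; rewrite /cabs /=.
rewrite -[leRHS]ger0_norm ?addr_ge0 // -sqrtr_sqr ler_sqrt ?sqr_ge0 //.
by rewrite sqrrD !real_normK ?num_real // -addrA lerD2l lerDr mulrn_wge0 // mulr_ge0.
Qed.

Lemma sqr_cabs x : rC (cabs x ^+ 2) = x * x^*.
Proof. by rewrite rmorphXn /= -normE normCK. Qed.

End ComplexModulus.

Section Parseval.
Variable R : realType.
Local Notation rC := (real_complex R : R -> CC R).

Lemma prim_root_exists n : (0 < n)%N -> exists z : CC R, n.-primitive_root z.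
Proof.
pose p : {poly CC R} := 'X^n - 1; have [r Dp] := closed_field_poly_normal p.
move=> n_gt0; rewrite (monicP _) ?monicXnsubC // scale1r in Dp.
have rn1: all n.-unity_root r by apply/allP=> z; rewrite -root_prod_XsubC -Dp.
have sz_r: (n < (size r).+1)%N.
  by rewrite -(size_prod_XsubC r id) -Dp size_XnsubC.
have [|z] := hasP (has_prim_root n_gt0 rn1 _ sz_r); last by exists z.
by rewrite -separable_prod_XsubC -Dp separable_Xn_sub_1 // pnatr_eq0 -lt0n.
Qed.

Lemma poly_sum_trunc (q : {poly CC R}) n x : (size q <= n)%N ->
  q.[x] = \sum_(k < n) q`_k * x ^+ k.
Proof. exact: horner_coef_wide. Qed.

(** Discrete orthogonality: the nodes are [r] times the n-th roots of unity, and distinct exponents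
    below [n] differ modulo [n], so the cross terms are vanishing geometric sums. *)
Lemma parseval_nodes n (r : R) : (0 < n)%N -> 0 <= r ->
  exists x : 'I_n -> CC R, (forall i, cabs (x i) = r) /\
   forall q : {poly CC R}, (size q <= n)%N ->
     \sum_i cabs q.[x i] ^+ 2 =
       n%:R * \sum_(k < n) cabs q`_k ^+ 2 * r ^+ (2 * k).
Proof.
move=> n_gt0 r_ge0; have [w prw] := prim_root_exists n_gt0.
have wn : w ^+ n = 1 by exact: prim_expr_order.
have nw : cabs w = 1.
  apply/eqP; rewrite -(@pexpr_eq1 _ (cabs w) n) ?cabs_ge0 //.
  by rewrite -cabsX wn cabs1.
have wcw : w * w^* = 1 by rewrite -sqr_cabs nw expr1n rmorph1.
exists (fun i => rC r * w ^+ i); split=> [i|q sq].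
  by rewrite cabsM cabsX nw expr1n mulr1 cabs_realp.
have ci u : rC (cabs u ^+ 2) = u * u^* := sqr_cabs u.
apply: (@fmorph_inj _ _ (real_complex R)).
rewrite rmorph_sum rmorphM rmorph_sum rmorph_nat mulr_sumr.
pose t (i k l : 'I_n) := q`_k * (q`_l)^* * rC r ^+ (k + l) * (w ^+ k * w^* ^+ l) ^+ i.
have -> : \sum_(i < n) rC (cabs q.[rC r * w ^+ i] ^+ 2) = \sum_(i < n) \sum_k \sum_l t i k l.
  apply: eq_bigr => i _; rewrite ci (poly_sum_trunc _ sq) rmorph_sum mulr_suml.
  apply: eq_bigr => k _; rewrite mulr_sumr; apply: eq_bigr => l _.
  have rr : (rC r)^* = rC r by apply/CrealP; rewrite complex_real.
  rewrite /t rmorphM rmorphXn rmorphM rmorphXn /= rr !exprMn exprD -!exprM.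
  by rewrite ![(_ * i)%N]mulnC; ring.
rewrite exchange_big; apply: eq_bigr => k _ /=.
rewrite exchange_big (bigD1 k) //= [X in _ + X]big1 ?addr0.
  under eq_bigr do rewrite /t -exprMn wcw !expr1n mulr1.
  rewrite sumr_const card_ord [X in _ = _ * X]rmorphM [X in _ * (X * _)]ci.
  by rewrite [X in _ * (_ * X)]rmorphXn mul2n addnn mulr_natl.
move=> l lk; rewrite -mulr_sumr; set y := w ^+ k * _.
have yn : y ^+ n = 1.
  by rewrite exprMn -!exprM ![(_ * n)%N]mulnC !exprM -rmorphXn wn rmorph1 !expr1n mulr1.
have y1 : y != 1.
  apply: contra lk => /eqP y1.
  have /eqP : w ^+ k = w ^+ l.
    by rewrite -[RHS]mul1r -y1 -mulrA -exprMn [w^* * w]mulrC wcw expr1n mulr1.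
  by rewrite (eq_prim_root_expr prw) !modn_small // eq_sym.
have /eqP : (y - 1) * \sum_(i < n) y ^+ i = 0 by rewrite -subrX1 yn subrr.
by rewrite mulf_eq0 subr_eq0 (negPf y1) /= => /eqP ->; rewrite mulr0.
Qed.

Lemma cauchy_poly (q : {poly CC R}) (r M : R) k : 0 <= r ->
  (forall s, cabs s = r -> cabs q.[s] <= M) -> cabs q`_k * r ^+ k <= M.
Proof.
move=> r0 qM; have M0 : 0 <= M.
  by apply: le_trans (cabs_ge0 q.[rC r]) (qM _ _); rewrite cabs_realp.
(* More nodes than the degree of [q], and enough for the index [k] to occur in Parseval's sum. *)
pose n := maxn (size q) k.+1.
have n0 : (0 < n)%N by rewrite leq_max orbT.
have [x [xr /(_ q (leq_maxl _ _)) E]] := parseval_nodes n0 r0.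
have kn : (k < n)%N by rewrite leq_max leqnn orbT.
rewrite -(@ler_pXn2r _ 2) ?nnegrE ?mulr_ge0 ?exprn_ge0 ?cabs_ge0 //.
rewrite -(@ler_pM2l _ n%:R) ?ltr0n //.
have -> : n%:R * M ^+ 2 = \sum_(i < n) M ^+ 2.
  by rewrite sumr_const card_ord mulr_natl.
apply: (@le_trans _ _ (\sum_i cabs q.[x i] ^+ 2)); last first.
  by apply: ler_sum => i _; rewrite ler_pXn2r ?nnegrE ?cabs_ge0 ?qM.
rewrite E ler_pM2l ?ltr0n // (bigD1 (Ordinal kn)) //= exprMn -exprM mulnC lerDl.
by apply: sumr_ge0 => i _; rewrite mulr_ge0 ?exprn_ge0 ?cabs_ge0.
Qed.

End Parseval.

(** * Power series *)

Section PowerSeries.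
Variable R : realType.
Local Notation rC := (real_complex R : R -> CC R).

(** One-sided on purpose: these sequences serve only as upper bounds for errors. *)
Definition vanishing (e : nat -> R) :=
  forall eps, 0 < eps -> exists N, forall n, (N <= n)%N -> e n <= eps.

Lemma le_vanishing (e : nat -> R) (x y K : R) : vanishing e -> 0 <= K ->
  (forall n, x <= y + K * e n) -> x <= y.
Proof.
move=> ve K0 H; rewrite leNgt; apply/negP => yx.
have d0 : 0 < (x - y) / (2 * (K + 1)) by rewrite divr_gt0 ?subr_gt0 //; lra.
have [N /(_ _ (leqnn N)) HN] := ve _ d0.
have := H N; apply/negP; rewrite -ltNge.
have K1 : K * e N <= K * ((x - y) / (2 * (K + 1))) by rewrite ler_wpM2l.
have : K * ((x - y) / (2 * (K + 1))) <= (x - y) / 2.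
  rewrite (_ : _ * _ = (x - y) / 2 * (K / (K + 1))); last by field; lra.
  by rewrite ler_piMr ?ler_pdivrMr //; lra.
lra.
Qed.

Lemma vanishing_geom (K q : R) : 0 <= q < 1 -> vanishing (fun n => K * q ^+ n).
Proof.
move=> /andP[q0 q1] eps e0.
have [K0|K0] := leP K 0.
  by exists 0%N => n _; apply: le_trans (ltW e0); rewrite mulr_le0_ge0 ?exprn_ge0.
have nq : `|q| < 1 by rewrite ger0_norm.
have /cvgrPdist_le /(_ (eps / K)) := cvg_expr nq.
move=> /(_ (divr_gt0 e0 K0)) [N _ HN]; exists N => n Nn.
have := HN n Nn; rewrite /= sub0r normrN ger0_norm ?exprn_ge0 //.
by rewrite ler_pdivlMr // mulrC.
Qed.

Lemma vanishing_scale (K : R) e : 0 <= K -> vanishing e -> vanishing (fun n => K * e n).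
Proof.
move=> K0 ve eps e0.
have [|N HN] := ve (eps / (K + 1)); first by rewrite divr_gt0 //; lra.
exists N => n /HN; rewrite ler_pdivlMr; last lra.
move=> H; have [e1|e1] := leP 0 (e n); first nra.
by apply: le_trans (ltW e0); rewrite mulr_ge0_le0 // ltW.
Qed.

Lemma geom_sum_le (q : R) n : 0 <= q < 1 -> \sum_(k < n) q ^+ k <= (1 - q)^-1.
Proof.
move=> /andP[q0 q1]; have p1 : 0 < 1 - q by rewrite subr_gt0.
rewrite -[_^-1]mul1r ler_pdivlMr // mulrC.
rewrite -[1 - q]opprB mulNr -subrX1 opprB lerBlDr lerDl exprn_ge0 //.
Qed.

(** The intervals of centre [x n] and radius [e n] meet pairwise, so the supremum of their left ends
    lies in all of them. The rate [e] need not vanish. *)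
Lemma real_lim (x e : nat -> R) : (forall n m, `|x n - x m| <= e n + e m) ->
  exists l : R, forall n, `|x n - l| <= e n.
Proof.
move=> H; pose S := [set x n - e n | n in [set: nat]].
have ubS m : ubound S (x m + e m).
  by move=> _ [n _ <-]; have := H n m; rewrite ler_norml => /andP[_]; lra.
have S0 : S !=set0 by exists (x 0%N - e 0%N), 0%N.
exists (sup S) => n; rewrite ler_norml; apply/andP; split.
  by have := sup_le_ub S0 (ubS n); rewrite -/S; lra.
have : x n - e n <= sup S by apply: ub_le_sup; [exists (x 0%N + e 0%N); exact: ubS|exists n].
lra.
Qed.

Lemma complex_lim (x : nat -> CC R) (e : nat -> R) :
  (forall n m, cabs (x n - x m) <= e n + e m) ->
  exists l, forall n, cabs (x n - l) <= 2 * e n.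
Proof.
move=> H.
have [a Ha] : exists l : R, forall n, `|complex.Re (x n) - l| <= e n.
  apply: real_lim => n m; apply: le_trans (H n m).
  by rewrite -raddfB; apply: cabs_Re_le.
have [c Hc] : exists l : R, forall n, `|complex.Im (x n) - l| <= e n.
  apply: real_lim => n m; apply: le_trans (H n m).
  by rewrite -raddfB; apply: cabs_Im_le.
exists (Complex a c) => n; apply: le_trans (cabs_ReIm _) _.
have -> : complex.Re (x n - Complex a c) = complex.Re (x n) - a by case: (x n).
have -> : complex.Im (x n - Complex a c) = complex.Im (x n) - c by case: (x n).
by have := Ha n; have := Hc n; lra.
Qed.

Definition psum (a : nat -> CC R) n s := \sum_(k < n) a k * s ^+ k.

(* The remainders carry the whole definition: [n = 0] bounds [f], consecutive
   remainders bound the coefficients, and no notion of limit is needed. *)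
Definition has_ps (f : CC R -> CC R) (rho : R) (a : nat -> CC R) :=
  forall r, 0 < r -> r < rho -> exists B : R, forall n s, cabs s <= r ->
    cabs (f s - psum a n s) <= B * (cabs s / r) ^+ n.

Lemma has_ps_le f rho rho' a : rho' <= rho -> has_ps f rho a -> has_ps f rho' a.
Proof. by move=> le H r r0 rl; apply: H => //; apply: lt_le_trans le. Qed.

Lemma has_ps_bound f rho a r : has_ps f rho a -> r < rho ->
  exists B : R, forall s, cabs s <= r -> cabs (f s) <= B.
Proof.
move=> H rr; have [r0|r0] := ltP 0 r.
  have [B HB] := H r r0 rr; exists B => s sr; have := HB 0%N s sr.
  by rewrite /psum big_ord0 subr0 expr0 mulr1.
exists (cabs (f 0)) => s sr; have : cabs s == 0 by rewrite eq_le cabs_ge0 (le_trans sr).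
by rewrite cabs_eq0 => /eqP ->.
Qed.

Lemma has_ps0 f rho a : 0 < rho -> has_ps f rho a -> f 0 = a 0%N.
Proof.
move=> r0 H; have [||B /(_ 1%N 0)] := H (rho / 2); rewrite ?cabs0 ?divr_gt0 //; first by lra.
move=> /(_ (divr_ge0 (ltW r0) (ler0n _ _))); rewrite mul0r expr1 mulr0.
rewrite /psum big_ord1 expr0 mulr1 => H0; apply/eqP; rewrite -subr_eq0 -cabs_eq0.
by rewrite eq_le cabs_ge0 H0.
Qed.

Lemma psumB a m n s (r M : R) : (n <= m)%N -> cabs s < r ->
  (forall k, cabs (a k) * r ^+ k <= M) ->
  cabs (psum a m s - psum a n s) <= M * (cabs s / r) ^+ n / (1 - cabs s / r).
Proof.
move=> nm sr HM; have s0 := cabs_ge0 s; have r0 : 0 < r by apply: le_lt_trans sr.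
set q := cabs s / r; have q01 : 0 <= q < 1.
  by rewrite /q divr_ge0 ?(ltW r0) //= ltr_pdivrMr // mul1r.
have M0 : 0 <= M by apply: le_trans (HM 0%N); rewrite expr0 mulr1 cabs_ge0.
have -> : psum a m s - psum a n s = \sum_(k < m - n) a (n + k)%N * s ^+ (n + k).
  by rewrite /psum -(subnKC nm) big_split_ord /= addrAC subrr add0r addKn.
apply: le_trans (cabs_sum _ _ _) _.
apply: (@le_trans _ _ (\sum_(k < m - n) M * q ^+ n * q ^+ k)).
  apply: ler_sum => k _; rewrite cabsM cabsX -mulrA -exprD.
  rewrite (_ : cabs (a _) * _ = cabs (a (n + k)%N) * r ^+ (n + k) * q ^+ (n + k)).
    by rewrite ler_wpM2r ?exprn_ge0 //; case/andP: q01.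
  by rewrite -mulrA -exprMn /q [r * _]mulrC divfK ?gt_eqF.
rewrite -mulr_sumr; apply: ler_wpM2l; last exact: geom_sum_le.
by rewrite mulr_ge0 ?exprn_ge0 //; case/andP: q01.
Qed.

(** In [has_ps] the constant is existential and depends on [f]; here it depends only on a bound for
    the coefficients, which is what estimates uniform over all slices require. *)
Lemma has_ps_remainder f rho a (r M : R) s n : has_ps f rho a ->
  (forall k, cabs (a k) * r ^+ k <= M) -> cabs s < r -> cabs s < rho ->
  cabs (f s - psum a n s) <= M * (cabs s / r) ^+ n / (1 - cabs s / r).
Proof.
move=> H HM sr sq; have s0 := cabs_ge0 s.
pose r1 := (cabs s + rho) / 2.
have sr1 : cabs s < r1 by rewrite /r1; lra.
have r1r : r1 < rho by rewrite /r1; lra.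
have r10 : 0 < r1 by apply: le_lt_trans sr1.
have [B HB] := H r1 r10 r1r.
have v : vanishing (fun m => B * (cabs s / r1) ^+ m).
  by apply: vanishing_geom; rewrite divr_ge0 ?(ltW r10) //= ltr_pdivrMr // mul1r.
apply: (@le_vanishing (fun m => B * (cabs s / r1) ^+ (n + m)) _ _ 1) => //.
  move=> eps /v[N HN]; exists N => m Nm; apply: HN.
  exact: leq_trans Nm (leq_addl _ _).
move=> m; rewrite mul1r.
apply: le_trans (cabs_dist _ (psum a (n + m) s) _) _; rewrite addrC.
apply: lerD; first by apply: psumB => //; rewrite leq_addr.
by apply: HB; rewrite ltW.
Qed.

Lemma has_ps_intro g r a (S : R) : 0 < r -> 0 <= S ->
  (forall s, cabs s < r -> forall n,
    cabs (g s - psum a n s) <= S * (cabs s / r) ^+ n / (1 - cabs s / r)) ->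
  has_ps g r a.
Proof.
move=> r0 S0 H r1 r10 r1r; exists (S / (1 - r1 / r)) => n s sr1.
have s0 := cabs_ge0 s; have sr : cabs s < r by apply: le_lt_trans r1r.
apply: le_trans (H s sr n) _; set q := cabs s / r.
have q0 : 0 <= q by rewrite divr_ge0 // ltW.
have q1 : q < 1 by rewrite ltr_pdivrMr ?mul1r.
have qq : q <= r1 / r by rewrite ler_pM2r ?invr_gt0.
have r1r1 : r1 / r < 1 by rewrite ltr_pdivrMr ?mul1r.
rewrite mulrAC; apply: ler_pM; rewrite ?exprn_ge0 //.
- by rewrite divr_ge0 //; lra.
- by rewrite ler_wpM2l // lef_pV2 ?posrE; lra.
- apply: lerXn2r; rewrite ?nnegrE ?divr_ge0 ?(ltW r10) ?(ltW r0) //.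
  by rewrite /q ler_wpM2l // lef_pV2 ?posrE // ltW.
Qed.

(** Weierstrass's theorem. Cauchy's estimate for [p N - p M] turns the rate of uniform approximation
    into a rate for each coefficient, whatever the degrees of the [p N]. *)
Lemma has_ps_unif (p : nat -> {poly CC R}) f (e : nat -> R) (r : R) : 0 < r ->
  vanishing e ->
  (forall N s, cabs s <= r -> cabs (f s - (p N).[s]) <= e N) ->
  exists c, has_ps f r c /\ forall N k, cabs ((p N)`_k - c k) * r ^+ k <= 2 * e N.
Proof.
move=> r0 ve H; have crk k : cabs (rC r ^+ k) = r ^+ k.
  by rewrite cabsX cabs_realp // ltW.
have rn0 k : rC r ^+ k != 0 by rewrite -cabs_gt0 crk exprn_gt0.
have e0 N : 0 <= e N by apply: le_trans (H N 0 _); rewrite ?cabs_ge0 // cabs0 ltW.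
have /choice[c Hc] : forall k, exists ck, forall N,
    cabs ((p N)`_k - ck) * r ^+ k <= 2 * e N.
  move=> k.
  have [|l Hl] := @complex_lim (fun N => (p N)`_k * rC r ^+ k) e.
    move=> N M; rewrite -mulrBl -coefB cabsM crk; apply: cauchy_poly; first exact: ltW.
    move=> s sr; rewrite hornerD hornerN.
    apply: le_trans (cabs_dist _ (f s) _) _.
    by apply: lerD; [rewrite cabs_distC|]; apply: H; rewrite sr.
  exists (l / rC r ^+ k) => N; rewrite -crk -cabsM mulrBl divfK //.
exists c; split=> [|N k //].
(* A single polynomial within distance 1 of [f] bounds all the [c k] at once. *)
have [N0 /(_ _ (leqnn _)) eN0] := ve 1 ltr01.
have [S HS] : exists S, forall k, cabs (c k) * r ^+ k <= S.
  exists (\sum_(i < size (p N0)) cabs (p N0)`_i * r ^+ i + 2) => k.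
  have Hk : cabs (p N0)`_k * r ^+ k <= \sum_(i < size (p N0)) cabs (p N0)`_i * r ^+ i.
    have [kl|kl] := ltnP k (size (p N0)); last first.
      rewrite nth_default // cabs0 mul0r sumr_ge0 // => i _.
      by rewrite mulr_ge0 ?cabs_ge0 ?exprn_ge0 ?ltW.
    rewrite (bigD1 (Ordinal kl)) //= lerDl sumr_ge0 // => i _.
    by rewrite mulr_ge0 ?cabs_ge0 ?exprn_ge0 ?ltW.
  have Hd := Hc k N0.
  have : cabs (c k) <= cabs (p N0)`_k + cabs ((p N0)`_k - c k).
    by rewrite -{1}[c k](subKr (p N0)`_k); apply: cabsB.
  move=> /(ler_wpM2r (exprn_ge0 k (ltW r0))); rewrite mulrDl; lra.
have S0 : 0 <= S by apply: le_trans (HS 0%N); rewrite expr0 mulr1 cabs_ge0.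
apply: (has_ps_intro r0 S0) => s sr n; have s0 := cabs_ge0 s.
set q := cabs s / r; have q0 : 0 <= q by rewrite divr_ge0 // ltW.
have q1 : q < 1 by rewrite ltr_pdivrMr ?mul1r.
apply: (@le_vanishing e _ _ (1 + 2 / (1 - q))) => //.
  by rewrite addr_ge0 // divr_ge0 //; lra.
(* [m] covers both the degree of [p N] and the order [n]; the error is split at [p N] and at the
   partial sum of order [m]. *)
move=> N; pose m := maxn (size (p N)) n.
apply: le_trans (cabs_dist _ (p N).[s] _) _.
have := H N s (ltW sr).
rewrite (@horner_coef_wide _ m) ?leq_maxl // => Hf.
have Hp : cabs (\sum_(i < m) (p N)`_i * s ^+ i - psum c m s) <= 2 * e N / (1 - q).
  rewrite /psum -sumrB; apply: le_trans (cabs_sum _ _ _) _.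
  apply: (@le_trans _ _ (\sum_(i < m) 2 * e N * q ^+ i)).
    apply: ler_sum => i _; rewrite -mulrBl cabsM cabsX.
    rewrite (_ : cabs s ^+ i = r ^+ i * q ^+ i).
      by rewrite mulrA ler_wpM2r ?exprn_ge0.
    by rewrite -exprMn /q mulrC divfK ?gt_eqF.
  rewrite -mulr_sumr ler_wpM2l ?mulr_ge0 //; apply: geom_sum_le.
  by rewrite q0.
have Hm := psumB (leq_maxr (size (p N)) n) sr HS.
have := cabs_dist (\sum_(i < m) (p N)`_i * s ^+ i) (psum c m s) (psum c n s).
rewrite -/m -/q in Hm *; rewrite mulrDl mul1r [2 / _ * _]mulrAC.
by lra.
Qed.

End PowerSeries.

(** * Uniqueness, Cauchy's estimates and change of centre *)

Section PowerSeriesTheory.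
Variable R : realType.
Local Notation rC := (real_complex R : R -> CC R).
Implicit Types (f g : CC R -> CC R) (a : nat -> CC R) (rho : R).

Lemma vanishing_shift (e : nat -> R) k : vanishing e -> vanishing (fun n => e (n + k)%N).
Proof.
by move=> ve eps /ve[N HN]; exists N => n Nn; apply: HN; rewrite (leq_trans Nn) ?leq_addr.
Qed.

(** If the coefficients agree below [n] and differ by [D] at [n], the remainders of order [n + 1]
    give D t^n <= K t^(n+1) for all small t > 0, which forces D = 0. *)
Lemma has_ps_uniq f g rho rho' delta a a' :
  0 < rho -> 0 < rho' -> 0 < delta -> has_ps f rho a -> has_ps g rho' a' ->
  (forall s, cabs s < delta -> f s = g s) -> forall k, a k = a' k :> CC R.
Proof.
move=> rho0 rho'0 d0 Hf Hg fg; elim/ltn_ind => n IHn.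
pose r := Num.min delta (Num.min rho rho') / 2.
have m0 : 0 < Num.min delta (Num.min rho rho') by rewrite !lt_min rho0 rho'0 d0.
have r0 : 0 < r by rewrite divr_gt0.
have rm : r < Num.min delta (Num.min rho rho') by rewrite /r; lra.
move: (rm); rewrite !lt_min => /and3P[rd rr rr'].
have [B HB] := Hf r r0 rr; have [B' HB'] := Hg r r0 rr'.
apply/eqP; rewrite -subr_eq0 -cabs_eq0 eq_le cabs_ge0 andbT.
set D := cabs _; pose K := `|(B + B') / r ^+ n.+1|.
have HK t : 0 < t -> t <= r -> D <= K * t.
  move=> t0 tr; have ct : cabs (rC t) = t by rewrite cabs_realp // ltW.
  have tr' : cabs (rC t) <= r by rewrite ct.
  rewrite -(@ler_pM2r _ (t ^+ n)) ?exprn_gt0 //.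
  have -> : D * t ^+ n = cabs (psum a n.+1 (rC t) - psum a' n.+1 (rC t)).
    rewrite /psum !big_ord_recr /=.
    rewrite (eq_bigr (fun i : 'I_n => a' i * rC t ^+ i)); last by move=> i _; rewrite IHn.
    by rewrite opprD addrACA subrr add0r -mulrBl cabsM cabsX ct.
  have h1 := HB n.+1 _ tr'; have h2 := HB' n.+1 _ tr'.
  rewrite fg in h1; last by rewrite ct; apply: le_lt_trans tr _.
  apply: le_trans (cabs_dist _ (g (rC t)) _) _; rewrite cabs_distC.
  apply: le_trans (lerD h1 h2) _; rewrite ct -mulrDl.
  rewrite expr_div_n mulrA mulrAC -[K * t * _]mulrA -exprS.
  by rewrite ler_wpM2r ?exprn_ge0 ?(ltW t0) // ler_norm.
rewrite leNgt; apply/negP => D0.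
have K0 : 0 <= K by exact: normr_ge0.
pose t := Num.min r (D / (2 * (K + 1))).
have t0 : 0 < t by rewrite lt_min r0 divr_gt0 //; lra.
have tr : t <= r by rewrite ge_min lexx.
have tD : t <= D / (2 * (K + 1)) by rewrite ge_min lexx orbT.
have := HK t t0 tr; apply/negP; rewrite -ltNge.
apply: (@le_lt_trans _ _ (K * (D / (2 * (K + 1))))); first by rewrite ler_wpM2l.
rewrite mulrA ltr_pdivrMr; last lra.
nra.
Qed.

Lemma has_ps_ext f g rho (a : nat -> CC R) : (forall s, cabs s < rho -> f s = g s) ->
  has_ps f rho a -> has_ps g rho a.
Proof.
move=> fg H r r0 rr; have [B HB] := H r r0 rr; exists B => n s sr.
by rewrite -fg ?HB //; apply: le_lt_trans rr.
Qed.

(** The coefficients could a priori depend on the radius [r]; uniqueness identifies them. *)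
Lemma has_ps_exhaust f rho : 0 < rho ->
  (forall r, 0 < r < rho -> exists a, has_ps f r a) -> exists a : nat -> CC R, has_ps f rho a.
Proof.
move=> rho0 H; have [|a Ha] := H (rho / 2); first by apply/andP; lra.
exists a => r r0 rr; pose r1 := (r + rho) / 2.
have [|a1 Ha1] := H r1; first by apply/andP; rewrite /r1; lra.
have E : a = a1.
  by apply/funext; apply: (has_ps_uniq _ _ ltr01 Ha Ha1 (fun _ _ => erefl)) => //;
    rewrite /r1; lra.
by rewrite E; apply: Ha1 => //; rewrite /r1; lra.
Qed.

Definition ptrunc (a : nat -> CC R) N : {poly CC R} := \poly_(k < N) a k.

Lemma horner_ptrunc a N s : (ptrunc a N).[s] = psum a N s.
Proof. exact: horner_poly. Qed.

Lemma has_ps_ptrunc f rho a r : has_ps f rho a -> 0 <= r < rho ->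
  exists e, vanishing e /\ forall N s, cabs s <= r -> cabs (f s - (ptrunc a N).[s]) <= e N.
Proof.
move=> H /andP[r0 rr]; pose r1 := (r + rho) / 2.
have r10 : 0 < r1 by rewrite /r1; lra.
have rr1 : r < r1 by rewrite /r1; lra.
have [|B HB] := H r1 r10; first by rewrite /r1; lra.
have B0 : 0 <= B.
  have := HB 0%N 0; rewrite cabs0 expr0 mulr1 => /(_ (ltW r10)).
  by apply: le_trans; apply: cabs_ge0.
exists (fun n => B * (r / r1) ^+ n); split.
  by apply: vanishing_geom; rewrite divr_ge0 ?(ltW r10) //= ltr_pdivrMr // mul1r.
move=> N s sr; rewrite horner_ptrunc; apply: le_trans (HB _ _ _) _.
  exact: le_trans sr (ltW rr1).
rewrite ler_wpM2l //; apply: lerXn2r.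
- by rewrite nnegrE divr_ge0 ?cabs_ge0 ?(ltW r10).
- by rewrite nnegrE divr_ge0 ?(ltW r10).
- by rewrite ler_pM2r ?invr_gt0.
Qed.

Lemma has_ps_cauchy f rho a (r M : R) : has_ps f rho a -> 0 <= r < rho ->
  (forall s, cabs s = r -> cabs (f s) <= M) -> forall k, cabs (a k) * r ^+ k <= M.
Proof.
move=> H rr HM k; have [e [ve He]] := has_ps_ptrunc H rr.
case/andP: rr => r0 rr.
apply: (@le_vanishing _ (fun n => e (n + k.+1)%N) _ _ 1) => //; first exact: vanishing_shift.
move=> n; rewrite mul1r; have :=
  @cauchy_poly _ (ptrunc a (n + k.+1)) r (M + e (n + k.+1)%N) k r0.
rewrite coef_poly addnS ltnS leq_addl; apply => s sr.
have -> : (ptrunc a (n + k).+1).[s] = f s - (f s - (ptrunc a (n + k).+1).[s]) by ring.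
by apply: le_trans (cabsB _ _) _; apply: lerD; [exact: HM | apply: He; rewrite sr].
Qed.

Lemma has_ps_exists (a : nat -> CC R) (r B : R) : 0 < r ->
  (forall k, cabs (a k) * r ^+ k <= B) -> exists g, has_ps g r a.
Proof.
move=> r0 HB; have B0 : 0 <= B by apply: le_trans (HB 0%N); rewrite expr0 mulr1 cabs_ge0.
have /choice[g Hg] : forall s, exists l, cabs s < r -> forall n,
    cabs (psum a n s - l) <= 2 * (B * (cabs s / r) ^+ n / (1 - cabs s / r)).
  move=> s; have [sr|sr] := ltP (cabs s) r; last by exists 0.
  have h n : 0 <= B * (cabs s / r) ^+ n / (1 - cabs s / r).
    rewrite divr_ge0 ?mulr_ge0 ?exprn_ge0 ?divr_ge0 ?cabs_ge0 ?(ltW r0) //.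
    by rewrite subr_ge0 ler_pdivrMr // mul1r ltW.
  have [|l Hl] := @complex_lim _ (psum a ^~ s)
    (fun n => B * (cabs s / r) ^+ n / (1 - cabs s / r)); last by exists l.
  move=> n m.
  have [nm|/ltnW mn] := leqP n m.
    rewrite cabs_distC; apply: le_trans (psumB nm sr HB) _.
    by rewrite lerDl.
  by apply: le_trans (psumB mn sr HB) _; rewrite lerDr.
exists g; apply: (@has_ps_intro _ _ _ _ (2 * B)) => //; first by rewrite mulr_ge0.
by move=> s sr n; rewrite cabs_distC -!mulrA ![_ * (B * _)]mulrA; have := Hg s sr n; lra.
Qed.

(** The Taylor expansions at [d] of the truncations of [f] converge uniformly near [d], and
    [has_ps_unif] compares the coefficients. The error [e] is the same for all centres [d], so that
    later proofs may let [d] run over a circle. *)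
Lemma has_ps_recenter_rate f rho a r : has_ps f rho a -> 0 <= r < rho ->
  exists e, [/\ vanishing e, forall N, 0 <= e N & forall d, cabs d <= r ->
    exists b, has_ps (fun s => f (d + s)) (rho - cabs d) b /\
      forall N k, cabs ((ptrunc a N)^`N(k).[d] - b k) * ((rho - r) / 2) ^+ k <= e N].
Proof.
move=> H /andP[r0 rr].
have loc r1 r2 : 0 <= r1 -> 0 < r2 -> r1 + r2 < rho -> exists e, vanishing e /\
  forall d, cabs d <= r1 -> exists b, has_ps (fun s => f (d + s)) r2 b /\
      forall N k, cabs ((ptrunc a N)^`N(k).[d] - b k) * r2 ^+ k <= 2 * e N.
  move=> r10 r20 r12; have [|e [ve He]] := @has_ps_ptrunc _ _ _ (r1 + r2) H.
    by apply/andP; lra.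
  exists e; split=> // d dr.
  pose p N := \poly_(i < size (ptrunc a N)) (ptrunc a N)^`N(i).[d].
  have [|b [Hb1 Hb2]] := @has_ps_unif _ p (fun s => f (d + s)) e r2 r20 ve.
    move=> N s sr; rewrite horner_poly -nderiv_taylor; last exact: mulrC.
    by apply: He; apply: le_trans (cabsD _ _) _; lra.
  exists b; split=> // N k; have := Hb2 N k; rewrite coef_poly.
  by case: ltnP => // sk; rewrite nderivn_poly0 // horner0.
have d0 : 0 < (rho - r) / 2 by lra.
have [|e [ve He]] := loc r _ r0 d0; first by lra.
have e0 N : 0 <= 2 * e N.
  have [|b [_ Hb]] := He 0; first by rewrite cabs0.
  by apply: le_trans (Hb N 0%N); rewrite expr0 mulr1 cabs_ge0.
exists (fun N => 2 * e N); split=> //; first exact: vanishing_scale.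
move=> d dr; have [b [Hb1 Hb2]] := He d dr; exists b; split=> //.
(* [loc] gives the rate on a fixed radius; exhaustion gives the series on the largest disc about [d]
   inside the original one, and uniqueness joins the two. *)
have [||b' Hb'] := @has_ps_exhaust (fun s => f (d + s)) (rho - cabs d); first by lra.
  move=> r2 /andP[r20 r2r]; have [|e' [_ He']] := loc (cabs d) r2 (cabs_ge0 _) r20;
    first by lra.
  by have [|b2 []] := He' d; last by exists b2.
suff -> : b = b' by [].
by apply/funext; apply: (has_ps_uniq d0 _ d0 Hb1 Hb' (fun _ _ => erefl)); lra.
Qed.

Lemma has_ps_recenter f rho a d : has_ps f rho a -> cabs d < rho ->
  exists b, has_ps (fun s => f (d + s)) (rho - cabs d) b.
Proof.
move=> H dr; have [|e [_ _ He]] := @has_ps_recenter_rate _ _ _ (cabs d) H.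
  by rewrite cabs_ge0.
by have [|b []] := He d; last by exists b.
Qed.

(* The [j]-th local coefficient is, as a function of the centre [d], the series
   with coefficients ['C(k, j) a_k]; Cauchy's estimate on [cabs d = r] bounds
   these, and the binomial theorem sums them over [j]. *)
Lemma has_ps_coef_extend f rho a (r rho1 B x : R) : has_ps f rho a ->
  0 < r < rho -> 0 < rho1 -> 0 <= x < rho1 ->
  (forall d, cabs d = r -> exists (delta : R) b, [/\ 0 < delta,
      has_ps (fun s => f (d + s)) delta b & forall j, cabs (b j) * rho1 ^+ j <= B]) ->
  forall k, cabs (a k) * (r + x) ^+ k <= B / (1 - x / rho1).
Proof.
move=> H /andP[r0 rr] rho10 /andP[x0 xr] Hd k.
have [|e [ve e0 He]] := @has_ps_recenter_rate _ _ _ r H; first by rewrite ltW.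
have d0 : 0 < (rho - r) / 2 by lra.
have HC j : (j <= k)%N -> (cabs (a k) *+ 'C(k, j)) * r ^+ (k - j) <= B / rho1 ^+ j.
  move=> jk; pose dj := ((rho - r) / 2) ^+ j.
  have dj0 : 0 < dj by exact: exprn_gt0.
  apply: (@le_vanishing _ (fun n => e (n + k.+1)%N) _ _ dj^-1).
  - exact: vanishing_shift.
  - by rewrite invr_ge0 ltW.
  move=> n; set N := (n + k.+1)%N.
  have := @cauchy_poly _ (ptrunc a N)^`N(j) r (B / rho1 ^+ j + dj^-1 * e N) (k - j) (ltW r0).
  have kN : (k < N)%N by rewrite /N addnS ltnS leq_addl.
  rewrite coef_nderivn subnKC // coef_poly kN.
  rewrite -[a k *+ _]mulr_natl cabsM cabs_nat mulr_natl; apply => s sr.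
  have [|b [Hb1 Hb2]] := He s; first by rewrite sr.
  have [delta [b' [delta0 Hb' Bb']]] := Hd s sr.
  have E : b = b'.
    apply/funext; apply: (has_ps_uniq _ delta0 delta0 Hb1 Hb' (fun _ _ => erefl)).
    by rewrite sr subr_gt0.
  rewrite (_ : _.[s] = b j + ((ptrunc a N)^`N(j).[s] - b j)); last by ring.
  apply: le_trans (cabsD _ _) _; apply: lerD.
    by rewrite ler_pdivlMr ?exprn_gt0 // E.
  by rewrite mulrC ler_pdivlMr // Hb2.
have B0 : 0 <= B.
  have [|delta [b [_ _ /(_ 0%N)]]] := Hd (rC r); first by rewrite cabs_realp ?ltW.
  by rewrite expr0 mulr1; apply: le_trans; apply: cabs_ge0.
rewrite exprDn mulr_sumr.
apply: (@le_trans _ _ (\sum_(j < k.+1) B * (x / rho1) ^+ j)).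
  apply: ler_sum => j _; have jk : (j <= k)%N by rewrite -ltnS.
  rewrite expr_div_n mulrA mulrAC.
  rewrite (_ : cabs (a k) * _ = (cabs (a k) *+ 'C(k, j)) * r ^+ (k - j) * x ^+ j).
    by rewrite ler_wpM2r ?exprn_ge0 ?HC.
  by rewrite mulrnAr mulrA -!mulrnAl.
rewrite -mulr_sumr ler_wpM2l // geom_sum_le // divr_ge0 ?(ltW rho10) //=.
by rewrite ltr_pdivrMr // mul1r.
Qed.

(** [f1] is known only pointwise, as first local coefficient of [f]. Recentring exhibits it as the
    uniform limit of the derivatives of the truncations, so it has a series, whose coefficients are
    the limits of theirs. *)
Lemma has_ps_deriv f f1 rho a : 0 < rho -> has_ps f rho a ->
  (forall t, cabs t < rho -> exists (delta : R) b, [/\ 0 < delta,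
     has_ps (fun s => f (t + s)) delta b & b 1%N = f1 t]) ->
  has_ps f1 rho (fun k => k.+1%:R * a k.+1).
Proof.
move=> rho0 H H1.
suff loc r : 0 < r < rho -> has_ps f1 r (fun k => k.+1%:R * a k.+1).
  move=> r r0 rr; apply: (loc ((r + rho) / 2)) => //; last lra.
  by apply/andP; lra.
move=> /andP[r0 rr].
have [|e [ve e0 He]] := @has_ps_recenter_rate _ _ _ r H; first by rewrite ltW.
pose d := (rho - r) / 2; have d0 : 0 < d by rewrite /d; lra.
have ve' : vanishing (fun N => d^-1 * e N).
  by apply: vanishing_scale; rewrite // invr_ge0 ltW.
have [|c [Hc1 Hc2]] := @has_ps_unif _ (fun N => (ptrunc a N)^`N(1)) f1 _ r r0 ve'.
  move=> N s sr; have [b [Hb1 Hb2]] := He s sr.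
  have [|delta [b' [delta0 Hb' <-]]] := H1 s; first by apply: le_lt_trans rr.
  have -> : b' = b.
    apply/funext; apply: (has_ps_uniq _ _ delta0 Hb' Hb1 (fun _ _ => erefl)) => //.
    by rewrite subr_gt0 (le_lt_trans sr).
  by rewrite cabs_distC mulrC ler_pdivlMr //; have := Hb2 N 1%N; rewrite expr1.
suff -> : (fun k => k.+1%:R * a k.+1) = c by [].
apply/funext => k; apply/eqP; rewrite -subr_eq0 -cabs_eq0 eq_le cabs_ge0 andbT.
rewrite -(@ler_pM2r _ (r ^+ k)) ?exprn_gt0 // mul0r.
apply: (le_vanishing (vanishing_shift k.+2 ve') (ler0n R 2)) => N.
have := Hc2 (N + k.+2)%N k;
  have kN : (1 + k < N + k.+2)%N by rewrite add1n !addnS !ltnS leq_addl.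
by rewrite coef_nderivn coef_poly kN add1n bin1 add0r -[a _ *+ _]mulr_natl.
Qed.

End PowerSeriesTheory.

(** * Continuation to a full disc *)

Section Continuation.
Variable R : realType.
Local Notation rC := (real_complex R : R -> CC R).
Implicit Types (f g : CC R -> CC R) (a : nat -> CC R) (rho : R).

Lemma disc_uniform (P : nat -> CC R -> Prop) (r : R) :
  (forall m m' d, (m <= m')%N -> P m d -> P m' d) ->
  (forall d, cabs d <= r -> exists (delta : R) m, 0 < delta /\
     forall d', cabs (d' - d) < delta -> P m d') ->
  exists m, forall d, cabs d <= r -> P m d.
Proof.
(* The compact set is a square in real coordinates; its points outside the disc get a neighbourhood
   that misses the disc. *)
move=> Pmono Ploc; pose K := `[- r, r]%classic `*` `[- r, r]%classic.
have cK : compact (K : set (R * R)) by apply: compact_setX; apply: segment_compact.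
have := (iffLR (compact_near_coveringP K) cK) nat \oo
  (fun m (x : R * R) => cabs (Complex x.1 x.2) <= r -> P m (Complex x.1 x.2)) _ _.
case=> [x _|N _ /(_ N (leqnn N)) HN]; last first.
  exists N => -[x y] d; apply: (HN (x, y)) => //; split=> /=; rewrite in_itv /= -ler_norml.
    exact: le_trans (cabs_Re_le (Complex x y)) d.
  exact: le_trans (cabs_Im_le (Complex x y)) d.
have [xr|xr] := leP (cabs (Complex x.1 x.2)) r.
  have [delta [m [d0 Hm]]] := Ploc _ xr.
  exists (ball x (delta / 2), [set n | (m <= n)%N]).
    by split; [apply: nbhsx_ballx; rewrite divr_gt0 | exists m].
  move=> [y n] /= [[y1 y2] mn] _; apply: Pmono mn _; apply: Hm.
  apply: le_lt_trans (cabs_ReIm _) _ => /=; move: y1 y2; rewrite /ball /= => y1 y2.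
  by rewrite (distrC y.1) (distrC y.2); lra.
pose d := cabs (Complex x.1 x.2) - r; have d0 : 0 < d by rewrite subr_gt0.
exists (ball x (d / 2), setT).
  by split; [apply: nbhsx_ballx; rewrite divr_gt0 | exact: filterT].
move=> [y n] [[y1 y2] _] yr; exfalso.
have h : cabs (Complex x.1 x.2 - Complex y.1 y.2 : CC R) <= `|x.1 - y.1| + `|x.2 - y.2|.
  exact: (cabs_ReIm (Complex x.1 x.2 - Complex y.1 y.2 : CC R)).
have := cabs_dist (Complex x.1 x.2 : CC R) (Complex y.1 y.2) 0; rewrite !subr0 => h2.
have {}yr : cabs (Complex y.1 y.2) <= r by [].
have {}y1 : `|x.1 - y.1| < d / 2 by [].
have {}y2 : `|x.2 - y.2| < d / 2 by [].
by rewrite /d in y1 y2; lra.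
Qed.

Lemma local_ps_uniform f rho r : r < rho ->
  (forall d, cabs d < rho -> exists (delta : R) c,
    0 < delta /\ has_ps (fun s => f (d + s)) delta c) ->
  exists rho1 B : R, 0 < rho1 /\ forall d, cabs d <= r -> exists c,
    has_ps (fun s => f (d + s)) rho1 c /\ forall k, cabs (c k) * rho1 ^+ k <= B.
Proof.
move=> rr H.
(* One integer encodes both a radius and a bound for the coefficients, which makes the property
   monotone, as [disc_uniform] demands. *)
pose P m d := exists c, has_ps (fun s => f (d + s)) (m.+1%:R)^-1 c /\
  forall k, cabs (c k) * (m.+1%:R)^-1 ^+ k <= m%:R.
have [m m' d mm' [c [Hc1 Hc2]]||m Hm] := @disc_uniform P r; last first.
- by exists (m.+1%:R)^-1, m%:R; split=> //; rewrite invr_gt0 ltr0n.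
- move=> d dr; have [|delta [c [d0 Hc]]] := H d; first exact: le_lt_trans rr.
  have [|B HB] := @has_ps_bound _ _ _ _ (3 / 4 * delta) Hc; first by lra.
  pose m := maxn (Num.truncn (4 / delta)) (Num.truncn B).+1.
  have mB : B <= m%:R.
    apply: ltW; apply: lt_le_trans (truncnS_gt B) _.
    by rewrite ler_nat leq_maxr.
  have md : (m.+1%:R)^-1 <= delta / 4.
    rewrite -[leRHS]invrK lef_pV2 ?posrE ?invr_gt0 ?divr_gt0 ?ltr0n // invf_div.
    apply: ltW; apply: lt_le_trans (truncnS_gt _) _.
    by rewrite ler_nat ltnS leq_maxl.
  have md' : (m.+1%:R)^-1 <= 3 / 4 * delta by apply: le_trans md _; lra.
  have m0 : 0 <= (m.+1%:R)^-1 :> R by rewrite invr_ge0.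
  have md2 : (m.+1%:R)^-1 < 3 / 4 * delta by apply: le_lt_trans md _; lra.
  exists (delta / 4), m; split=> [|d' dd]; first by lra.
  have [|c' Hc'] := @has_ps_recenter _ _ _ _ (d' - d) Hc; first by lra.
  have Hc'' : has_ps (fun s => f (d' + s)) (3 / 4 * delta) c'.
    have le : 3 / 4 * delta <= delta - cabs (d' - d) by lra.
    apply: (has_ps_ext _ (has_ps_le le Hc')).
    by move=> s _; congr f; ring.
  exists c'; split; first exact: has_ps_le Hc''.
  move=> k; apply: le_trans mB; apply: (has_ps_cauchy Hc''); first by rewrite m0.
  move=> s sd; rewrite (_ : d' + s = d + (d' - d + s)); last by ring.
  apply: HB; apply: le_trans (cabsD _ _) _; rewrite sd.
  by apply: le_trans (lerD (ltW dd) md) _; lra.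
- have le1 : (m'.+1%:R)^-1 <= (m.+1%:R)^-1 :> R.
    by rewrite lef_pV2 ?posrE ?ltr0n // ler_nat.
  exists c; split; first exact: has_ps_le Hc1.
  move=> k; apply: (@le_trans _ _ m%:R); last by rewrite ler_nat.
  apply: le_trans (Hc2 k); rewrite ler_wpM2l ?cabs_ge0 //.
  by apply: lerXn2r; rewrite ?nnegrE ?invr_ge0.
Qed.

Lemma has_ps_eq f g rho rho' a s : has_ps f rho a -> has_ps g rho' a ->
  cabs s < rho -> cabs s < rho' -> f s = g s.
Proof.
move=> Hf Hg sr sr'; apply/eqP; rewrite -subr_eq0 -cabs_eq0 eq_le cabs_ge0 andbT.
have s0 := cabs_ge0 s; pose m := Num.min rho rho'.
have sm : cabs s < m by rewrite lt_min sr.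
pose t := (cabs s + m) / 2; have [st tm] : cabs s < t /\ t < m by rewrite /t; split; lra.
have t0 : 0 < t by lra.
move: (tm); rewrite lt_min => /andP[tr tr'].
have [C1 HC1] := Hf t t0 tr; have [C2 HC2] := Hg t t0 tr'.
have q01 : 0 <= cabs s / t < 1 by rewrite divr_ge0 ?(ltW t0) //= ltr_pdivrMr // mul1r.
apply: (le_vanishing (vanishing_geom (C1 + C2) q01) ler01) => n.
rewrite add0r mul1r mulrDl.
apply: le_trans (cabs_dist _ (psum a n s) _) _; rewrite [X in _ + X]cabs_distC.
by apply: lerD; [apply: HC1|apply: HC2]; rewrite ltW.
Qed.

(** Takes the place of Cauchy's integral formula. On a smaller disc the local expansions share a
    radius [x1] and a bound, so that the series at the origin can be extended by a fixed amount
    again and again. *)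
Lemma has_ps_global f rho : 0 < rho ->
  (forall d, cabs d < rho -> exists (delta : R) c,
    0 < delta /\ has_ps (fun s => f (d + s)) delta c) ->
  exists a, has_ps f rho a.
Proof.
move=> rho0 H; have [|delta [a [delta0 Ha0]]] := H 0; first by rewrite cabs0.
have {}Ha0 : has_ps f delta a by apply: has_ps_ext Ha0 => s _; rewrite add0r.
apply: has_ps_exhaust => // r /andP[r0 rr].
have [x1 [B [x0 HB]]] := local_ps_uniform rr H.
suff ind n : has_ps f (Num.min r (delta + n%:R * (x1 / 4))) a.
  exists a; pose n := (Num.truncn (r / (x1 / 4))).+1.
  apply: has_ps_le (ind n); rewrite le_min lexx /=.
  have : r / (x1 / 4) <= n%:R by apply: ltW; apply: truncnS_gt.
  by rewrite ler_pdivrMr; lra.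
elim: n => [|n IHn].
  by apply: has_ps_le Ha0; rewrite mul0r addr0 ge_min lexx orbT.
have [rn|rn] := leP r (delta + n%:R * (x1 / 4)).
  by move: IHn; rewrite min_l // => IHn; apply: has_ps_le IHn; rewrite ge_min lexx.
move: IHn; rewrite min_r ?(ltW rn) //; set rn' := _ + _ in rn * => IHn.
have rn0 : 0 < rn'.
  by rewrite /rn' ltr_wpDr // mulr_ge0 // divr_ge0 // ltW.
(* A circle of positive radius inside the present disc, at most [x1 / 4] from its boundary: reaching
   [3 / 4 * x1] beyond it is a true gain. *)
pose r' := Num.max (rn' / 2) (rn' - x1 / 4).
have r'0 : 0 < r' by rewrite lt_max divr_gt0.
have r'n : r' < rn' by rewrite gt_max; apply/andP; lra.
have r'x : rn' - x1 / 4 <= r' by rewrite le_max lexx orbT.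
apply: (@has_ps_le _ _ (r' + 3 / 4 * x1)).
  by rewrite ge_min; apply/orP; right; rewrite /rn' in r'x *; rewrite -natr1; lra.
have coef := @has_ps_coef_extend _ _ _ _ r' x1 B (3 / 4 * x1) IHn.
have {}coef k : cabs (a k) * (r' + 3 / 4 * x1) ^+ k <= B / (1 - 3 / 4 * x1 / x1).
  apply: coef; rewrite ?r'0 ?r'n //; first by apply/andP; lra.
  move=> d dr; have [|c [Hc1 Hc2]] := HB d; first by lra.
  by exists x1, c.
have R0 : 0 < r' + 3 / 4 * x1 by lra.
have [g Hg] := has_ps_exists R0 coef.
have fg s : cabs s < rn' -> f s = g s.
  by move=> sr; apply: (has_ps_eq IHn Hg) => //; lra.
apply: (has_ps_ext _ Hg) => s sr.
have [sn|sn] := ltP (cabs s) rn'; first by rewrite fg.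
have s0 : 0 < cabs s by apply: lt_le_trans sn.
(* Radial projection of [s] to the inner circle. Near [d] the functions [f] and [g] agree, so their
   local series coincide, and [s] is within reach of both. *)
pose d := rC (r' / cabs s) * s.
have dr : cabs d = r'.
  by rewrite cabsM cabs_realp ?divr_ge0 ?(ltW r'0) ?cabs_ge0 // divfK ?gt_eqF.
have sd : cabs (s - d) = cabs s - r'.
  rewrite (_ : s - d = rC (1 - r' / cabs s) * s); last by rewrite rmorphB rmorph1 /d; ring.
  rewrite cabsM cabs_realp; first by rewrite mulrBl mul1r divfK ?gt_eqF.
  by rewrite subr_ge0 ler_pdivrMr // mul1r; lra.
have [|c [Hc _]] := HB d; first by lra.
have [|c' Hc'] := @has_ps_recenter _ _ _ _ d Hg; first by lra.
have cc' : c = c'.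
  apply/funext; apply: (has_ps_uniq (delta := rn' - r') _ _ _ Hc Hc') => //.
  - by rewrite dr; lra.
  - by rewrite subr_gt0.
  by move=> u ur; rewrite fg //; apply: le_lt_trans (cabsD _ _) _; lra.
rewrite -(subrK d s) [s - d + d]addrC; rewrite -cc' in Hc'.
by symmetry; apply: (has_ps_eq Hc Hc'); rewrite ?dr ?sd; lra.
Qed.

End Continuation.

(** * Functions analytic in several variables *)

Section Euclid.
Variables (R : realType) (n : nat).
Implicit Types (z w v : 'rV[CC R]_n).
Local Notation rC := (real_complex R : R -> CC R).

Lemma enorm_ge0 z : 0 <= enorm z.
Proof. exact: sqrtr_ge0. Qed.

Lemma enormZ t z : enorm (t *: z) = cabs t * enorm z.
Proof.
rewrite /enorm; under eq_bigr do rewrite mxE cabsM exprMn.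
by rewrite -mulr_sumr sqrtrM ?sqr_ge0 // sqrtr_sqr ger0_norm // cabs_ge0.
Qed.

Lemma enorm_coord z j : cabs (z 0 j) <= enorm z.
Proof.
rewrite -[leLHS]ger0_norm ?cabs_ge0 // -sqrtr_sqr; apply: ler_wsqrtr.
by rewrite (bigD1 j) //= lerDl sumr_ge0 // => i _; rewrite sqr_ge0.
Qed.

Lemma sum_cauchy_schwarz (x y : 'I_n -> R) :
  (\sum_i x i * y i) ^+ 2 <= (\sum_i x i ^+ 2) * (\sum_i y i ^+ 2).
Proof.
set P := \sum_i x i * y i; set X := \sum_i x i ^+ 2; set Y := \sum_i y i ^+ 2.
have Y0 : 0 <= Y by apply: sumr_ge0 => i _; rewrite sqr_ge0.
have [Yp|] := ltP 0 Y; last first.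
  move=> Yn; have Yz : Y = 0 by apply/eqP; rewrite eq_le Yn.
  have yz i : y i = 0.
    apply/eqP; rewrite -sqrf_eq0.
    move: Yz => /eqP; rewrite psumr_eq0; last by move=> j _; rewrite sqr_ge0.
    by move=> /allP/(_ i (mem_index_enum i)) /=.
  by rewrite /P big1 ?expr0n /= ?Yz ?mulr0 // => i _; rewrite yz mulr0.
have : 0 <= \sum_i (Y * x i - P * y i) ^+ 2 by apply: sumr_ge0 => i _; rewrite sqr_ge0.
have -> : \sum_i (Y * x i - P * y i) ^+ 2 = Y * (X * Y - P ^+ 2).
  rewrite (eq_bigr (fun i => Y ^+ 2 * x i ^+ 2 + (- (2 * Y * P)) * (x i * y i)
    + P ^+ 2 * y i ^+ 2)); last by move=> i _; ring.
  by rewrite !big_split /= -!mulr_sumr -/X -/Y -/P; ring.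
by rewrite pmulr_rge0 // subr_ge0.
Qed.

Lemma enormD z w : enorm (z + w) <= enorm z + enorm w.
Proof.
rewrite -[leRHS]ger0_norm ?addr_ge0 ?enorm_ge0 // -sqrtr_sqr; apply: ler_wsqrtr.
pose x i := cabs (z 0 i); pose y i := cabs (w 0 i).
have s0 (u : 'I_n -> R) : 0 <= \sum_i u i ^+ 2 by apply: sumr_ge0 => i _; rewrite sqr_ge0.
rewrite sqrrD !sqr_sqrtr ?s0 // -sqrtrM ?s0 //.
apply: (@le_trans _ _ (\sum_i (x i + y i) ^+ 2)).
  apply: ler_sum => i _; rewrite mxE; apply: lerXn2r; rewrite ?nnegrE ?cabs_ge0 ?cabsD //.
  by rewrite addr_ge0 ?cabs_ge0.
under eq_bigr do rewrite sqrrD.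
rewrite !big_split /= lerD2r lerD2l -mulr2n lerMn2r /=.
apply: le_trans (ler_norm _) _; rewrite -sqrtr_sqr; apply: ler_wsqrtr.
exact: sum_cauchy_schwarz.
Qed.

End Euclid.

Section PolynomialFunctions.
Variables (R : realType) (n : nat).
Implicit Types (z w v : 'rV[CC R]_n) (Q : 'rV[CC R]_n -> CC R).

Inductive polfun : ('rV[CC R]_n -> CC R) -> Prop :=
| polfun_cst c : polfun (fun _ => c)
| polfun_coord j : polfun (fun z => z 0 j)
| polfun_add Q1 Q2 : polfun Q1 -> polfun Q2 -> polfun (fun z => Q1 z + Q2 z)
| polfun_mul Q1 Q2 : polfun Q1 -> polfun Q2 -> polfun (fun z => Q1 z * Q2 z).

Lemma polfun_sum (I : Type) (r : seq I) (P : pred I) (Q : I -> 'rV[CC R]_n -> CC R) :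
  (forall i, polfun (Q i)) -> polfun (fun z => \sum_(i <- r | P i) Q i z).
Proof.
move=> HQ; elim: r => [|i r IHr].
  by under eq_fun do rewrite big_nil; exact: polfun_cst.
under eq_fun do rewrite big_cons; case: (P i) => //.
exact: polfun_add.
Qed.

Lemma polfun_prod (I : Type) (r : seq I) (P : pred I) (Q : I -> 'rV[CC R]_n -> CC R) :
  (forall i, polfun (Q i)) -> polfun (fun z => \prod_(i <- r | P i) Q i z).
Proof.
move=> HQ; elim: r => [|i r IHr].
  by under eq_fun do rewrite big_nil; exact: polfun_cst.
under eq_fun do rewrite big_cons; case: (P i) => //.
exact: polfun_mul.
Qed.

Lemma polfun_exp Q k : polfun Q -> polfun (fun z => Q z ^+ k).
Proof.
move=> HQ; elim: k => [|k IHk].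
  by under eq_fun do rewrite expr0; exact: polfun_cst.
by under eq_fun do rewrite exprS; exact: polfun_mul.
Qed.

(** The chain rule for polynomials. The gradient [D] does not depend on the direction [v], and this
    is the fact that has to survive the passage to limits. *)
Lemma polfun_grad Q : polfun Q ->
  exists D : 'I_n -> 'rV[CC R]_n -> CC R, (forall j, polfun (D j)) /\
    forall z v, exists p : {poly CC R}, (forall t, Q (z + t *: v) = p.[t]) /\
      p`_1 = \sum_j D j z * v 0 j.
Proof.
elim=> {Q} [c|j|Q1 Q2 _ [D1 [P1 H1]] _ [D2 [P2 H2]]|Q1 Q2 HQ1 [D1 [P1 H1]] HQ2 [D2 [P2 H2]]].
- exists (fun _ _ => 0); split=> [j|z v]; first exact: polfun_cst.
  exists c%:P; split=> [t|]; first by rewrite hornerC.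
  by rewrite coefC /= big1 // => j _; rewrite mul0r.
- exists (fun i _ => (i == j)%:R); split=> [i|z v]; first exact: polfun_cst.
  exists ((z 0 j)%:P + (v 0 j)%:P * 'X); split=> [t|].
    by rewrite !hornerE !mxE mulrC.
  rewrite coefD coefCM coefX coefC /= add0r mulr1 (bigD1 j) //= eqxx mul1r big1 ?addr0 //.
  by move=> i /negPf ->; rewrite mul0r.
- exists (fun j z => D1 j z + D2 j z); split=> [j|z v]; first exact: polfun_add.
  have [p1 [E1 F1]] := H1 z v; have [p2 [E2 F2]] := H2 z v.
  exists (p1 + p2); split=> [t|]; first by rewrite hornerD E1 E2.
  by rewrite coefD F1 F2 -big_split; apply: eq_bigr => j _; rewrite mulrDl.
- exists (fun j z => D1 j z * Q2 z + Q1 z * D2 j z); split=> [j|z v].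
    by apply: polfun_add; apply: polfun_mul.
  have [p1 [E1 F1]] := H1 z v; have [p2 [E2 F2]] := H2 z v.
  exists (p1 * p2); split=> [t|]; first by rewrite hornerM E1 E2.
  have E10 : p1`_0 = Q1 z by rewrite -horner_coef0 -E1 scale0r addr0.
  have E20 : p2`_0 = Q2 z by rewrite -horner_coef0 -E2 scale0r addr0.
  rewrite coefM !big_ord_recl big_ord0 addr0 /= /bump /= addn0 subn0 subnn.
  rewrite E10 E20 F1 F2 mulr_sumr mulr_suml -big_split /=.
  by apply: eq_bigr => j _; ring.
Qed.

(* Local uniform approximability by polynomials: unlike convergence of a
   multi-index series, it passes to derivatives without rearranging sums. *)
Definition lup (F : 'rV[CC R]_n -> CC R) (a : 'rV[CC R]_n) :=
  exists (r : R) (Q : nat -> 'rV[CC R]_n -> CC R) (e : nat -> R),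
    [/\ 0 < r, forall N, polfun (Q N), vanishing e &
        forall N w, enorm w < r -> cabs (F (a + w) - Q N (a + w)) <= e N].

Local Notation natffun N al := ([ffun j => (al : {ffun 'I_n -> 'I_N}) j : nat]).

(** Places the smaller box of multi-indices inside the larger one, so that a difference of partial
    sums becomes a sum over the remaining indices. *)
Lemma box_reindex (V : zmodType) (phi : {ffun 'I_n -> nat} -> V) (N M : nat) :
  (N <= M)%N ->
  \sum_(al : {ffun 'I_n -> 'I_N}) phi (natffun N al) =
  \sum_(al : {ffun 'I_n -> 'I_M} | [forall j, (al j < N)%N]) phi (natffun M al).
Proof.
move=> NM.
pose w (al : {ffun 'I_n -> 'I_N}) : {ffun 'I_n -> 'I_M} := [ffun j => widen_ord NM (al j)].
have winj : injective w.
  move=> al be /ffunP E; apply/ffunP => j; apply/val_inj.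
  by have := congr1 val (E j); rewrite !ffunE.
have -> : \sum_(al : {ffun 'I_n -> 'I_M} | [forall j, (al j < N)%N]) phi (natffun M al) =
   \sum_(be in (w @: predT)%SET) phi (natffun M be).
  apply: eq_bigl => be; apply/forallP/imsetP => [H|[al _ ->] j]; last first.
    by rewrite ffunE /= ltn_ord.
  exists [ffun j => Ordinal (H j)] => //.
  by apply/ffunP => j; rewrite !ffunE; apply/val_inj.
rewrite big_imset /=; last by move=> x y _ _; apply: winj.
apply: eq_bigr => al _.
by congr phi; apply/ffunP => j; rewrite !ffunE.
Qed.

Lemma summable_box_bounded (u : {ffun 'I_n -> nat} -> R) : (forall al, 0 <= u al) ->
  summable setT (fun al => (u al)%:E) ->
  exists S : R, forall N, \sum_(al : {ffun 'I_n -> 'I_N}) u (natffun N al) <= S.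
Proof.
move=> u0 Su; have Sfin : \esum_(x in setT) `|(u x)%:E|%E \is a fin_num.
  by rewrite ge0_fin_numE // esum_ge0.
exists (fine (\esum_(x in setT) `|(u x)%:E|%E)) => N.
rewrite -lee_fin fineK //; apply: ereal_sup_ubound.
pose s := [seq natffun N al | al : {ffun 'I_n -> 'I_N}].
exists [set` s]; first by split=> //; exact: finite_seq.
have us : uniq s.
  rewrite map_inj_uniq ?enum_uniq // => al be /ffunP E; apply/ffunP => j; apply/val_inj.
  by have := E j; rewrite !ffunE.
rewrite -fsbig_seq // big_map big_enum /= -sumEFin.
by apply: eq_bigr => al _; rewrite /= ger0_norm.
Qed.

(** Absolute convergence at the single point [W], all of whose coordinates are [x], dominates the
    series at every [w] of norm below [x]; the error is the tail of the series at [W]. The factor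
    [n.+1] in [x] keeps [W] in the ball and is nonzero even for [n = 0]. *)
Lemma analytic_lup (F : 'rV[CC R]_n -> CC R) a : analytic_at F a -> lup F a.
Proof.
move=> [r [c [r0 H]]]; pose x := r / (2 * n.+1%:R).
have x0 : 0 < x by rewrite divr_gt0 // mulr_gt0.
pose W : 'rV[CC R]_n := \row_j real_complex R x.
have xle : x <= r / 2.
  rewrite /x invfM mulrA ler_piMr ?divr_ge0 ?(ltW r0) // invf_le1 ?ltr0n //.
  by rewrite ler1n.
have Wr : enorm W < r.
  apply: (@le_lt_trans _ _ (r / 2)); last by lra.
  rewrite -[leRHS]ger0_norm ?divr_ge0 ?(ltW r0) // -sqrtr_sqr; apply: ler_wsqrtr.
  under eq_bigr do rewrite mxE cabs_realp ?(ltW x0) //.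
  rewrite sumr_const card_ord -[leLHS]mulr_natr.
  have -> : (r / 2) ^+ 2 = x ^+ 2 * n.+1%:R ^+ 2.
    by rewrite -exprMn; congr (_ ^+ 2); rewrite /x invfM mulrA divfK // pnatr_eq0.
  rewrite ler_wpM2l ?sqr_ge0 // -natrX ler_nat.
  by rewrite (leq_trans (leqnSn n)) // expnS expn1 leq_pmull.
have [SW _] := H W Wr.
pose psi al := cabs (c al * monomial al W).
have psi0 al : 0 <= psi al by apply: cabs_ge0.
have [S HS] := summable_box_bounded psi0 SW.
pose SN N := \sum_(al : {ffun 'I_n -> 'I_N}) psi (natffun N al).
pose phi w al := c al * monomial al w.
pose FN w N := \sum_(al : {ffun 'I_n -> 'I_N}) phi w (natffun N al).
have phile w al : enorm w < x -> cabs (phi w al) <= psi al.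
  move=> wx; rewrite /phi /psi !cabsM ler_wpM2l ?cabs_ge0 // !cabs_prod.
  apply: ler_prod => j _; rewrite cabs_ge0 /= !cabsX mxE cabs_realp ?(ltW x0) //.
  apply: lerXn2r; rewrite ?nnegrE ?cabs_ge0 ?(ltW x0) //.
  exact: le_trans (enorm_coord _ _) (ltW wx).
have diff w N M : enorm w < x -> (N <= M)%N -> cabs (FN w M - FN w N) <= SN M - SN N.
  move=> wx NM; rewrite /FN /SN !(box_reindex _ NM).
  rewrite (bigID (fun al : {ffun 'I_n -> 'I_M} => [forall j, (al j < N)%N])) /=.
  rewrite [\sum_(al : {ffun 'I_n -> 'I_M}) psi _](bigID (fun al : {ffun 'I_n ->
    'I_M} => [forall j, (al j < N)%N])) /=.
  rewrite ![_ + _ - _]addrAC !subrr !add0r; apply: le_trans (cabs_sum _ _ _) _.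
  by apply: ler_sum => al _; apply: phile.
have SNm N M : (N <= M)%N -> SN N <= SN M.
  move=> NM; rewrite -subr_ge0; apply: le_trans (diff 0 N M _ NM); first exact: cabs_ge0.
  by rewrite -(scale0r 0) enormZ cabs0 mul0r.
pose E := [set SN N | N in [set: nat]].
have E0 : E !=set0 by exists (SN 0%N), 0%N.
have Eub : has_ubound E by exists S => _ [N _ <-]; exact: HS.
exists x, (fun N z => FN (z - a) N), (fun N => sup E - SN N); split=> //.
- move=> N; apply: polfun_sum => al; apply: polfun_mul; first exact: polfun_cst.
  apply: polfun_prod => j; apply: polfun_exp.
  under eq_fun do rewrite !mxE.
  by apply: polfun_add; [exact: polfun_coord | exact: polfun_cst].
- move=> eps e0; have [|_ [N _ <-] HN] := @sup_adherent _ E eps e0; first by split.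
  by exists N => M /SNm; lra.
move=> N w wx; rewrite [a + w]addrC addrK addrC.
have wr : enorm w < r by apply: lt_trans wx _; lra.
have [_ /cvgrPdist_le cv] := H w wr.
apply/ler_addgt0Pr => eps e0.
have eC : 0 < real_complex R eps by rewrite (rC_lt 0).
have [M0 _ HM] := cv _ eC; pose M := maxn M0 N.
have := HM M (leq_maxl _ _); rewrite normE rC_le => h.
apply: le_trans (cabs_dist _ (FN w M) _) _; rewrite [leLHS]addrC; apply: lerD.
  apply: le_trans (diff w N M wx (leq_maxr _ _)) _.
  by rewrite lerD2r; apply: ub_le_sup => //; exists M.
exact: h.
Qed.

End PolynomialFunctions.

(** * Taylor expansion along complex lines *)

Section DirectionalTaylor.
Variables (R : realType) (n : nat).
Implicit Types (z w v a b : 'rV[CC R]_n) (F : 'rV[CC R]_n -> CC R).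
Local Notation rC := (real_complex R : R -> CC R).

Lemma gt0_rC (e : CC R) : 0 < e -> exists2 e' : R, 0 < e' & e = rC e'.
Proof.
move=> e0; have /complex_realP[k ek] := gtr0_real e0.
by exists k => //; move: e0; rewrite ek (rC_lt 0).
Qed.

Lemma has_ps_is_derive F a v (delta : R) (c : nat -> CC R) : 0 < delta ->
  has_ps (fun t => F (a + t *: v)) delta c -> is_derive a v F (c 1%N).
Proof.
move=> d0 H; have Fa : F a = c 0%N by rewrite -(has_ps0 d0 H) scale0r addr0.
suff cv : (fun h => h^-1 *: ((F \o shift a) (h *: v) - F a)) @ 0^' --> c 1%N.
  by apply: DeriveDef; [apply/cvg_ex; exists (c 1%N) | exact: cvg_lim].
have [||B HB] := H (delta / 2); rewrite ?divr_gt0 //; first by lra.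
set r := delta / 2 in HB; have r0 : 0 < r by rewrite divr_gt0.
apply/cvgrPdist_le => _ /gt0_rC[e e0 ->].
pose eta := Num.min r (e * r ^+ 2 / (`|B| + 1)).
have B0 : 0 <= `|B| by [].
have eta0 : 0 < eta.
  by rewrite lt_min r0 divr_gt0 ?mulr_gt0 ?exprn_gt0 // ltr_wpDl.
have etaC : 0 < rC eta by rewrite (rC_lt 0).
near=> h.
have h0 : h != 0 by near: h; exact: nbhs_dnbhs_neq.
have : `|h| < rC eta by near: h; exact: dnbhs0_lt.
rewrite normE rC_lt lt_min => /andP[hr he].
rewrite normE rC_le /= [h *: v + a]addrC cabs_distC.
have ch : 0 < cabs h by rewrite cabs_gt0.
have := HB 2%N h (ltW hr);
  rewrite /psum !big_ord_recl big_ord0 /= /bump /= expr0 mulr1 expr1 addr0 -Fa.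
move=> Hh; rewrite -(@ler_pM2l _ (cabs h)) // -cabsM.
rewrite (_ : h * _ = F (a + h *: v) - (F a + c 1%N * h)); last first.
  by rewrite mulrBr /GRing.scale /= mulrA divff // mul1r; ring.
apply: le_trans Hh _; apply: (@le_trans _ _ (`|B| * (cabs h / r) ^+ 2)).
  by rewrite ler_wpM2r ?sqr_ge0 ?ler_norm.
rewrite ltr_pdivlMr in he; last by rewrite ltr_wpDl.
rewrite (_ : `|B| * _ = cabs h * (`|B| * cabs h / r ^+ 2)); last first.
  by rewrite expr_div_n; ring.
rewrite ler_wpM2l ?(ltW ch) // ler_pdivrMr ?exprn_gt0 //; nra.
Unshelve. all: by end_near. Qed.

Lemma dirscale_lt (r : R) v : 0 < r ->
  exists2 delta : R, 0 < delta & forall t, cabs t <= delta -> enorm (t *: v) < r.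
Proof.
move=> r0; have v1 : 0 < enorm v + 1 by rewrite ltr_wpDl // enorm_ge0.
exists (r / (2 * (enorm v + 1))); first by rewrite divr_gt0 // mulr_gt0.
move=> t tr; rewrite enormZ;
  apply: (@le_lt_trans _ _ (r / (2 * (enorm v + 1)) * (enorm v + 1))).
  by apply: ler_pM; rewrite ?cabs_ge0 ?enorm_ge0 // lerDl.
by rewrite invfM mulrA divfK ?gt_eqF //; lra.
Qed.

(** [dirD] is built from partial derivatives, the series from a line. For the approximating
    polynomials the first coefficient is linear in [v]; both sides converge at the rate [e], and the
    coordinate directions determine [G]. *)
Lemma lup_gradient F a : lup F a -> exists G : 'I_n -> CC R, forall v,
  exists (delta : R) c, [/\ 0 < delta, has_ps (fun t => F (a + t *: v)) delta c &
    c 1%N = \sum_j G j * v 0 j].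
Proof.
move=> [r [Q [e [r0 Qp ve He]]]].
have /choice[D HD] : forall N, exists D : 'I_n -> 'rV[CC R]_n -> CC R,
    (forall j, polfun (D j)) /\
    forall z v, exists p : {poly CC R}, (forall t, Q N (z + t *: v) = p.[t]) /\
      p`_1 = \sum_j D j z * v 0 j by move=> N; exact: polfun_grad.
have e0 N : 0 <= e N.
  apply: le_trans (He N 0 _); first exact: cabs_ge0.
  by rewrite -(scale0r 0) enormZ cabs0 mul0r.
have loc v : exists (delta : R) c, [/\ 0 < delta, has_ps (fun t => F (a + t *: v)) delta c &
   forall N, cabs (\sum_j D N j a * v 0 j - c 1%N) <= 2 / delta * e N].
  have [delta d0 Hd] := dirscale_lt v r0.
  have /choice[p Hp] : forall N, exists p : {poly CC R},
      (forall t, Q N (a + t *: v) = p.[t]) /\ p`_1 = \sum_j D N j a * v 0 j.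
    by move=> N; have [_] := HD N; apply.
  have [|c [Hc1 Hc2]] := @has_ps_unif _ p (fun t => F (a + t *: v)) e delta d0 ve.
    by move=> N s sd; have [<- _] := Hp N; apply: He; apply: Hd.
  exists delta, c; split=> // N; have := Hc2 N 1%N; have [_ ->] := Hp N.
  by rewrite expr1 -ler_pdivlMr // mulrAC.
have /choice[G HG] : forall j, exists g : CC R, exists2 K : R, 0 <= K &
    forall N, cabs (D N j a - g) <= K * e N.
  move=> j; have [delta [c [d0 _ Hc]]] := loc (delta_mx 0 j).
  exists (c 1%N), (2 / delta); first by rewrite divr_ge0 // ltW.
  move=> N; have := Hc N; rewrite (bigD1 j) //= mxE !eqxx mulr1 big1 ?addr0 //.
  by move=> i ij; rewrite mxE (negPf ij) andbF mulr0.
exists G => v; have [delta [c [d0 Hc1 Hc2]]] := loc v.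
exists delta, c; split=> //; apply/eqP; rewrite -subr_eq0 -cabs_eq0 eq_le cabs_ge0 andbT.
have /choice[K HK] : forall j, exists K : R, 0 <= K /\ forall N,
  cabs (D N j a - G j) <= K * e N.
  by move=> j; have [K K0 HK] := HG j; exists K.
apply: (le_vanishing (K := 2 / delta + \sum_j K j * cabs (v 0 j)) ve).
  rewrite addr_ge0 ?divr_ge0 ?(ltW d0) // sumr_ge0 // => j _.
  by rewrite mulr_ge0 ?cabs_ge0 //; case: (HK j).
move=> N; rewrite add0r mulrDl.
apply: le_trans (cabs_dist _ (\sum_j D N j a * v 0 j) _) _; rewrite cabs_distC.
apply: lerD; first exact: Hc2.
rewrite -sumrB mulr_suml; apply: le_trans (cabs_sum _ _ _) _; apply: ler_sum => j _.
rewrite -mulrBl cabsM mulrAC ler_wpM2r ?cabs_ge0 //.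
by have [_] := HK j; apply.
Qed.

Lemma lup_dirD F a v : lup F a -> exists (delta : R) c,
  [/\ 0 < delta, has_ps (fun t => F (a + t *: v)) delta c & c 1%N = dirD v F a].
Proof.
move=> /lup_gradient[G HG].
have E j : 'D_(delta_mx 0 j) F a = G j.
  have [delta [c [d0 Hc c1]]] := HG (delta_mx 0 j).
  have [_ ->] := has_ps_is_derive d0 Hc.
  rewrite c1 (bigD1 j) //= mxE !eqxx mulr1 big1 ?addr0 //.
  by move=> i ij; rewrite mxE (negPf ij) andbF mulr0.
have [delta [c [d0 Hc c1]]] := HG v.
by exists delta, c; split=> //; rewrite c1; apply: eq_bigr => j _; rewrite E.
Qed.

Lemma lup_is_derive F a v : lup F a -> is_derive a v F (dirD v F a).
Proof.
by move=> /(@lup_dirD _ _ v)[delta [c [d0 Hc <-]]]; apply: has_ps_is_derive Hc.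
Qed.

Lemma lup_shift F a : lup F a -> exists2 r : R, 0 < r & forall w, enorm w < r -> lup F (a + w).
Proof.
move=> [r [Q [e [r0 Qp ve He]]]]; exists (r / 2); first by rewrite divr_gt0.
move=> w wr; exists (r / 2), Q, e; split=> //; first by rewrite divr_gt0.
move=> N w' wr'; rewrite -addrA; apply: He; apply: le_lt_trans (enormD _ _) _; lra.
Qed.

(** At every point near [a] the line in the direction [b] stays for a common time [delta] where the
    polynomials approximate [F], so Cauchy's estimate controls the derivatives uniformly. *)
Lemma dirD_lup b F a : lup F a -> lup (dirD b F) a.
Proof.
move=> HF; have [r' r'0 Hr'] := lup_shift HF.
case: HF => r [Q [e [r0 Qp ve He]]].
have /choice[D HD] : forall N, exists D : 'I_n -> 'rV[CC R]_n -> CC R,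
    (forall j, polfun (D j)) /\
    forall z v, exists p : {poly CC R}, (forall t, Q N (z + t *: v) = p.[t]) /\
      p`_1 = \sum_j D j z * v 0 j by move=> N; exact: polfun_grad.
have r20 : 0 < r / 2 by rewrite divr_gt0.
have [delta d0 Hd] := dirscale_lt b r20.
exists (Num.min r' (r / 2)), (fun N z => \sum_j D N j z * b 0 j), (fun N => 2 / delta * e N).
split.
- by rewrite lt_min r'0.
- move=> N; apply: polfun_sum => j; apply: polfun_mul; last exact: polfun_cst.
  by case: (HD N).
- by apply: vanishing_scale ve; rewrite divr_ge0 // ltW.
move=> N w; rewrite lt_min => /andP[/Hr' Hw wr].
have /choice[p Hp] : forall N, exists p : {poly CC R},
    (forall t, Q N (a + w + t *: b) = p.[t]) /\ p`_1 = \sum_j D N j (a + w) * b 0 j.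
  by move=> m; have [_] := HD m; apply.
have [|c [Hc1 Hc2]] := @has_ps_unif _ p (fun t => F (a + w + t *: b)) e delta d0 ve.
  move=> m s sd; have [<- _] := Hp m; rewrite -addrA; apply: He.
  by apply: le_lt_trans (enormD _ _) _; have := Hd s sd; lra.
have [delta' [c' [d'0 Hc' <-]]] := lup_dirD b Hw.
rewrite -(has_ps_uniq d0 d'0 ltr01 Hc1 Hc' (fun _ _ => erefl) 1%N).
have := Hc2 N 1%N; have [_ ->] := Hp N.
by rewrite expr1 -ler_pdivlMr // mulrAC cabs_distC.
Qed.

Definition lup_ball F := forall a, @unit_ball R n a -> lup F a.

Lemma dirD_lup_ball b F : lup_ball F -> lup_ball (dirD b F).
Proof. by move=> H a /H; exact: dirD_lup. Qed.

Lemma dirDn_lup_ball b F k : lup_ball F -> lup_ball (dirDn b k F).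
Proof. by move=> H; elim: k => //= k; exact: dirD_lup_ball. Qed.

Lemma unit_ball_shift z w : unit_ball z -> enorm w < 1 - enorm z -> unit_ball (z + w).
Proof. by move=> zB wz; apply: le_lt_trans (enormD _ _) _; lra. Qed.

(** Induction on [k] for all [F] at once: the termwise derivative is the series of [dirD v F], to
    which the induction hypothesis applies. The radius is reduced to keep the line inside the
    ball. *)
Lemma slice_ps_coef F z v (delta : R) c k : lup_ball F -> unit_ball z -> 0 < delta ->
  has_ps (fun t => F (z + t *: v)) delta c -> c k = dirDn v k F z / k`!%:R.
Proof.
move=> HF zB d0; elim: k F HF delta d0 c => [|k IHk] F HF delta d0 c Hc.
  by rewrite -(has_ps0 d0 Hc) scale0r addr0 fact0 divr1.
have z1 : 0 < 1 - enorm z by rewrite subr_gt0.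
have [d1 d10 Hd1] := dirscale_lt v z1.
pose d := Num.min delta d1.
have dd0 : 0 < d by rewrite lt_min d0.
have Hcd : has_ps (fun t => F (z + t *: v)) d c by apply: has_ps_le Hc; rewrite ge_min lexx.
have H1 : has_ps (fun t => dirD v F (z + t *: v)) d (fun k => k.+1%:R * c k.+1).
  apply: (has_ps_deriv dd0 Hcd) => t; rewrite lt_min => /andP[_ /ltW /Hd1 td].
  have [delta' [c' [d'0 Hc' c'1]]] := lup_dirD v (HF _ (unit_ball_shift zB td)).
  exists delta', c'; split=> //; apply: (has_ps_ext _ Hc') => s _.
  by rewrite scalerDl addrA.
have := IHk _ (dirD_lup_ball v HF) d dd0 _ H1; rewrite /dirDn -iterSr => E.
apply: (@mulfI _ k.+1%:R); first by rewrite pnatr_eq0.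
rewrite E factS natrM invfM [RHS]mulrCA; congr (_ * _).
by rewrite mulrA divff ?mul1r // pnatr_eq0.
Qed.

Lemma slice_ps F z v (rho : R) : lup_ball F -> unit_ball z -> 0 < rho ->
  rho * enorm v <= 1 - enorm z ->
  has_ps (fun t => F (z + t *: v)) rho (fun k => dirDn v k F z / k`!%:R).
Proof.
move=> HF zB r0 rz.
have [|a Ha] := @has_ps_global _ (fun t => F (z + t *: v)) rho r0; last first.
  have <- : a = (fun k => dirDn v k F z / k`!%:R) by apply/funext => k; exact: slice_ps_coef Ha.
  exact: Ha.
move=> d dr; have dB : unit_ball (z + d *: v).
  apply: unit_ball_shift => //; rewrite enormZ.
  have [v0|v0] := ltP 0 (enorm v); first by apply: lt_le_trans rz; rewrite ltr_pM2r.
  have -> : enorm v = 0 by apply/eqP; rewrite eq_le v0 enorm_ge0.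
  by rewrite mulr0 subr_gt0.
have [delta' [c' [d'0 Hc' _]]] := lup_dirD v (HF _ dB).
exists delta', c'; split=> //; apply: (has_ps_ext _ Hc') => s _.
by rewrite scalerDl addrA.
Qed.

End DirectionalTaylor.

(** * Zeros *)

Section Identity.
Variable R : realType.
Local Notation rC := (real_complex R : R -> CC R).

Lemma has_ps_cst0 (rho : R) : has_ps (fun _ => 0 : CC R) rho (fun _ => 0).
Proof.
move=> r _ _; exists 0 => m s _; rewrite mul0r /psum big1 ?subrr ?cabs0 // => i _.
by rewrite mul0r.
Qed.

Lemma has_ps_zero (f : CC R -> CC R) (rho eta : R) a : 0 < rho -> 0 < eta ->
  has_ps f rho a -> (forall s, cabs s < eta -> f s = 0) ->
  forall s, cabs s < rho -> f s = 0.
Proof.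
move=> r0 e0 H fz s sr.
have E : a = (fun _ => 0).
  by apply/funext => k; exact: (has_ps_uniq r0 r0 e0 H (@has_ps_cst0 rho) fz k).
by rewrite E in H; exact: (has_ps_eq H (@has_ps_cst0 rho) sr sr).
Qed.

Lemma line_reparam (K : comPzRingType) (V : lmodType K) (z v : V) (a a' t : K) :
  z + a' *: v + t *: v = z + a *: v + (a' - a + t) *: v.
Proof. by rewrite -2!addrA -2!scalerDl; congr (_ + _ *: _); ring. Qed.

(** A chain of discs in the complex line through [z] and [z1]. By convexity the segment keeps the
    distance [m] from the sphere, so one radius [d] serves at every point and steps of [d / 2] reach
    [z1]. *)
Lemma identity_ball n (F : 'rV[CC R]_n -> CC R) z z1 (eta : R) : lup_ball F ->
  unit_ball z -> unit_ball z1 -> 0 < eta ->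
  (forall t, cabs t < eta -> F (z + t *: (z1 - z)) = 0) -> F z1 = 0.
Proof.
move=> HF zB z1B eta0 Hz; set v := z1 - z in Hz.
pose m := Num.min (1 - enorm z) (1 - enorm z1).
have m0 : 0 < m by rewrite lt_min !subr_gt0; apply/andP.
have [mz mz1] : m <= 1 - enorm z /\ m <= 1 - enorm z1.
  by split; rewrite ge_min lexx // orbT.
have v1 : 0 < enorm v + 1 by rewrite ltr_wpDl // enorm_ge0.
pose d := m / (enorm v + 1); have d0 : 0 < d by rewrite divr_gt0.
have dv : d * enorm v <= m.
  by rewrite /d mulrAC ler_pdivrMr // ler_pM2l // lerDl.
pose zt (tau : R) := z + rC tau *: v.
have ztm tau : 0 <= tau <= 1 -> enorm (zt tau) <= 1 - m.
  move=> /andP[t0 t1].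
  rewrite (_ : zt tau = rC (1 - tau) *: z + rC tau *: z1); last first.
    by rewrite /zt /v rmorphB rmorph1 scalerBl scale1r scalerBr [RHS]addrAC -addrA.
  apply: le_trans (enormD _ _) _; rewrite !enormZ !cabs_realp ?subr_ge0 //; nra.
pose P tau := exists2 eta : R, 0 < eta & forall t, cabs t < eta -> F (zt tau + t *: v) = 0.
have step tau tau' : 0 <= tau <= 1 -> P tau -> `|tau' - tau| < d -> P tau'.
  move=> t01 [e e0 He] tt'.
  have tB : unit_ball (zt tau) by apply: le_lt_trans (ztm _ t01) _; lra.
  have dz : d * enorm v <= 1 - enorm (zt tau) by have := ztm _ t01; lra.
  have H := has_ps_zero d0 e0 (slice_ps HF tB d0 dz) He.
  exists (d - `|tau' - tau|); first by rewrite subr_gt0.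
  move=> t td; have -> : zt tau' + t *: v = zt tau + (rC (tau' - tau) + t) *: v.
    have E : rC (tau' - tau) = rC tau' - rC tau by exact: rmorphB.
    by rewrite /zt E; exact: line_reparam.
  apply: H; apply: le_lt_trans (cabsD _ _) _; rewrite cabs_real; lra.
have ind k : P (Num.min 1 (k%:R * (d / 2))).
  elim: k => [|k IHk].
    rewrite mul0r min_r //; exists eta => // t te.
    by rewrite /zt rmorph0 scale0r addr0 Hz.
  apply: step IHk _.
    by rewrite ge_min lexx /= le_min ler01 mulr_ge0 // divr_ge0 // ltW.
  rewrite -natr1; set x := _%:R * _.
  have -> : (k%:R + 1) * (d / 2) = x + d / 2 by rewrite mulrDl mul1r.
  have [x1|x1] := leP 1 x.
    by rewrite min_l ?subrr ?normr0 //; lra.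
  by have [h|h] := leP 1 (x + d / 2); rewrite ger0_norm; lra.
pose k := (Num.truncn (d / 2)^-1).+1.
have k1 : 1 <= k%:R * (d / 2).
  rewrite -ler_pdivrMr ?divr_gt0 // div1r; apply: ltW; exact: truncnS_gt.
have := ind k; rewrite min_l // => -[e e0 /(_ 0)]; rewrite cabs0 scale0r addr0 => /(_ e0).
by rewrite /zt rmorph1 scale1r /v addrCA subrr addr0.
Qed.

End Identity.

(** * Circles far from the zeros of finitely many functions *)

Section GoodCircle.
Variable R : realType.
Local Notation rC := (real_complex R : R -> CC R).

(** The candidates are the midpoints of [Q] equal intervals that divide [1/2, 1]; each member of
    [xs] is closer than half an interval to at most one of them. *)
Lemma avoid_radii (xs : seq R) (Q : nat) : (size xs < Q)%N ->
  exists q : 'I_Q, forall x, x \in xs ->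
    (2 * Q%:R)^-1 / 2 <= `|x - (1 / 2 + (q%:R + 1 / 2) * (2 * Q%:R)^-1)|.
Proof.
move=> sQ; set w := (2 * Q%:R)^-1.
have Q0 : (0 < Q)%N by apply: leq_ltn_trans sQ.
have w0 : 0 < w by rewrite invr_gt0 mulr_gt0 // ltr0n.
apply: contrapT => Hno.
have /choice[i Hi] : forall q : 'I_Q, exists i : 'I_(size xs),
    `|xs`_i - (1 / 2 + (q%:R + 1 / 2) * w)| < w / 2.
  move=> q; apply: contrapT => Hq; apply: Hno; exists q => x xin.
  rewrite leNgt; apply/negP => xl; apply: Hq.
  have ix : (index x xs < size xs)%N by rewrite index_mem.
  by exists (Ordinal ix); rewrite /= nth_index.
have inji : injective i.
  move=> q q' E; apply/val_inj/eqP; rewrite eqn_leq.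
  have wlog_le (q1 q2 : 'I_Q) : i q1 = i q2 -> (q1 <= q2)%N.
    move=> E12; rewrite leqNgt; apply/negP => lt.
    have := Hi q1; have := Hi q2; rewrite E12 !ltr_norml => /andP[a1 a2] /andP[b1 b2].
    have : q2%:R + 1 <= q1%:R :> R by rewrite natr1 ler_nat.
    nra.
  by rewrite !wlog_le.
have := leq_card i inji; rewrite !card_ord => le.
by move: (leq_ltn_trans le sQ); rewrite ltnn.
Qed.

Lemma prod_XsubC_coef_le (rs : seq (CC R)) k :
  cabs (\prod_(r <- rs) ('X - r%:P))`_k <= \prod_(r <- rs) (1 + cabs r).
Proof.
elim: rs k => [|r rs IHrs] k.
  by rewrite !big_nil coef1 cabs_nat; case: (k == 0)%N.
rewrite !big_cons mulrBl coefB coefXM coefCM mulrDl mul1r.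
apply: le_trans (cabsB _ _) _; apply: lerD.
  case: eqP => _ //; rewrite cabs0; apply: prodr_ge0 => i _.
  by rewrite addr_ge0 ?cabs_ge0.
by rewrite cabsM ler_wpM2l ?cabs_ge0.
Qed.

(** If |r| <= 2, then 1 + |r| <= 3 and the gap [kappa] suffices; if |r| >= 2, then |s - r| >= |r| -
    3/2 >= (1 + |r|) / 6. *)
Lemma root_distance (s r : CC R) (kappa : R) : 0 < kappa <= 1 / 2 -> cabs s <= 3 / 2 ->
  kappa <= `|cabs s - cabs r| -> kappa / 3 * (1 + cabs r) <= cabs (s - r).
Proof.
move=> /andP[k0 k1] s1 ks.
have d1 : `|cabs s - cabs r| <= cabs (s - r).
  rewrite ler_norml; apply/andP; split.
    have := cabs_dist r s 0; rewrite !subr0 cabs_distC; lra.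
  by have := cabs_dist s r 0; rewrite !subr0; lra.
have r0 := cabs_ge0 r.
have [r2|r2] := leP 2 (cabs r); last by nra.
have h : cabs r - cabs s <= `|cabs s - cabs r| by rewrite distrC ler_norm.
nra.
Qed.

(* Some annulus around a radius in [[1/2, 1]] avoids the moduli of all roots of
   the [K] polynomials, by the pigeonhole principle. *)
Lemma cartan (K m0 : nat) : exists (c eta : R), [/\ 0 < c, 0 < eta <= 1 / 2 &
  forall q : 'I_K -> {poly CC R}, (forall i, (size (q i) <= m0.+1)%N) ->
  exists2 tau : R, 1 / 2 <= tau <= 1 & forall i k s, `|cabs s - tau| <= eta ->
    c * cabs (q i)`_k <= cabs (q i).[s]].
Proof.
pose Q := (K * m0).+1; pose w : R := (2 * Q%:R)^-1.
have Q1 : 1 <= Q%:R :> R by rewrite ler1n.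
have w0 : 0 < w by rewrite invr_gt0; lra.
have wQ : w * Q%:R = 1 / 2 by rewrite /w invfM mulrAC -mulrA mulrV ?unitfE ?gt_eqF //; lra.
have w1 : w <= 1 / 2 by nra.
(* The roots keep [w / 2] away from [tau], hence [w / 4] from the annulus of half-width [w / 4];
   [root_distance] loses a factor 3 for each of the at most [m0] roots. Coefficients and values are
   compared through the product of the 1 + |r| over the roots. *)
exists ((w / 12) ^+ m0), (w / 4); split.
- by rewrite exprn_gt0 // divr_gt0.
- by rewrite divr_gt0 //=; lra.
move=> q sq.
have /choice[rs Hrs] : forall i, exists rs : seq (CC R), (size rs <= m0)%N /\
    q i = lead_coef (q i) *: \prod_(r <- rs) ('X - r%:P).
  move=> i; have [->|q0] := eqVneq (q i) 0.
    by exists [::]; rewrite lead_coef0 scale0r.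
  have [rs Hrs] := closed_field_poly_normal (q i); exists rs; split=> //.
  have := sq i; rewrite Hrs size_scale ?lead_coef_eq0 //.
  by rewrite size_prod_XsubC ltnS.
pose xs := flatten [seq [seq cabs r | r <- rs i] | i <- enum 'I_K].
have sxs : (size xs < Q)%N.
  rewrite ltnS size_flatten /shape -map_comp sumnE big_map big_enum /=.
  apply: (@leq_trans (\sum_(i < K) m0)); last by rewrite sum_nat_const card_ord.
  by apply: leq_sum => i _; rewrite /= size_map; case: (Hrs i).
have [j Hj] := avoid_radii sxs; rewrite -/w in Hj.
have j0 : 0 <= j%:R :> R by [].
have j1 : j%:R + 1 <= Q%:R :> R by rewrite natr1 ler_nat.
exists (1 / 2 + (j%:R + 1 / 2) * w); first by apply/andP; split; nra.
set tau := _ + _ in Hj *.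
have tau1 : tau <= 1 by rewrite /tau; nra.
move=> i k s st; have [sr Eq] := Hrs i.
set l := lead_coef (q i) in Eq.
have s32 : cabs s <= 3 / 2 by move: st; rewrite ler_norml => /andP[_]; lra.
rewrite Eq coefZ hornerZ !cabsM mulrCA ler_wpM2l ?cabs_ge0 //.
rewrite horner_prod cabs_prod.
apply: (@le_trans _ _ ((w / 12) ^+ m0 * \prod_(r <- rs i) (1 + cabs r))).
  rewrite ler_wpM2l ?exprn_ge0 ?divr_ge0 ?(ltW w0) //.
  exact: prod_XsubC_coef_le.
have P0 (l' : seq (CC R)) : 0 <= \prod_(r <- l') (1 + cabs r).
  by apply: prodr_ge0 => r _; rewrite addr_ge0 ?cabs_ge0.
apply: (@le_trans _ _ ((w / 12) ^+ (size (rs i)) * \prod_(r <- rs i) (1 + cabs r))).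
  rewrite ler_wpM2r //; apply: ler_wiXn2l => //; first by rewrite divr_ge0 // ltW.
  by lra.
have Hr r : r \in rs i -> w / 4 <= `|cabs s - cabs r|.
  move=> rin; have := Hj (cabs r).
  have -> : cabs r \in xs.
    apply/flattenP; exists [seq cabs r0 | r0 <- rs i]; last exact: map_f.
    by apply: (map_f (fun i => [seq cabs r0 | r0 <- rs i])); rewrite mem_enum.
  move=> /(_ isT) h; have := ler_distD (cabs s) (cabs r) tau.
  rewrite [`|cabs r - cabs s|]distrC; lra.
elim: (rs i) Hr => [|r l' IHl] Hr; first by rewrite !big_nil expr0 mulr1.
rewrite !big_cons exprS mulrACA; apply: ler_pM.
- by rewrite mulr_ge0 ?divr_ge0 ?addr_ge0 ?cabs_ge0 ?(ltW w0).
- by rewrite mulr_ge0 ?exprn_ge0 ?divr_ge0 ?(ltW w0).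
- rewrite hornerXsubC (_ : w / 12 = w / 4 / 3); last by field.
  apply: root_distance => //; first by rewrite divr_gt0 //=; lra.
  by apply: Hr; rewrite mem_head.
- by apply: IHl => r' r'in; apply: Hr; rewrite in_cons r'in orbT.
Qed.

(** The constants depend on [K] and [m0] alone. [cartan], applied to the truncations in the variable
    s / rho, bounds them below by c M rho^m0, and the tails carry one more factor rho. Bounding
    [b 1%N] by a multiple of the modulus instead of a quotient admits functions that vanish
    identically. *)
Lemma good_circle (K m0 : nat) : exists rho eps P : R,
  [/\ 0 < rho <= 1 / 4, 0 < eps, 0 <= P &
  forall (U : 'I_K -> CC R -> CC R) (a : 'I_K -> nat -> CC R) (M : 'I_K -> R),
    (forall i, has_ps (U i) 1 (a i)) -> (forall i k, cabs (a i k) <= M i) ->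
    (forall i, exists2 k, (k <= m0)%N & M i <= cabs (a i k)) ->
  exists2 rho' : R, rho / 2 <= rho' <= rho &
    forall i s, `|cabs s - rho'| <= eps ->
      (0 < M i -> U i s != 0) /\
      forall (delta : R) b, 0 < delta -> has_ps (fun t => U i (s + t)) delta b ->
        cabs (b 1%N) <= P * cabs (U i s)].
Proof.
have [c [eta [c0 /andP[eta0 eta1] Hc]]] := cartan K m0.
(* Where |s| <= 2 rho the tail is at most 2 M (2 rho)^(m0+1); this power of 2 puts it below half of
   the main term. *)
pose rho := Num.min (1 / 4) (c / 2 ^+ (m0 + 4)).
have rho0 : 0 < rho by rewrite lt_min !divr_gt0 // exprn_gt0.
have rho1 : rho <= 1 / 4 by rewrite ge_min lexx.
have rhoc : rho * 2 ^+ (m0 + 4) <= c.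
  by rewrite -ler_pdivlMr ?exprn_gt0 // ge_min lexx orbT.
have rm0 : 0 < rho ^+ m0 by rewrite exprn_gt0.
(* The derivative is at most 16 M, by Cauchy's estimate at radius 1/4, and the modulus is at least c
   M rho^m0 / 2. *)
exists rho, (rho * eta), (32 / (c * rho ^+ m0)); split.
- by rewrite rho0.
- by rewrite mulr_gt0.
- by rewrite divr_ge0 // mulr_ge0 ?(ltW c0) ?(ltW rm0).
move=> U a M HU HM HMk.
pose q i : {poly CC R} := \poly_(k < m0.+1) (a i k * rC rho ^+ k).
have [|tau /andP[tau0 tau1] Ht] := Hc q; first by move=> i; exact: size_poly.
exists (rho * tau); first by apply/andP; split; nra.
move=> i s hs.
have M0 : 0 <= M i by apply: le_trans (HM i 0%N); apply: cabs_ge0.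
have s12 : cabs s <= 2 * rho.
  by move: hs; rewrite ler_norml => /andP[_]; nra.
have su : `|cabs (s / rC rho) - tau| <= eta.
  rewrite cabsM cabsV cabs_realp ?(ltW rho0) //.
  rewrite (_ : _ - tau = (cabs s - rho * tau) / rho); last first.
    by rewrite mulrBl [rho * tau]mulrC mulfK ?gt_eqF.
  by rewrite normrM [`|rho^-1|]gtr0_norm ?invr_gt0 // ler_pdivrMr // [eta * _]mulrC.
have qs : (q i).[s / rC rho] = psum (a i) m0.+1 s.
  rewrite horner_poly; apply: eq_bigr => k _; rewrite -mulrA -exprMn [rC rho * _]mulrC divfK //.
  by rewrite -cabs_gt0 cabs_realp // ltW.
have main : c * M i * rho ^+ m0 <= cabs (psum (a i) m0.+1 s).
  have [k km Mk] := HMk i; rewrite -qs; apply: le_trans (Ht i k _ su).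
  rewrite coef_poly ltnS km cabsM cabsX cabs_realp ?(ltW rho0) // -mulrA ler_pM2l //.
  apply: ler_pM => //; first exact: ltW.
  by apply: ler_wiXn2l => //; [exact: ltW | lra].
have rem : cabs (U i s - psum (a i) m0.+1 s) <= c / 2 * M i * rho ^+ m0.
  apply: le_trans (has_ps_remainder (r := 1) (M := M i) _ (HU i) _ _ _) _.
  - by move=> k; rewrite expr1n mulr1.
  - lra.
  - lra.
  rewrite divr1; have s1 : 1 / 2 <= 1 - cabs s by lra.
  have q1 : (1 - cabs s)^-1 <= 2.
    by rewrite -[2]invrK lef_pV2 ?posrE ?invr_gt0 //; lra.
  apply: (@le_trans _ _ (M i * (2 * rho) ^+ m0.+1 * 2)).
    apply: ler_pM => //; first by rewrite mulr_ge0 ?exprn_ge0 ?cabs_ge0.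
      by rewrite invr_ge0; lra.
    rewrite ler_wpM2l //; apply: lerXn2r; rewrite ?nnegrE ?cabs_ge0 //.
    by rewrite mulr_ge0 // ltW.
  have -> : M i * (2 * rho) ^+ m0.+1 * 2 = (M i * rho ^+ m0) * (rho * 2 ^+ (m0 + 4)) / 4.
    by rewrite exprMn exprD !exprS expr0; field.
  have -> : c / 2 * M i * rho ^+ m0 = (M i * rho ^+ m0) * (c / 2) by ring.
  rewrite -mulrA ler_wpM2l ?mulr_ge0 ?(ltW rm0) //; lra.
have lowU : c / 2 * M i * rho ^+ m0 <= cabs (U i s).
  have := cabs_dist (psum (a i) m0.+1 s) (U i s) 0; rewrite !subr0 cabs_distC.
  have -> : c / 2 * M i * rho ^+ m0 = c * M i * rho ^+ m0 - c / 2 * M i * rho ^+ m0 by field.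
  by lra.
split=> [Mp|delta b d0 Hb].
  by rewrite -cabs_gt0; apply: lt_le_trans lowU; rewrite !mulr_gt0 // divr_gt0.
have s1 : cabs s < 1 by lra.
have [b' Hb'] := has_ps_recenter (HU i) s1.
have E := has_ps_uniq d0 _ ltr01 Hb Hb' (fun _ _ => erefl) 1%N.
rewrite E ?subr_gt0 //.
have : cabs (b' 1%N) * (1 / 4) ^+ 1 <= 4 * M i.
  apply: (has_ps_cauchy Hb'); first by apply/andP; lra.
  move=> t t4; have st : cabs (s + t) <= 3 / 4 by apply: le_trans (cabsD _ _) _; lra.
  have := has_ps_remainder (r := 1) (M := M i) (s := s + t) 0 (HU i) _ _ _.
  rewrite /psum big_ord0 subr0 expr0 mulr1 divr1 => h; apply: le_trans (h _ _ _) _.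
  - by move=> k; rewrite expr1n mulr1.
  - lra.
  - lra.
  rewrite mulrC ler_wpM2r // -[4]invrK lef_pV2 ?posrE ?invr_gt0 //; lra.
rewrite expr1 => hb; apply: (@le_trans _ _ (16 * M i)); first lra.
rewrite mulrAC ler_pdivlMr ?mulr_gt0 //.
by rewrite (_ : 16 * M i * _ = 32 * (c / 2 * M i * rho ^+ m0)); [rewrite ler_wpM2l | field].
Qed.

End GoodCircle.

(** * Absorbing the tail of a power series *)

Section Absorption.
Variable R : realType.
Local Notation rC := (real_complex R : R -> CC R).

Lemma sum_shift_trunc (G : nat -> R) k N : (forall j, (j < k)%N -> G j = 0) ->
  \sum_(i < N) (if (k + i < N)%N then G (k + i)%N else 0) = \sum_(j < N) G j.
Proof.
move=> G0; rewrite -(big_mkord xpredT G).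
rewrite -(big_mkord xpredT (fun i => if (k + i < N)%N then G (k + i)%N else 0)).
have [kN|Nk] := leqP k N; last first.
  rewrite !big_nat !big1 // => i iN.
    by rewrite G0 // (leq_trans _ (ltnW Nk)).
  by rewrite ltnNge (leq_trans (ltnW Nk)) ?leq_addr.
rewrite [RHS](big_cat_nat (leq0n k) kN) /=.
rewrite [X in _ = X + _]big_nat [X in _ = X + _]big1 ?add0r; last by move=> i /andP[_ /G0].
rewrite (big_cat_nat (leq0n (N - k)) (leq_subr k N)) /=.
rewrite [X in _ + X]big_nat [X in _ + X]big1 ?addr0; last first.
  by move=> i /andP[iN _]; rewrite ltnNge -leq_subLR iN.
have -> : \sum_(k <= i < N) G i = \sum_(0 <= i < N - k) G (i + k)%N.
  by rewrite -{1}[k]add0n big_addn.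
rewrite !big_nat; apply: eq_bigr => i /andP[_ iN].
by rewrite -ltn_subRL iN addnC.
Qed.

Lemma vanishing_sqr (e : nat -> R) : (forall n, 0 <= e n) -> vanishing e ->
  vanishing (fun n => e n ^+ 2).
Proof.
move=> e0 ve eps eps0; have [|N HN] := ve (Num.min 1 eps); first by rewrite lt_min ltr01.
exists N => n /HN; rewrite le_min => /andP[h1 h2]; apply: le_trans h2.
by rewrite expr2 ler_piMl.
Qed.

Lemma sqr_sum_le n (y : 'I_n -> R) : (\sum_i y i) ^+ 2 <= n%:R * \sum_i y i ^+ 2.
Proof.
have := sum_cauchy_schwarz (fun _ : 'I_n => 1) y.
rewrite (eq_bigr y) => [|i _]; last by rewrite mul1r.
by under [X in X * _]eq_bigr do rewrite expr1n; rewrite sumr_const card_ord.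
Qed.

(** The factor of |a_j|^2 in the mean of |f^(k)|^2 over the circle of radius [r]. For j < k the
    truncated subtraction is harmless, as the falling factorial is 0. *)
Definition weight (r : R) (k j : nat) : R := (j ^_ k)%:R ^+ 2 * r ^+ (2 * (j - k)).

Lemma weight_ge0 r k j : 0 <= weight r k j.
Proof. by rewrite mulr_ge0 ?sqr_ge0 // exprM exprn_ge0 ?sqr_ge0. Qed.

(** The nodes depend neither on [a] nor on [k], so an inequality between derivatives of several
    orders can be summed node by node. *)
Lemma parseval_derivn n (r : R) : (0 < n)%N -> 0 <= r ->
  exists x : 'I_n -> CC R, (forall i, cabs (x i) = r) /\
   forall (a : nat -> CC R) k,
     \sum_i cabs ((ptrunc a n)^`(k)).[x i] ^+ 2 =
       n%:R * \sum_(j < n) cabs (a j) ^+ 2 * weight r k j.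
Proof.
move=> n0 r0; have [x [xr Hx]] := parseval_nodes n0 r0; exists x; split=> // a k.
have sz : (size (ptrunc a n)^`(k) <= n)%N.
  apply/leq_sizeP => j nj; rewrite coef_derivn coef_poly ltnNge (leq_trans nj) ?leq_addl //.
  by rewrite mul0rn.
rewrite Hx //; congr (_ * _).
pose G j := cabs (a j) ^+ 2 * weight r k j.
rewrite -(@sum_shift_trunc G k n); last first.
  by move=> j jk; rewrite /G /weight ffact_small // expr0n mul0r mulr0.
apply: eq_bigr => i _; rewrite coef_derivn coef_poly.
case: ltnP => _; last by rewrite mul0rn cabs0 expr0n mul0r.
rewrite /G /weight -[a _ *+ _]mulr_natl cabsM cabs_nat exprMn addKn.
by rewrite -mulrA mulrCA.
Qed.

Lemma ffact_leS k j : (k < j)%N -> (j ^_ k <= j ^_ k.+1)%N.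
Proof. by move=> kj; rewrite ffactnSr leq_pmulr // subn_gt0. Qed.

Lemma ffact_le k p j : (k <= p)%N -> (p <= j)%N -> (j ^_ k <= j ^_ p)%N.
Proof.
elim: p => [|p IHp]; first by rewrite leqn0 => /eqP ->.
rewrite leq_eqVlt => /predU1P[-> //|]; rewrite ltnS => kp pj.
by apply: leq_trans (IHp kp (ltnW pj)) (ffact_leS pj).
Qed.

Lemma weight_le (r : R) k p j : 0 <= r <= 1 -> (k <= p)%N -> (p <= j)%N ->
  weight r k j <= weight r p j.
Proof.
move=> /andP[r0 r1] kp pj; apply: ler_pM.
- exact: sqr_ge0.
- by rewrite exprn_ge0.
- by apply: lerXn2r; rewrite ?nnegrE // ler_nat ffact_le.
- by apply: ler_wiXn2l => //; rewrite leq_mul2l leq_sub2l.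
Qed.

Lemma weight_succ (r : R) p j : 0 <= r <= 1 -> (p < j)%N ->
  (j - p)%:R ^+ 2 * weight r p j <= weight r p.+1 j.
Proof.
move=> /andP[r0 r1] pj; rewrite /weight mulrA; apply: ler_pM.
- by rewrite mulr_ge0 ?sqr_ge0.
- by rewrite exprn_ge0.
- by rewrite -exprMn -natrM ffactnSr mulnC.
- by apply: ler_wiXn2l => //; rewrite leq_mul2l /= leq_sub2l.
Qed.

Lemma le_weight (r : R) p j : 0 <= r <= 1 -> (p <= j)%N -> r ^+ (2 * j) <= weight r p j.
Proof.
move=> r01 pj; apply: le_trans (weight_le r01 (leq0n p) pj).
by rewrite /weight ffactn0 expr1n mul1r subn0.
Qed.

Lemma weight_le_sqr (r : R) k j : 0 <= r <= 1 -> weight r k j <= (j ^_ k)%:R ^+ 2.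
Proof.
by move=> /andP[r0 r1]; rewrite ler_piMr ?sqr_ge0 // exprn_ile1.
Qed.

(* For large [j] the weight of [a_j] in the [(p+1)]-st derivative dominates its
   weights in the lower ones, so Parseval on a single circle bounds the tail of
   the series by finitely many coefficients. *)
Lemma coef_absorb p (C rho : R) : 0 <= C -> 0 < rho <= 1 ->
  exists (N0 : nat) (B : R), 0 <= B /\
  forall f (a : nat -> CC R) (R0 r : R), rho <= r <= 1 -> r < R0 -> has_ps f R0 a ->
  (forall s, cabs s = r -> exists (delta : R) b, [/\ 0 < delta,
     has_ps (fun t => f (s + t)) delta b &
     (p.+1)`!%:R * cabs (b p.+1) <= C * \sum_(k < p.+1) k`!%:R * cabs (b k)]) ->
  forall k, cabs (a k) * rho ^+ k <= B * \sum_(i < N0) cabs (a i).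
Proof.
move=> C0 /andP[rho0 rho1].
(* The factor 2 comes from separating the approximation error from the square, [p.+1] from the
   Cauchy-Schwarz inequality for the sum over the lower orders. *)
pose A := 2 * C ^+ 2 * p.+1%:R; have A0 : 0 <= A by rewrite !mulr_ge0 // sqr_ge0.
(* From here on i - p exceeds A (p + 1) + 1: the weights of the lower orders are absorbed and a
   multiple 1 of the term |a_j|^2 r^(2j) is left over. *)
pose N0 := (p + (Num.truncn (A * p.+1%:R + 1)).+1)%N.
have N0p : (p < N0)%N by rewrite /N0 addnS ltnS leq_addr.
pose W : R := \sum_(k < p.+1) \sum_(j < N0) (j ^_ k)%:R ^+ 2.
have W0 : 0 <= W by apply: sumr_ge0 => k _; apply: sumr_ge0 => j _; exact: sqr_ge0.
exists N0, (Num.sqrt (A * W) + 1); split; first by rewrite addr_ge0 ?sqrtr_ge0.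
move=> f a R0 r /andP[rr r1] rR0 Hf Hb j.
have r0 : 0 < r by apply: lt_le_trans rr.
have r01 : 0 <= r <= 1 by rewrite ltW.
set S := \sum_(i < N0) cabs (a i).
have S0 : 0 <= S by apply: sumr_ge0 => i _; exact: cabs_ge0.
have aS i : (i < N0)%N -> cabs (a i) <= S.
  by move=> iN; rewrite /S (bigD1 (Ordinal iN)) //= lerDl sumr_ge0 // => l _; exact: cabs_ge0.
have [jN|Nj] := ltnP j N0.
  apply: (@le_trans _ _ (cabs (a j) * 1)).
    by rewrite ler_wpM2l ?cabs_ge0 // exprn_ile1 // ltW.
  rewrite mulr1 mulrDl mul1r; apply: le_trans (aS j jN) _.
  by rewrite lerDr mulr_ge0 ?sqrtr_ge0.
have [|e [ve e0 He]] := @has_ps_recenter_rate _ _ _ _ r Hf; first by rewrite ltW.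
pose d0 := (R0 - r) / 2; have d00 : 0 < d0 by rewrite divr_gt0 // subr_gt0.
pose E := \sum_(k < p.+2) k`!%:R / d0 ^+ k.
have E0 : 0 <= E.
  by apply: sumr_ge0 => k _; rewrite divr_ge0 // exprn_ge0 // ltW.
pose A' := (1 + C * p.+1%:R) * E.
have A'0 : 0 <= A' by rewrite mulr_ge0 // addr_ge0 // mulr_ge0.
(* The hypothesis on the circle transferred to truncations. [A'] depends on the function, but it
   multiplies an error that vanishes, so [B] remains uniform. *)
have circ N s : cabs s = r -> cabs (ptrunc a N)^`(p.+1).[s] <=
    C * (\sum_(k < p.+1) cabs (ptrunc a N)^`(k).[s]) + A' * e N.
  move=> sr; have [|b [Hb1 Hb2]] := He s; first by rewrite sr.
  have [delta [b' [d'0 Hb' Cb']]] := Hb s sr.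
  have bb : b' = b.
    apply/funext; apply: (has_ps_uniq d'0 _ ltr01 Hb' Hb1 (fun _ _ => erefl)).
    by rewrite sr subr_gt0.
  rewrite bb in Cb'.
  have close k : (k < p.+2)%N -> cabs ((ptrunc a N)^`(k).[s] - k`!%:R * b k) <= E * e N.
    move=> kp; rewrite nderivn_def hornerMn -[_ *+ _]mulr_natl -mulrBr cabsM cabs_nat.
    apply: (@le_trans _ _ (k`!%:R * (e N / d0 ^+ k))).
      by rewrite ler_wpM2l // ler_pdivlMr ?exprn_gt0.
    rewrite mulrCA mulrC ler_wpM2r // /E (bigD1 (Ordinal kp)) //= lerDl sumr_ge0 // => i _.
    by rewrite divr_ge0 // exprn_ge0 // ltW.
  have up k : (k < p.+2)%N -> k`!%:R * cabs (b k) <= cabs (ptrunc a N)^`(k).[s] + E * e N.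
    move=> kp; rewrite -cabs_nat -cabsM.
    have := cabs_dist (k`!%:R * b k) (ptrunc a N)^`(k).[s] 0; rewrite !subr0 cabs_distC.
    by have := close k kp; lra.
  have lo : cabs (ptrunc a N)^`(p.+1).[s] <= (p.+1)`!%:R * cabs (b p.+1) + E * e N.
    rewrite -(cabs_nat _ (p.+1)`!) -cabsM.
    have := cabs_dist (ptrunc a N)^`(p.+1).[s] ((p.+1)`!%:R * b p.+1) 0; rewrite !subr0.
    by have := close p.+1 (leqnn _); lra.
  apply: le_trans lo _.
  have : \sum_(k < p.+1) k`!%:R * cabs (b k) <=
      \sum_(k < p.+1) cabs (ptrunc a N)^`(k).[s] + p.+1%:R * (E * e N).
    have -> : p.+1%:R * (E * e N) = \sum_(k < p.+1) E * e N.
      by rewrite sumr_const card_ord mulr_natl.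
    rewrite -big_split /=.
    by apply: ler_sum => k _; apply: up; rewrite ltnS ltnW.
  move=> /(ler_wpM2l C0); rewrite /A'; move: Cb'.
  move: (\sum_(k < p.+1) _) (\sum_(k < p.+1) _) => x1 x2 h1 h2.
  by rewrite !mulrDl mul1r -!mulrA; rewrite mulrDr in h2; lra.
have tail N : (N0 <= N)%N -> (j < N)%N ->
    cabs (a j) ^+ 2 * r ^+ (2 * j) <= A * W * S ^+ 2 + (2 * A' ^+ 2) * e N ^+ 2.
  move=> NN jN; have Np : (0 < N)%N by apply: leq_ltn_trans jN.
  have [x [xr Hx]] := parseval_derivn Np (ltW r0).
  pose V k := \sum_(i < N) cabs (a i) ^+ 2 * weight r k i.
  have ineq : V p.+1 <= A * (\sum_(k < p.+1) V k) + 2 * A' ^+ 2 * e N ^+ 2.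
    have N0' : 0 < N%:R :> R by rewrite ltr0n.
    rewrite -(ler_pM2l N0') -Hx mulrDr mulrCA mulr_sumr.
    under [X in A * X]eq_bigr do rewrite -Hx.
    rewrite exchange_big mulr_sumr /=.
    have -> : N%:R * (2 * A' ^+ 2 * e N ^+ 2) = \sum_(i < N) 2 * A' ^+ 2 * e N ^+ 2.
      by rewrite sumr_const card_ord mulr_natl.
    rewrite -big_split /=.
    apply: ler_sum => i _; have := circ N (x i) (xr i).
    set y := cabs _; set z := \sum_(k < _) _ => h.
    have z2 : z ^+ 2 <= p.+1%:R * \sum_(k < p.+1) cabs (ptrunc a N)^`(k).[x i] ^+ 2.
      exact: sqr_sum_le.
    apply: (@le_trans _ _ (2 * C ^+ 2 * z ^+ 2 + 2 * A' ^+ 2 * e N ^+ 2)).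
      have y0 : 0 <= y by exact: cabs_ge0.
      apply: (@le_trans _ _ ((C * z + A' * e N) ^+ 2)).
        by apply: lerXn2r => //; rewrite nnegrE; apply: le_trans h.
      have := sqr_ge0 (C * z - A' * e N); rewrite sqrrB sqrrD !exprMn; lra.
    rewrite lerD2r /A -[leRHS]mulrA. apply: ler_wpM2l => //.
    by rewrite mulr_ge0 // sqr_ge0.
  (* Compared index by index: from [N0] on the left side is absorbed by [V p.+1], and the finitely
     many earlier indices make up [A * W * S ^+ 2]. All sums are finite, so [V p.+1] may be
     cancelled afterwards. *)
  have VS : A * (\sum_(k < p.+1) V k) + cabs (a j) ^+ 2 * r ^+ (2 * j) <= V p.+1 + A * W * S
    ^+ 2.
    pose Wt i := \sum_(k < p.+1) weight r k i.
    have -> : \sum_(k < p.+1) V k = \sum_(i < N) cabs (a i) ^+ 2 * Wt i.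
      by rewrite exchange_big /=; apply: eq_bigr => l _; rewrite mulr_sumr.
    have term (i : 'I_N) : A * (cabs (a i) ^+ 2 * Wt i) +
        (if i == Ordinal jN then cabs (a j) ^+ 2 * r ^+ (2 * j) else 0) <=
        cabs (a i) ^+ 2 * weight r p.+1 i +
        (if (i < N0)%N then A * (cabs (a i) ^+ 2 * Wt i) else 0).
      have ai : 0 <= cabs (a i) ^+ 2 by exact: sqr_ge0.
      case: ltnP => iN0.
        rewrite ifF; last by apply/negP => /eqP E1; move: iN0; rewrite E1 /= ltnNge Nj.
        by rewrite addr0 lerDr mulr_ge0 // weight_ge0.
      have pi : (p < i)%N by apply: leq_trans iN0.
      rewrite addr0; apply: (@le_trans _ _ (cabs (a i) ^+ 2 * (A * Wt i + r ^+ (2 * i)))).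
        rewrite mulrCA mulrDr lerD2l; case: eqP => [-> //|_].
        by rewrite mulr_ge0 // exprn_ge0 // ltW.
      rewrite ler_wpM2l //; apply: le_trans (weight_succ r01 pi).
      have wp := weight_ge0 r p i.
      have h1 : Wt i <= p.+1%:R * weight r p i.
        have -> : p.+1%:R * weight r p i = \sum_(k < p.+1) weight r p i.
          by rewrite sumr_const card_ord mulr_natl.
        by apply: ler_sum => k _; apply: weight_le => //; [rewrite -ltnS | exact: ltnW].
      have h2 := le_weight r01 (ltnW pi).
      have h3 : A * p.+1%:R + 1 <= (i - p)%:R ^+ 2.
        have : A * p.+1%:R + 1 <= (i - p)%:R.
          apply: ltW; apply: lt_le_trans (truncnS_gt _) _.
          by rewrite ler_nat leq_subRL ?(ltnW pi).
        move=> h; apply: (le_trans h); rewrite expr2 ler_peMl //.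
        by rewrite ler1n subn_gt0.
      apply: (@le_trans _ _ ((A * p.+1%:R + 1) * weight r p i)).
        by rewrite mulrDl mul1r; apply: lerD => //; rewrite -mulrA ler_wpM2l.
      by rewrite ler_wpM2r.
    have := ler_sum (index_enum 'I_N) (fun i (_ : true) => term i).
    rewrite !big_split /= -!mulr_sumr -big_mkcond /= big_pred1_eq -/(V p.+1).
    move=> h; apply: le_trans h _; rewrite lerD2l -big_mkcond /= -mulr_sumr -mulrA ler_wpM2l //.
    rewrite -(big_ord_widen N (fun i => cabs (a i) ^+ 2 * Wt i) NN).
    have -> : W = \sum_(i < N0) \sum_(k < p.+1) (i ^_ k)%:R ^+ 2 by rewrite /W exchange_big.
    rewrite mulr_suml; apply: ler_sum => i _; rewrite mulrC; apply: ler_pM.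
    - by apply: sumr_ge0 => k _; exact: weight_ge0.
    - exact: sqr_ge0.
    - by apply: ler_sum => k _; exact: weight_le_sqr.
    - by apply: lerXn2r; rewrite ?nnegrE ?cabs_ge0 ?aS.
  by lra.
have fin : cabs (a j) ^+ 2 * r ^+ (2 * j) <= A * W * S ^+ 2.
  have ve2 := vanishing_shift (j.+1 + N0) (vanishing_sqr e0 ve).
  apply: (le_vanishing ve2 (K := 2 * A' ^+ 2)); first by rewrite mulr_ge0 ?sqr_ge0.
  move=> N; apply: tail; first by rewrite addnA leq_addl.
  by rewrite addnCA addSn ltnS leq_addr.
apply: (@le_trans _ _ (cabs (a j) * r ^+ j)).
  by rewrite ler_wpM2l ?cabs_ge0 //; apply: lerXn2r; rewrite ?nnegrE ?(ltW rho0) ?(ltW r0).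
apply: (@le_trans _ _ (Num.sqrt (A * W) * S)); last by rewrite ler_wpM2r // lerDl.
rewrite -(@ler_pXn2r _ 2) ?nnegrE ?mulr_ge0 ?cabs_ge0 ?sqrtr_ge0 ?exprn_ge0 ?(ltW r0) //.
by rewrite !exprMn sqr_sqrtr ?mulr_ge0 // -exprM mulnC.
Qed.

End Absorption.

(** * Coefficients along slices *)

Section Scaling.
Variable R : realType.
Local Notation rC := (real_complex R : R -> CC R).

Lemma has_ps_scale (f : CC R -> CC R) (rho : R) a c : c != 0 -> has_ps f rho a ->
  has_ps (fun s => f (s * c)) (rho / cabs c) (fun k => a k * c ^+ k).
Proof.
move=> c0 H r r0 rr; have cp : 0 < cabs c by rewrite cabs_gt0.
rewrite ltr_pdivlMr // in rr; have [|B HB] := H (r * cabs c) _ rr; first by rewrite mulr_gt0.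
exists B => m s sr; have := HB m (s * c); rewrite cabsM ler_pM2r // => /(_ sr).
rewrite -mulf_div divff ?gt_eqF // mulr1 (_ :
  psum _ _ (s * c) = psum (fun k => a k * c ^+ k) m s) //.
by apply: eq_bigr => i _; rewrite exprMn mulrAC mulrA.
Qed.

(** The differential equation holds inside the ball only, so its two sides are not equal as total
    functions; equality near [z] on the line suffices. *)
Lemma is_derive_line_eq n (f g : 'rV[CC R]_n -> CC R) z v (eta : R) (x y : CC R) : 0 < eta ->
  (forall t, cabs t < eta -> f (z + t *: v) = g (z + t *: v)) ->
  is_derive z v f x -> is_derive z v g y -> x = y.
Proof.
move=> e0 fg [_ <-] [dg <-].
have fg0 : f z = g z by have := fg 0; rewrite cabs0 scale0r addr0; apply.
have E : \forall h \near 0^', h^-1 *: ((g \o shift z) (h *: v) - g z) =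
    h^-1 *: ((f \o shift z) (h *: v) - f z).
  have eC : 0 < rC eta by rewrite (rC_lt 0).
  near=> h; have : `|h| < rC eta by near: h; exact: dnbhs0_lt.
  by rewrite normE rC_lt => he; rewrite /= ![h *: v + z]addrC fg // fg0.
by apply: cvg_lim => //; apply: cvg_trans dg; apply: near_eq_cvg.
Unshelve. all: by end_near. Qed.

End Scaling.

Section Slices.
Variables (R : realType) (n : nat) (b : 'rV[CC R]_n) (L : 'rV[CC R]_n -> R) (beta : R).
Local Notation rC := (real_complex R : R -> CC R).
Implicit Types (z w : 'rV[CC R]_n) (F : 'rV[CC R]_n -> CC R).

Lemma class_Q_bounds : 0 < beta -> class_Q b beta L -> exists l1 l2 : R,
  [/\ 0 < l1 <= 1, 1 <= l2 & forall z t, unit_ball z -> cabs t <= beta / L z ->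
      l1 * L z <= L (z + t *: b) <= l2 * L z].
Proof.
move=> b0 [_ Lp _ /(_ beta)]; rewrite lexx (ltW b0) => /(_ isT)[h1 _ h2].
have sr z t : unit_ball z -> cabs t <= beta / L z ->
    slice_ratios L b beta (L (z + t *: b) / L z).
  move=> zB tb; exists z, 0, t; rewrite scale0r addr0 subr0; split=> //.
  by rewrite /slice_dom /= scale0r addr0.
have [l1 l10 H1] : exists2 l1 : R, 0 < l1 & forall z t, unit_ball z -> cabs t <= beta / L z ->
    l1 <= L (z + t *: b) / L z.
  have inf z t : unit_ball z -> cabs t <= beta / L z ->
      (lambda1 L b beta <= (L (z + t *: b) / L z)%:E)%E.
    by move=> zB tb; apply: ereal_inf_lbound; exists (L (z + t *: b) / L z) => //; exact: sr.
  case: (lambda1 L b beta) h1 inf => [l|_ inf|//].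
    by rewrite lte_fin => l0 inf; exists l => // z t zB tb; rewrite -lee_fin inf.
  (* An infinite infimum lies below no real ratio: the case is void and the constant arbitrary. *)
  by exists 1 => // z t zB tb; have := inf z t zB tb.
have [l2 H2] : exists l2 : R, forall z t, unit_ball z -> cabs t <= beta / L z ->
    L (z + t *: b) / L z <= l2.
  have sup z t : unit_ball z -> cabs t <= beta / L z ->
      ((L (z + t *: b) / L z)%:E <= lambda2 L b beta)%E.
    by move=> zB tb; apply: ereal_sup_ubound; exists (L (z + t *: b) / L z) => //; exact: sr.
  case: (lambda2 L b beta) h2 sup => [l|//|_ sup].
    by move=> _ sup; exists l => z t zB tb; rewrite -lee_fin sup.
  by exists 1 => z t zB tb; have := sup z t zB tb.
exists (Num.min l1 1), (Num.max l2 1); split.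
- by rewrite lt_min l10 ltr01 /= ge_min lexx orbT.
- by rewrite le_max lexx orbT.
move=> z t zB tb; have Lz := Lp z zB.
apply/andP; split.
  by rewrite -ler_pdivlMr // ge_min H1.
by rewrite -ler_pdivrMr // le_max H2.
Qed.

Hypotheses (beta_gt1 : 1 < beta) (LQ : class_Q b beta L).

Let beta0 : 0 < beta. Proof. exact: lt_trans beta_gt1. Qed.

Let L_gt0 z : unit_ball z -> 0 < L z.
Proof. by case: LQ => _ H _ _; apply: H. Qed.

(** The purpose of the lower bound on [L] in [class_Q]: in the variable scaled by [L z], every slice
    contains the closed disc of radius [beta]. *)
Lemma slice_radius z : unit_ball z -> beta / L z * enorm b < 1 - enorm z.
Proof.
move=> zB; case: LQ => _ _ /(_ z zB) H _; have z1 : 0 < 1 - enorm z by rewrite subr_gt0.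
by rewrite mulrAC ltr_pdivrMr ?L_gt0 // [ltRHS]mulrC -ltr_pdivrMr.
Qed.

Lemma slice_point_ball z t : unit_ball z -> cabs t <= beta / L z -> unit_ball (z + t *: b).
Proof.
move=> zB tb; apply: unit_ball_shift => //; rewrite enormZ.
by apply: le_lt_trans (slice_radius zB); rewrite ler_wpM2r ?enorm_ge0.
Qed.

(** The scale [l] is independent of the centre: at a shifted centre z' the coefficients are needed
    both in the scale [L z] of the old centre and in the scale [L z']. *)
Definition slice_coef F (l : R) z k : CC R := dirDn b k F z / k`!%:R * (rC l)^-1 ^+ k.

Lemma slice_coef_ps F l z : lup_ball F -> unit_ball z -> 0 < l ->
  has_ps (fun s => F (z + (s / rC l) *: b)) (beta * l / L z) (slice_coef F l z).
Proof.
move=> HF zB l0; have Lz := L_gt0 zB.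
have H := slice_ps HF zB (divr_gt0 beta0 Lz) (ltW (slice_radius zB)).
have lC : (rC l)^-1 != 0 by rewrite -cabs_gt0 cabsV cabs_realp ?invr_gt0 // ltW.
have := has_ps_scale lC H; rewrite cabsV cabs_realp ?(ltW l0) // invrK.
by rewrite mulrAC.
Qed.

Lemma slice_coef_ps_scaled F z : lup_ball F -> unit_ball z ->
  has_ps (fun s => F (z + (s / rC (L z)) *: b)) beta (slice_coef F (L z) z).
Proof.
move=> HF zB; have := slice_coef_ps HF zB (L_gt0 zB).
by rewrite mulfK // gt_eqF ?L_gt0.
Qed.

Lemma cabs_slice_coef F l z k : 0 < l ->
  cabs (slice_coef F l z k) = cabs (dirDn b k F z) / k`!%:R / l ^+ k.
Proof.
by move=> l0; rewrite /slice_coef !cabsM cabsX !cabsV cabs_nat cabs_realp ?(ltW l0) // exprVn.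
Qed.

Local Opaque slice_coef.

Lemma slice_coef_rescale F l l' z k : 0 < l -> 0 < l' ->
  cabs (slice_coef F l' z k) = cabs (slice_coef F l z k) * (l / l') ^+ k.
Proof.
move=> l0 l'0; rewrite (cabs_slice_coef F z k l0) (cabs_slice_coef F z k l'0);
  set x := _ / k`!%:R.
by rewrite expr_div_n mulrA divfK // expf_neq0 // gt_eqF.
Qed.

Lemma index_term_slice_coef F z k : unit_ball z ->
  index_term L b F z k = cabs (slice_coef F (L z) z k).
Proof.
by move=> zB; rewrite cabs_slice_coef ?L_gt0 // /index_term invfM mulrC mulrA.
Qed.

Lemma slice_coef_recenter F z d : lup_ball F -> unit_ball z -> cabs d <= beta ->
  let z' := z + (d / rC (L z)) *: b in
  [/\ unit_ball z', 0 < beta * L z / L z' &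
   has_ps (fun s => F (z + ((d + s) / rC (L z)) *:
     b)) (beta * L z / L z') (slice_coef F (L z) z')].
Proof.
move=> HF zB db z'; have Lz := L_gt0 zB.
have z'B : unit_ball z'.
  apply: slice_point_ball => //.
  by rewrite cabsM cabsV cabs_realp ?(ltW Lz) // ler_pM2r ?invr_gt0.
split=> //; first by rewrite divr_gt0 ?mulr_gt0 ?L_gt0.
apply: (has_ps_ext _ (slice_coef_ps HF z'B Lz)) => s _.
by rewrite /z' mulrDl scalerDl addrA.
Qed.

Lemma bounded_index_dominant F m0 z : unit_ball z ->
  (forall m, index_term L b F z m <= \big[Num.max/0]_(k < m0.+1) index_term L b F z k) ->
  exists2 k, (k <= m0)%N & forall m,
    cabs (slice_coef F (L z) z m) <= cabs (slice_coef F (L z) z k).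
Proof.
move=> zB H.
pose k := [arg max_(i > ord0 : 'I_m0.+1) index_term L b F z i]%O.
exists k; first by rewrite -ltnS.
move=> m; rewrite -!index_term_slice_coef //; apply: le_trans (H m) _.
have it0 i : 0 <= index_term L b F z i by rewrite index_term_slice_coef // cabs_ge0.
apply: bigmax_le => // i _.
by rewrite /k; case: arg_maxP => // j _ /(_ i isT).
Qed.

End Slices.

Opaque slice_coef.

(** * The differential equation *)

Section Equation.
Variables (R : realType) (n : nat) (b : 'rV[CC R]_n).
Local Notation rC := (real_complex R : R -> CC R).
Implicit Types (z w : 'rV[CC R]_n) (F : 'rV[CC R]_n -> CC R).

Variables (p : nat) (g : nat -> 'rV[CC R]_n -> CC R) (h F : 'rV[CC R]_n -> CC R).
Hypotheses (g_lup : forall j, (j <= p)%N -> lup_ball (g j)) (h_lup : lup_ball h)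
  (F_lup : lup_ball F)
  (eqF : forall z, unit_ball z -> \sum_(j < p.+1) g j z * dirDn b (p - j) F z = h z).

Lemma equation_dirD z : unit_ball z ->
  \sum_(j < p.+1) (g j z * dirDn b (p - j).+1 F z + dirDn b (p - j) F z * dirD b (g j) z) =
  dirD b h z.
Proof.
move=> zB; have z1 : 0 < 1 - enorm z by rewrite subr_gt0.
have [eta e0 He] := dirscale_lt b z1.
have D j : (j <= p)%N -> is_derive z b (g j * dirDn b (p - j) F)
    (g j z * dirDn b (p - j).+1 F z + dirDn b (p - j) F z * dirD b (g j) z).
  move=> jp; have D1 := lup_is_derive b (g_lup jp zB).
  have D2 := lup_is_derive b (@dirDn_lup_ball _ _ b F (p - j) F_lup z zB).
  exact: (is_deriveM D1 D2).
have DS : is_derive z b (\sum_(j < p.+1) (g j * dirDn b (p - j) F))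
   (\sum_(j < p.+1) (g j z * dirDn b (p - j).+1 F z + dirDn b (p - j) F z * dirD b (g j) z)).
  by apply: is_derive_sum => j; apply: D; rewrite -ltnS.
apply: (is_derive_line_eq e0 _ DS (lup_is_derive b (h_lup zB))) => t te.
rewrite fct_sumE -eqF //; apply: unit_ball_shift => //; exact/He/ltW.
Qed.

(** In the differentiated equation one [P] is due to h', after |h| is bounded by the equation, one
    to the derivatives of the g_j, and the 1 to the terms g_j F^(p-j+1) with j >= 1. The scale [l]
    is meant to be [L] at the centre of the circle on which [z] lies. *)
Lemma equation_bound (P T l : R) z : 0 <= P -> 0 <= T -> 0 < l -> unit_ball z -> g 0%N z != 0 ->
  (forall j, (j <= p)%N -> cabs (g j z) <= T * l ^+ j * cabs (g 0%N z)) ->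
  (forall j, (j <= p)%N -> cabs (dirD b (g j) z) <= P * l * cabs (g j z)) ->
  cabs (dirD b h z) <= P * l * cabs (h z) ->
  (p.+1)`!%:R * cabs (slice_coef b F l z p.+1) <=
    (2 * P + 1) * T * \sum_(k < p.+1) k`!%:R * cabs (slice_coef b F l z k).
Proof.
move=> P0 T0 l0 zB g0 Hg Hg' Hh'.
pose X k := cabs (dirDn b k F z) / l ^+ k.
have X0 k : 0 <= X k by rewrite divr_ge0 ?cabs_ge0 // exprn_ge0 // ltW.
have EX k : k`!%:R * cabs (slice_coef b F l z k) = X k.
  by rewrite cabs_slice_coef // mulrA mulrCA divff ?mulr1 // pnatr_eq0 -lt0n fact_gt0.
have DX k : cabs (dirDn b k F z) = X k * l ^+ k.
  by rewrite divfK // expf_neq0 // gt_eqF.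
rewrite EX; under eq_bigr do rewrite EX.
set S := \sum_(k < p.+1) X k.
have Srev : \sum_(j < p.+1) X (p - j)%N = S.
  rewrite /S (reindex_inj rev_ord_inj) /=; apply: eq_bigr => j _.
  by rewrite subSS subKn // -ltnS.
set G := cabs (g 0%N z); have G0 : 0 < G by rewrite cabs_gt0.
have lp0 : 0 < l ^+ p by rewrite exprn_gt0.
have t1 : \sum_(j < p.+1) cabs (g j z) * cabs (dirDn b (p - j) F z) <= T * G * l ^+ p * S.
  rewrite -Srev mulr_sumr; apply: ler_sum => j _; have jp : (j <= p)%N by rewrite -ltnS.
  rewrite DX; apply: (@le_trans _ _ (T * l ^+ j * G * (X (p - j)%N * l ^+ (p - j)))).
    by rewrite ler_wpM2r ?Hg // mulr_ge0 // exprn_ge0 // ltW.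
  have -> : l ^+ p = l ^+ j * l ^+ (p - j) by rewrite -exprD subnKC.
  by rewrite le_eqVlt; apply/orP; left; apply/eqP; ring.
have t2 : \sum_(j < p) cabs (g j.+1 z) * cabs (dirDn b (p - j.+1).+1 F z) <=
    T * G * l ^+ p.+1 * S.
  apply: (@le_trans _ _ (T * G * l ^+ p.+1 * \sum_(j < p) X (p - j)%N)); last first.
    rewrite ler_wpM2l ?mulr_ge0 ?(ltW G0) ?exprn_ge0 ?(ltW l0) // -Srev big_ord_recr /=.
    by rewrite lerDl.
  rewrite mulr_sumr; apply: ler_sum => j _; have jp := ltn_ord j.
  rewrite subnSK // DX.
  apply: (@le_trans _ _ (T * l ^+ j.+1 * G * (X (p - j)%N * l ^+ (p - j)))).
    by rewrite ler_wpM2r ?Hg // mulr_ge0 // exprn_ge0 // ltW.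
  have -> : l ^+ p.+1 = l ^+ j.+1 * l ^+ (p - j) by rewrite -exprD addSn subnKC // ltnW.
  by rewrite le_eqVlt; apply/orP; left; apply/eqP; ring.
have t3 : cabs (h z) <= \sum_(j < p.+1) cabs (g j z) * cabs (dirDn b (p - j) F z).
  rewrite -eqF //; apply: le_trans (cabs_sum _ _ _) _.
  by apply: ler_sum => j _; rewrite cabsM.
have t4 : cabs (\sum_(j < p.+1) dirDn b (p - j) F z * dirD b (g j) z) <=
    P * l * \sum_(j < p.+1) cabs (g j z) * cabs (dirDn b (p - j) F z).
  apply: le_trans (cabs_sum _ _ _) _; rewrite mulr_sumr; apply: ler_sum => j _.
  rewrite cabsM mulrC mulrA ler_wpM2r ?cabs_ge0 // Hg' //.
  by rewrite -ltnS.
have t5 : cabs (\sum_(j < p) g j.+1 z * dirDn b (p - j.+1).+1 F z) <=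
    \sum_(j < p) cabs (g j.+1 z) * cabs (dirDn b (p - j.+1).+1 F z).
  apply: le_trans (cabs_sum _ _ _) _.
  by apply: ler_sum => j _; rewrite cabsM.
have split_sum (A B : nat -> CC R) : \sum_(j < p.+1) (A j + B j) =
    A 0%N + \sum_(j < p) A j.+1 + \sum_(j < p.+1) B j.
  by rewrite big_split big_ord_recl.
have E := etrans (esym (split_sum (fun j => g j z * dirDn b (p - j).+1 F z)
  (fun j => dirDn b (p - j) F z * dirD b (g j) z))) (equation_dirD zB).
rewrite subn0 in E.
have gen (x s1 s2 y : CC R) : x + s2 + s1 = y -> x = y - s1 - s2 by move=> <-; ring.
have key := gen _ _ _ _ E.
have Pl : 0 <= P * l by rewrite mulr_ge0 // ltW.
have : G * (X p.+1 * l ^+ p.+1) <= (2 * P + 1) * (T * G * l ^+ p.+1 * S).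
  rewrite -DX -cabsM key; apply: le_trans (cabsB _ _) _.
  have := cabsB (dirD b h z) (\sum_(j < p.+1) dirDn b (p - j) F z * dirD b (g j) z).
  have u1 := le_trans Hh' (ler_wpM2l Pl (le_trans t3 t1)).
  have u2 := le_trans t4 (ler_wpM2l Pl t1).
  have u3 := le_trans t5 t2.
  have -> : (2 * P + 1) * (T * G * l ^+ p.+1 * S) =
     P * l * (T * G * l ^+ p * S) + P * l * (T * G * l ^+ p * S) + T * G * l ^+ p.+1 * S.
    by rewrite exprS; ring.
  lra.
have Gl : 0 < G * l ^+ p.+1 by rewrite mulr_gt0 // exprn_gt0.
move=> H; rewrite -(ler_pM2l Gl).
rewrite (_ : _ * X p.+1 = G * (X p.+1 * l ^+ p.+1)); last by ring.
by apply: le_trans H _; rewrite le_eqVlt; apply/orP; left; apply/eqP; ring.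
Qed.

End Equation.

Section Regular.
Variables (R : realType) (n : nat) (b : 'rV[CC R]_n) (L : 'rV[CC R]_n -> R) (beta : R).
Local Notation rC := (real_complex R : R -> CC R).
Implicit Types (z w : 'rV[CC R]_n) (F : 'rV[CC R]_n -> CC R).
Hypotheses (beta_gt1 : 1 < beta) (LQ : class_Q b beta L).
Variable g0 : 'rV[CC R]_n -> CC R.
Hypothesis g0_lup : lup_ball g0.

Let beta0 : 0 < beta. Proof. exact: lt_trans beta_gt1. Qed.

Let L_gt0 z : unit_ball z -> 0 < L z.
Proof. by case: LQ => _ H _ _; apply: H. Qed.

Let cabs_div (d : CC R) (l : R) : 0 < l -> cabs (d / rC l) = cabs d / l.
Proof. by move=> l0; rewrite cabsM cabsV cabs_realp // ltW. Qed.

(** A property of the whole slice: [t] is not confined to a disc, whence the invariance under shifts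
    along [b]. *)
Definition regular z := unit_ball z /\ exists t, unit_ball (z + t *: b) /\ g0 (z + t *: b) != 0.

Lemma regular_shift z d : regular z -> cabs d <= beta ->
  regular (z + (d / rC (L z)) *: b).
Proof.
move=> [zB [t [tB gt]]] db; split.
  by apply: (slice_point_ball LQ) => //; rewrite cabs_div ?L_gt0 // ler_pM2r ?invr_gt0 ?L_gt0.
exists (t - d / rC (L z)).
by rewrite -addrA -scalerDl [_ + (t - _)]addrC subrK.
Qed.

(** Otherwise g_0 vanishes on a disc of the slice, and the identity theorem carries this to the
    point where it does not. It is the positivity that [good_circle] asks for. *)
Lemma regular_coef z : regular z -> exists k, slice_coef b g0 (L z) z k != 0.
Proof.
move=> [zB [t [tB gt]]]; apply: contrapT => Hno; move/negP: gt; apply; apply/eqP.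
have Lz := L_gt0 zB.
have T0 k : slice_coef b g0 (L z) z k = 0 by apply/eqP; apply: contrapT => /negP Hk;
  apply: Hno; exists k.
have H := slice_coef_ps_scaled beta_gt1 LQ g0_lup zB.
have G0 s : cabs s < beta -> g0 (z + (s / rC (L z)) *: b) = 0.
  move=> sb; apply: (has_ps_eq H _ sb sb).
  by rewrite (_ : slice_coef b g0 (L z) z = fun _ => 0); [exact: has_ps_cst0 | apply/funext].
have d0 : 0 < beta / (L z * (cabs t + 1)).
  by rewrite divr_gt0 // mulr_gt0 // ltr_wpDl // cabs_ge0.
apply: (identity_ball g0_lup zB tB d0) => s sd.
rewrite (_ : z + t *: b - z = t *: b) ?scalerA; last by rewrite addrAC subrr add0r.
have LC : rC (L z) != 0 by rewrite -cabs_gt0 cabs_realp // ltW.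
rewrite (_ : s * t = (s * t * rC (L z)) / rC (L z)); last by rewrite mulfK.
apply: G0.
rewrite !cabsM cabs_realp ?(ltW Lz) //.
rewrite ltr_pdivlMr in sd; last by rewrite mulr_gt0 // ltr_wpDl // cabs_ge0.
apply: le_lt_trans sd; rewrite -mulrA ler_wpM2l ?cabs_ge0 // mulrC ler_wpM2l ?(ltW Lz) //.
by rewrite lerDl.
Qed.

(** A zero y of g_0 with the shifted point in its disc of radius r / L y lies, in the variable
    scaled by [L z], within r L z / L y of [s]; comparing both values of [L] with that at the
    shifted point gives L z / L y <= l2 / l1. *)
Lemma notin_Gset (l1 l2 r eps : R) z s : 0 < l1 ->
  (forall z t, unit_ball z -> cabs t <= beta / L z ->
     l1 * L z <= L (z + t *: b) <= l2 * L z) ->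
  0 < r <= beta -> r * l2 <= eps * l1 -> regular z -> cabs s <= beta ->
  (forall s', cabs (s' - s) <= eps -> g0 (z + (s' / rC (L z)) *: b) != 0) ->
  ~ Gset L b r g0 (z + (s / rC (L z)) *: b).
Proof.
move=> l10 Hl /andP[r0 rb] re zreg sb Hs [z0 z0B].
have [zB [t1 [t1B gt1]]] := zreg; have Lz := L_gt0 zB.
set z' := z + _; have [z'B _] := regular_shift zreg sb.
rewrite -/z' in z'B; have Lz' := L_gt0 z'B.
rewrite /Gset_at; case: asboolP => [//|_];
  case: asboolP => [Hz [t tB E]|_ [a [yB ya] [t ta E]]].
  move/negP: gt1; apply; apply/eqP.
  have E1 : z + t1 *: b = z0 + (t - s / rC (L z) + t1) *: b.
    by rewrite !scalerDl scaleNr !addrA E /z' addrK.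
  by rewrite E1; apply: Hz; rewrite /slice_dom /= -E1.
set y := z0 + a *: b in yB ya.
have yB' : unit_ball y by [].
have Ly := L_gt0 yB'.
have ta' : cabs (t - a) <= r / L y by [].
have E2 : z' = y + (t - a) *: b.
  by rewrite /y -E scalerBl -addrA; congr (_ + _); rewrite [RHS]addrC subrK.
have tab : cabs (t - a) <= beta / L y.
  by apply: le_trans ta' _; rewrite ler_pM2r ?invr_gt0.
have /andP[_ hy] := Hl y (t - a) yB' tab; rewrite -E2 in hy.
have /andP[hz _] : l1 * L z <= L z' <= l2 * L z.
  by apply: Hl => //; rewrite cabs_div // ler_pM2r ?invr_gt0.
have LC : rC (L z) != 0 by rewrite -cabs_gt0 cabs_realp // ltW.
pose s' := s - rC (L z) * (t - a).
have /negP : g0 (z + (s' / rC (L z)) *: b) != 0.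
  apply: Hs; rewrite /s' addrAC subrr add0r cabsN cabsM cabs_realp ?(ltW Lz) //.
  have h1 : cabs (t - a) * L y <= r by rewrite -ler_pdivlMr.
  have l20 : 0 < l2 by rewrite -(pmulr_lgt0 _ Ly); apply: lt_le_trans hy.
  have c0 := cabs_ge0 (t - a).
  rewrite -(ler_pM2r l10).
  apply: (@le_trans _ _ (cabs (t - a) * (l2 * L y))).
    by rewrite mulrAC mulrC ler_wpM2l // mulrC; apply: le_trans hz hy.
  by apply: le_trans re; rewrite mulrCA [r * _]mulrC ler_wpM2l // ltW.
apply; apply/eqP; rewrite -ya; congr g0.
rewrite /s' mulrBl [rC (L z) * _]mulrC mulfK // scalerBl addrA -/z' E2.
by rewrite addrK.
Qed.

End Regular.

(** * Geometric growth of the coefficients on regular slices *)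

Section Hayman.
Variables (R : realType) (n : nat) (b : 'rV[CC R]_n) (L : 'rV[CC R]_n -> R) (beta : R).
Local Notation rC := (real_complex R : R -> CC R).
Implicit Types (z w : 'rV[CC R]_n).
Hypotheses (beta_gt1 : 1 < beta) (LQ : class_Q b beta L).

Let beta0 : 0 < beta. Proof. exact: lt_trans beta_gt1. Qed.

Let L_gt0 z : unit_ball z -> 0 < L z.
Proof. by case: LQ => _ H _ _; apply: H. Qed.

Lemma common_index K (u : 'I_K -> 'rV[CC R]_n -> CC R) :
  (forall i, bounded_index L b (u i)) ->
  exists m0, forall i z, unit_ball z ->
    exists2 k, (k <= m0)%N & forall m,
      cabs (slice_coef b (u i) (L z) z m) <= cabs (slice_coef b (u i) (L z) z k).
Proof.
move=> /choice[m Hm]; exists (\max_i m i)%N => i z zB.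
have [k km Hk] := bounded_index_dominant LQ zB (fun j => Hm i j z zB).
by exists k => //; apply: leq_trans km (leq_bigmax i).
Qed.

Variables (p : nat) (g : nat -> 'rV[CC R]_n -> CC R) (h F : 'rV[CC R]_n -> CC R).
Hypotheses (g_lup : forall j, (j <= p)%N -> lup_ball (g j)) (h_lup : lup_ball h)
  (F_lup : lup_ball F)
  (g_index : forall j, (j <= p)%N -> bounded_index L b (g j)) (h_index : bounded_index L b h)
  (g_bound : forall r : R, 0 < r <= beta ->
      exists2 T : R, 0 < T &
        forall z, (@unit_ball R n `\` Gset L b r (g 0%N)) z ->
        forall j, (1 <= j <= p)%N ->
          cabs (g j z) <= T * L z ^+ j * cabs (g 0%N z))
  (eqF : forall z, unit_ball z -> \sum_(j < p.+1) g j z * dirDn b (p - j) F z = h z).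

Lemma hayman_local : exists (rho : R) (N0 : nat) (B : R), [/\ 0 < rho <= 1, 0 <= B &
  forall z, regular b (g 0%N) z -> forall k,
    cabs (slice_coef b F (L z) z k) * rho ^+ k <= B * \sum_(i < N0) cabs (slice_coef b F (L
      z) z i)].
Proof.
have [l1 [l2 [/andP[l10 l11] l21 Hl]]] := class_Q_bounds beta0 LQ.
pose u (i : 'I_p.+2) := if (i <= p)%N then g i else h.
have u_lup i : lup_ball (u i) by rewrite /u; case: ifP => // /g_lup.
have u_index i : bounded_index L b (u i) by rewrite /u; case: ifP => // /g_index.
have [m0 Hm0] := common_index u_index.
have [rho [eps [P [/andP[rho0 rho4] eps0 P0 Hcirc]]]] := good_circle R p.+2 m0.
(* Small enough for [notin_Gset]: an annulus of half-width [eps] without zeros then keeps the circle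
   outside the exceptional set of parameter [r]. *)
pose r := Num.min beta (eps * l1 / l2).
have l20 : 0 < l2 by lra.
have r0 : 0 < r by rewrite lt_min beta0 divr_gt0 // mulr_gt0.
have rb : r <= beta by rewrite ge_min lexx.
have rl : r * l2 <= eps * l1 by rewrite -ler_pdivlMr // ge_min lexx orbT.
have [|T T0 HT] := g_bound (r := r); first by rewrite r0.
(* [l2 ^+ p] pays for replacing [L] on the circle by [L z]; the 1 covers the index 0, on which
   [g_bound] is silent. *)
pose T' := T * l2 ^+ p + 1.
have T'0 : 0 <= T' by rewrite addr_ge0 // mulr_ge0 ?exprn_ge0 // ltW.
have C0 : 0 <= (2 * P + 1) * T' by rewrite mulr_ge0 // addr_ge0 // mulr_ge0.
have rho2 : 0 < rho / 2 <= 1 by apply/andP; lra.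
have [N0 [B [B0 HB]]] := coef_absorb p C0 rho2.
exists (rho / 2), N0, B; split=> // z zreg.
have zB : unit_ball z by case: zreg.
have Lz := L_gt0 zB.
pose pt s := z + (s / rC (L z)) *: b.
pose a i := slice_coef b (u i) (L z) z.
have /choice[k Hk] : forall i, exists k, (k <= m0)%N /\ forall m, cabs (a i m) <= cabs (a i k).
  by move=> i; have [k k1 k2] := Hm0 i z zB; exists k.
have U_ps i : has_ps (fun s => u i (pt s)) 1 (a i).
  by apply: has_ps_le (slice_coef_ps_scaled beta_gt1 LQ (u_lup i) zB); exact: ltW.
have [|||rho' /andP[r1 r2] Hgood] :=
  Hcirc (fun i s => u i (pt s)) a (fun i => cabs (a i (k i))).
- by [].
- by move=> i m; case: (Hk i).
- by move=> i; exists (k i); [case: (Hk i)|].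
apply: (HB (fun s => F (pt s)) _ beta rho'); first by apply/andP; lra.
- by have := beta_gt1; lra.
- exact: slice_coef_ps_scaled.
move=> s sr.
have sb : cabs s <= beta by have := beta_gt1; lra.
have [z'B d0 HF] := slice_coef_recenter beta_gt1 LQ F_lup zB sb.
set z' := z + _ in z'B d0 HF.
exists (beta * L z / L z'), (slice_coef b F (L z) z'); split=> //.
have zz : pt s = z' by [].
have /andP[Lz1 Lz2] : l1 * L z <= L z' <= l2 * L z.
  apply: Hl => //; rewrite cabsM cabsV cabs_realp ?(ltW Lz) //.
  by rewrite ler_pM2r ?invr_gt0.
have eps_s : `|cabs s - rho'| <= eps by rewrite sr subrr normr0 ltW.
pose i0 : 'I_p.+2 := ord0.
have ui0 : u i0 = g 0%N by [].
have Mi0 : 0 < cabs (a i0 (k i0)).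
  have [m Hm] := regular_coef beta_gt1 LQ (g_lup (leq0n p)) zreg.
  apply: (@lt_le_trans _ _ (cabs (a i0 m))); first by rewrite cabs_gt0 /a ui0.
  by case: (Hk i0).
have nz s' : `|cabs s' - rho'| <= eps -> g 0%N (pt s') != 0.
  by move=> hs'; have [/(_ Mi0)] := Hgood i0 s' hs'; rewrite ui0.
have notG : ~ Gset L b r (g 0%N) z'.
  have r0b : 0 < r <= beta by rewrite r0.
  refine (notin_Gset LQ l10 Hl r0b rl zreg sb _).
  move=> s' ss'; apply: nz; rewrite -sr; apply: le_trans ss'.
  rewrite ler_norml; apply/andP; split.
    have := cabs_dist s s' 0; rewrite !subr0 cabs_distC; lra.
  by have := cabs_dist s' s 0; rewrite !subr0; lra.
have deriv_u i : cabs (dirD b (u i) z') <= P * L z * cabs (u i z').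
  have [_ dd HU] := slice_coef_recenter beta_gt1 LQ (u_lup i) zB sb.
  have [_ /(_ _ _ dd HU)] := Hgood i s eps_s.
  rewrite cabs_slice_coef // (_ : 1`!%:R = 1) // divr1 expr1 -/z' zz ler_pdivrMr //.
  by rewrite mulrAC.
apply: (@equation_bound _ _ _ _ g h) => //.
- by rewrite -zz; apply: nz.
- move=> j jp; have [->|j0] := posnP j.
    rewrite expr0 mulr1 ler_peMl ?cabs_ge0 // /T' lerDr mulr_ge0 ?exprn_ge0 //; lra.
  have jT : (1 <= j <= p)%N by rewrite j0.
  apply: le_trans (HT z' _ j jT) _; first by split.
  rewrite ler_wpM2r ?cabs_ge0 //.
  apply: (@le_trans _ _ (T * (l2 * L z) ^+ j)).
    rewrite ler_wpM2l ?(ltW T0) //; apply: lerXn2r;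
      rewrite ?nnegrE ?mulr_ge0 ?(ltW Lz) ?(ltW l20) //.
    by rewrite ltW // L_gt0.
  rewrite exprMn mulrA ler_wpM2r ?exprn_ge0 ?(ltW Lz) //.
  apply: (@le_trans _ _ (T * l2 ^+ p)); last by rewrite lerDl.
  by rewrite ler_wpM2l ?(ltW T0) // ler_weXn2l.
- move=> j jp; have jp2 : (j < p.+2)%N by rewrite ltnS ltnW.
  by have := deriv_u (Ordinal jp2); rewrite /u /= jp.
by have := deriv_u ord_max; rewrite /u /= ltnn.
Qed.

End Hayman.

(** * Enlarging the radius *)

Section RadiusExtension.
Variables (R : realType) (n : nat) (b : 'rV[CC R]_n) (L : 'rV[CC R]_n -> R) (beta : R).
Local Notation rC := (real_complex R : R -> CC R).
Implicit Types (z w : 'rV[CC R]_n).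
Hypotheses (beta_gt1 : 1 < beta) (LQ : class_Q b beta L).
Variables (F : 'rV[CC R]_n -> CC R) (G : 'rV[CC R]_n -> Prop).
Hypotheses (F_lup : lup_ball F) (G_ball : forall z, G z -> unit_ball z)
  (G_shift : forall z d, G z -> cabs d <= beta -> G (z + (d / rC (L z)) *: b)).

Let beta0 : 0 < beta. Proof. exact: lt_trans beta_gt1. Qed.

Let L_gt0 z : G z -> 0 < L z.
Proof. by case: LQ => _ H _ _ /G_ball; apply: H. Qed.

Variable N0 : nat.

Let Phi z := \sum_(i < N0) cabs (slice_coef b F (L z) z i).

Let Phi_ge0 z : 0 <= Phi z.
Proof. by apply: sumr_ge0 => i _; exact: cabs_ge0. Qed.

Let geom_bound (r B : R) := forall z, G z -> forall k,
  cabs (slice_coef b F (L z) z k) * r ^+ k <= B * Phi z.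

Variables rho B0 : R.
Hypotheses (rho01 : 0 < rho <= 1) (B0_ge0 : 0 <= B0) (hayman : geom_bound rho B0).

(* The bounds of [geom_bound r] control the first [N0] coefficients at points
   close to the circle of radius [r]; there [hayman] controls the others, and
   [has_ps_coef_extend] carries this back to the centre. *)
Lemma radius_step l1 l2 r B : 0 < l1 -> 1 <= l2 ->
  (forall z t, unit_ball z -> cabs t <= beta / L z ->
     l1 * L z <= L (z + t *: b) <= l2 * L z) ->
  0 < r <= 1 -> 0 <= B -> geom_bound r B ->
  exists B', 0 <= B' /\ geom_bound (r + rho / l2 / 4) B'.
Proof.
move=> l10 l21 Hl /andP[r0 r1] Bge HB.
have [rho0 rho1] := andP rho01; have b1 := beta_gt1.
have l20 : 0 < l2 by lra.
pose rho2 := rho / l2; have rho20 : 0 < rho2 by rewrite divr_gt0.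
(* The local series live on the circle of radius [r - y] > 0 and are used up to [rho2 / 2] beyond
   it, so at least [rho2 / 4] is gained over [r]. *)
pose y := Num.min (rho2 / 4) (r / 2).
have y0 : 0 < y by rewrite lt_min !divr_gt0.
have yr : y <= r / 2 by rewrite ge_min lexx orbT.
have y4 : y <= rho2 / 4 by rewrite ge_min lexx.
pose K1 := B / (1 - (r - y / 2) / r).
have q1 : 0 < 1 - (r - y / 2) / r.
  by rewrite subr_gt0 ltr_pdivrMr // mul1r; lra.
have K10 : 0 <= K1 by rewrite divr_ge0 // ltW.
pose c := 2 / y / l1 + 1.
have c0 : 0 <= 2 / y / l1 by rewrite !divr_ge0 // ltW.
(* [K1] bounds F on the disc of radius [r - y / 2]; Cauchy's estimate at radius [y / 2] and the
   change of scale from [L z] to [L z'] together cost at most a factor [c] per order. *)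
pose K2 := \sum_(i < N0) K1 * c ^+ i.
have K20 : 0 <= K2.
  by apply: sumr_ge0 => i _; rewrite mulr_ge0 // exprn_ge0 // /c; lra.
exists (B0 * K2 * 2); split; first by rewrite !mulr_ge0.
move=> z Gz k; have zB := G_ball Gz; have Lz := L_gt0 Gz; have Pz := Phi_ge0 z.
pose f s := F (z + (s / rC (L z)) *: b).
have Hf : has_ps f beta (slice_coef b F (L z) z) by exact: slice_coef_ps_scaled.
have loc d : cabs d = r - y -> exists (delta : R) c, [/\ 0 < delta,
   has_ps (fun s => f (d + s)) delta c &
   forall j, cabs (c j) * rho2 ^+ j <= B0 * K2 * Phi z].
  move=> dr; have db : cabs d <= beta by lra.
  have [z'B d0 HF] := slice_coef_recenter beta_gt1 LQ F_lup zB db.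
  set z' := z + _ in z'B d0 HF.
  have Gz' : G z' by exact: G_shift.
  have Lz' := L_gt0 Gz'.
  have /andP[Lz1 Lz2] : l1 * L z <= L z' <= l2 * L z.
    apply: Hl => //; rewrite cabsM cabsV cabs_realp ?(ltW Lz) //.
    by rewrite ler_pM2r ?invr_gt0.
  exists (beta * L z / L z'), (slice_coef b F (L z) z'); split=> // j.
  have cau i : cabs (slice_coef b F (L z) z' i) * (y / 2) ^+ i <= K1 * Phi z.
    have [|b' Hb'] := @has_ps_recenter _ _ _ _ d Hf; first by lra.
    have E : slice_coef b F (L z) z' = b'.
      apply/funext; apply: (has_ps_uniq d0 _ ltr01 HF Hb' (fun _ _ => erefl)).
      by rewrite subr_gt0; lra.
    rewrite E; apply: (has_ps_cauchy Hb'); first by apply/andP; lra.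
    move=> s sy; have ds : cabs (d + s) <= r - y / 2 by apply: le_trans (cabsD _ _) _; lra.
    have ds0 := cabs_ge0 (d + s).
    have dsr : cabs (d + s) < r by lra.
    have := @has_ps_remainder _ f beta (slice_coef b F (L z) z) r (B * Phi z) (d + s) 0 Hf
      (HB z Gz) dsr.
    rewrite /psum big_ord0 subr0 expr0 mulr1 => h; apply: le_trans (h _) _; first by lra.
    rewrite /K1 mulrAC ler_wpM2r // ler_wpM2l // lef_pV2 ?posrE ?q1 //.
      by rewrite lerD2l lerN2 ler_pM2r ?invr_gt0.
    by rewrite subr_gt0 ltr_pdivrMr // mul1r.
  have Phi' : Phi z' <= K2 * Phi z.
    rewrite /K2 mulr_suml; apply: ler_sum => i _; rewrite (slice_coef_rescale _ _ _ _ Lz Lz').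
    have y20 : 0 < (y / 2) ^+ i by rewrite exprn_gt0 // divr_gt0.
    have h1 : cabs (slice_coef b F (L z) z' i) <= K1 * Phi z / (y / 2) ^+ i by rewrite
      ler_pdivlMr.
    have h2 : (L z / L z') ^+ i <= (1 / l1) ^+ i.
      apply: lerXn2r; rewrite ?nnegrE ?divr_ge0 ?(ltW Lz) ?(ltW Lz') ?(ltW l10) //.
      by rewrite ler_pdivlMr // mulrAC ler_pdivrMr // mul1r mulrC.
    have h3 : 0 <= L z / L z' by rewrite divr_ge0 ?(ltW Lz) ?(ltW Lz').
    apply: (@le_trans _ _ (K1 * Phi z / (y / 2) ^+ i * (1 / l1) ^+ i)).
      by apply: ler_pM; rewrite ?cabs_ge0 ?exprn_ge0.
    rewrite -exprVn -mulrA -exprMn [K1 * _ ^+ i * _]mulrAC.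
    apply: ler_wpM2l; first by rewrite mulr_ge0.
    apply: lerXn2r; rewrite ?nnegrE /c.
    - by rewrite invf_div mulr_ge0 // divr_ge0 // ltW.
    - by lra.
    by rewrite invf_div mulrA mulr1; lra.
  apply: (@le_trans _ _ (cabs (slice_coef b F (L z') z' j) * rho ^+ j)).
    rewrite (slice_coef_rescale _ _ _ _ Lz' Lz) -[leLHS]mulrA -exprMn ler_wpM2l ?cabs_ge0 //.
    have h1 : 0 <= L z' / L z by rewrite divr_ge0 ?(ltW Lz) ?(ltW Lz').
    have h2 : L z' / L z * rho2 <= rho.
      have : L z' / L z <= l2 by rewrite ler_pdivrMr.
      by move=> /(ler_wpM2r (ltW rho20)); rewrite {2}/rho2 [l2 * _]mulrC divfK ?gt_eqF.
    by apply: lerXn2r => //; rewrite nnegrE ?(mulr_ge0 h1 (ltW rho20)) // ltW.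
  by apply: le_trans (hayman Gz' j) _; rewrite -mulrA ler_wpM2l.
have x01 : 0 <= rho2 / 2 < rho2 by apply/andP; lra.
have ry : 0 < r - y < beta by apply/andP; lra.
have := has_ps_coef_extend Hf ry rho20 x01 loc k.
rewrite (_ : 1 - rho2 / 2 / rho2 = 1 / 2); last first.
  by rewrite [rho2 / 2]mulrC mulfK ?gt_eqF //; field.
rewrite invf_div divr1 => h; rewrite [B0 * K2 * 2 * _]mulrAC; apply: le_trans h.
rewrite ler_wpM2l ?cabs_ge0 //; apply: lerXn2r; rewrite ?nnegrE -/rho2; lra.
Qed.

(** Only the constant [B] deteriorates from step to step; the gain depends on [rho] and [l2] alone,
    so finitely many steps suffice. They stop once 1 is passed, because the circles must stay in the
    disc of radius [beta]. *)
Lemma radius_gt1 : exists r B : R, 1 < r /\ geom_bound r B.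
Proof.
have [l1 [l2 [/andP[l10 _] l21 Hl]]] := class_Q_bounds beta0 LQ.
have [rho0 rho1] := andP rho01.
pose e := rho / l2 / 4; have e0 : 0 < e by rewrite !divr_gt0 //; lra.
have ind k : exists r B : R, [/\ 0 < r, 0 <= B, geom_bound r B & 1 < r \/ rho + k%:R * e <= r].
  elim: k => [|k [r [B [r0 Bge HB Hr]]]].
    by exists rho, B0; split=> //; right; rewrite mul0r addr0.
  have [r1|r1] := leP r 1; last by exists r, B; split=> //; left.
  have [|B' [B'0 HB']] := radius_step l10 l21 Hl _ Bge HB; first by rewrite r0.
  exists (r + e), B'; split=> //; first by rewrite addr_gt0.
  right; case: Hr => [|Hr]; first by rewrite ltNge r1.
  by rewrite -natr1 mulrDl mul1r addrA lerD2r.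
pose k := (Num.truncn e^-1).+1.
have k1 : 1 <= k%:R * e by rewrite -ler_pdivrMr // div1r ltW // truncnS_gt.
have [r [B [r0 _ HB Hr]]] := ind k.
by exists r, B; split=> //; case: Hr => //; lra.
Qed.

Lemma bounded_index_on : exists m0 : nat, forall m z, G z ->
  index_term L b F z m <= \big[Num.max/0]_(k < m0.+1) index_term L b F z k.
Proof.
have [r [B [r1 HB]]] := radius_gt1.
have r0 : 0 < r by lra.
have q01 : 0 <= r^-1 < 1 by rewrite invr_ge0 (ltW r0) /= invf_lt1.
(* [Phi] is at most [N0] times the maximum of the early terms, so beyond [m1] the decay r^-m
   compensates both constants. *)
have [m1 Hm1] := vanishing_geom (`|B| * N0%:R) q01 ltr01.
exists (maxn m1 N0) => m z Gz; have zB := G_ball Gz.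
set Mx := \big[_/_]_(k < _) _.
have le_Mx k : (k <= maxn m1 N0)%N -> index_term L b F z k <= Mx.
  move=> km; have kk : (k < (maxn m1 N0).+1)%N by rewrite ltnS.
  exact: (le_bigmax_cond 0 (fun i : 'I_(maxn m1 N0).+1 => index_term L b F z i) (j :=
    Ordinal kk)).
have [mm|] := leqP m (maxn m1 N0); first exact: le_Mx.
rewrite gtn_max => /andP[mm1 mN0].
have Mx0 : 0 <= Mx by apply: le_trans (le_Mx 0%N _) => //;
  rewrite (index_term_slice_coef LQ) // cabs_ge0.
rewrite (index_term_slice_coef LQ) //.
have rm : 0 < r ^+ m by rewrite exprn_gt0.
rewrite -(ler_pM2r rm); apply: le_trans (HB z Gz m) _.
have PM : Phi z <= N0%:R * Mx.
  have -> : N0%:R * Mx = \sum_(i < N0) Mx by rewrite sumr_const card_ord mulr_natl.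
  apply: ler_sum => i _; rewrite -(index_term_slice_coef LQ) //; apply: le_Mx.
  by rewrite leq_max (ltnW (ltn_ord i)) orbT.
apply: (@le_trans _ _ (`|B| * (N0%:R * Mx))).
  apply: (le_trans (ler_wpM2r (Phi_ge0 z) (ler_norm B))); exact: ler_wpM2l.
have := Hm1 m (ltnW mm1); rewrite exprVn ler_pdivrMr // mul1r => h.
by rewrite mulrA mulrC ler_wpM2l.
Qed.

End RadiusExtension.

(** * Exceptional slices *)

Section Density.
Variables (R : realType) (n : nat) (b : 'rV[CC R]_n) (L : 'rV[CC R]_n -> R) (beta : R).
Local Notation rC := (real_complex R : R -> CC R).
Implicit Types (z w v : 'rV[CC R]_n) (F : 'rV[CC R]_n -> CC R).
Hypotheses (beta_gt1 : 1 < beta) (LQ : class_Q b beta L).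

Lemma near0_cabs (e : R) : 0 < e -> \forall t \near (0 : CC R), cabs t < e.
Proof.
move=> e0; have eC : 0 < rC e by rewrite (rC_lt 0).
have : \forall t \near (0 : CC R), `|t| < rC e by exact: nbhs0_lt.
by apply: filterS => t; rewrite normE rC_lt.
Qed.

Lemma near0_ball (P : set (CC R)) : (\forall t \near (0 : CC R), P t) ->
  exists2 e : R, 0 < e & forall t, cabs t < e -> P t.
Proof.
move=> /nbhs_normP[_ /= /gt0_rC[e e0 ->] He]; exists e => // t te.
by apply: He; rewrite /= sub0r normrN normE rC_lt.
Qed.

Lemma line_near z v (A : set 'rV[CC R]_n) : nbhs z A ->
  \forall t \near (0 : CC R), A (z + t *: v).
Proof.
move=> /nbhs_normP[e /= e0 He].
have v0 : 0 < `|v| + 1 :> CC R by rewrite ltr_wpDl.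
have [d d0 ed] := gt0_rC (divr_gt0 e0 v0).
apply: filterS (near0_cabs d0) => t td; apply: He;
  rewrite /= opprD addrA subrr add0r normrN normrZ.
have te : `|t| < e / (`|v| + 1).
  by rewrite ed normE rC_lt.
rewrite ltr_pdivlMr // in te; apply: le_lt_trans te.
by rewrite ler_wpM2l // lerDl.
Qed.

Lemma lup_line_cvg F z v : lup F z ->
  (fun t : CC R => cabs (F (z + t *: v))) @ (0 : CC R) --> cabs (F z).
Proof.
move=> /(lup_dirD v)[delta [c [d0 Hc _]]].
have [||B HB] := Hc (delta / 2); rewrite ?divr_gt0 //; first by lra.
have F0 : F z = c 0%N by rewrite -(has_ps0 d0 Hc) scale0r addr0.
apply/(@cvgrPdist_le R R (CC R) (nbhs (0 : CC R)) _ (fun t : CC R => cabs (F (z + t *: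
  v)))) => eps e0.
pose eta := Num.min (delta / 2) (eps * (delta / 2) / (`|B| + 1)).
have B1 : 0 < `|B| + 1 by rewrite ltr_wpDl.
have eta0 : 0 < eta by rewrite lt_min !(divr_gt0, mulr_gt0).
apply: filterS (near0_cabs eta0) => t; rewrite lt_min => /andP[td te].
have := HB 1%N t (ltW td); rewrite /psum big_ord1 expr0 mulr1 -F0 expr1 => h.
have t0 := cabs_ge0 t.
have h2 : B * (cabs t / (delta / 2)) <= eps.
  apply: (@le_trans _ _ (`|B| * (cabs t / (delta / 2)))).
    by rewrite ler_wpM2r ?ler_norm // divr_ge0 // divr_ge0 // ltW.
  rewrite mulrA ler_pdivrMr ?divr_gt0 //.
  by rewrite ltr_pdivlMr // in te; nra.
apply: le_trans (le_trans h h2).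
rewrite ler_norml; apply/andP; split.
  by have := cabs_dist (F (z + t *: v)) (F z) 0; rewrite !subr0; lra.
by have := cabs_dist (F z) (F (z + t *: v)) 0; rewrite !subr0 cabs_distC; lra.
Qed.

Lemma index_term_line_cvg F z v k : lup_ball F -> unit_ball z ->
  (fun t : CC R => index_term L b F (z + t *: v) k) @ (0 : CC R) --> index_term L b F z k.
Proof.
move=> HF zB; have [Lc Lp _ _] := LQ.
have z1 : 0 < 1 - enorm z by rewrite subr_gt0.
have [eta e0 He] := dirscale_lt v z1.
have tB : \forall t \near (0 : CC R), unit_ball (z + t *: v).
  by apply: filterS (near0_cabs e0) => t te; apply: unit_ball_shift => //; exact/He/ltW.
have cL : (fun t : CC R => L (z + t *: v)) @ (0 : CC R) --> L z.
  move/subspace_continuousP: Lc => /(_ z zB) /cvgrPdist_le Lc.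
  apply/(@cvgrPdist_le R R (CC R) (nbhs (0 : CC R)) _ (fun t : CC R => L (z + t *:
    v))) => eps eps0.
  have := line_near v (Lc eps eps0) => LL.
  by apply: filterS2 tB LL => t tb; apply.
have cM (f1 f2 : CC R -> R) (x y : R) : f1 @ (0 : CC R) --> x -> f2 @ (0 : CC R) --> y ->
    (fun t : CC R => f1 t * f2 t) @ (0 : CC R) --> x * y.
  by move=> h1 h2; exact: (@cvgM _ (CC R) (nbhs (0 : CC R)) _ f1 f2 x y h1 h2).
have cC (x : R) : (fun _ : CC R => x) @ (0 : CC R) --> x.
  exact: (@cvg_cst _ x (CC R) (nbhs (0 : CC R))).
have cX j : (fun t : CC R => L (z + t *: v) ^+ j) @ (0 : CC R) --> L z ^+ j.
  elim: j => [|j IHj]; first exact: cC.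
  by rewrite exprS; under eq_fun do rewrite exprS; exact: cM.
apply: (cM _ _ _ _ _ (@lup_line_cvg _ _ v (dirDn_lup_ball b k HF zB))).
have cV (f1 : CC R -> R) (x : R) : x != 0 -> f1 @ (0 : CC R) --> x ->
    (fun t : CC R => (f1 t)^-1) @ (0 : CC R) --> x^-1.
  by move=> x0 h1; exact: (@cvgV _ (CC R) (nbhs (0 : CC R)) _ f1 x x0 h1).
by apply: cV (cM _ _ _ _ (cC k`!%:R) (cX k));
  rewrite mulf_neq0 ?pnatr_eq0 -?lt0n ?fact_gt0 // expf_neq0 // gt_eqF // Lp.
Qed.

(** A failure at [z] is a strict inequality between finitely many continuous quantities, so it
    persists near [z] on the line, where points of [G] lie. Continuity along one complex line is
    enough. *)
Lemma bounded_index_dense F (G : set 'rV[CC R]_n) m0 : lup_ball F ->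
  (forall m z, G z -> index_term L b F z m <=
     \big[Num.max/0]_(k < m0.+1) index_term L b F z k) ->
  (forall z, unit_ball z -> exists v, forall eta : R, 0 < eta ->
     exists2 t, cabs t < eta & G (z + t *: v)) ->
  bounded_index L b F.
Proof.
move=> HF HG Hd; exists m0 => m z zB; rewrite leNgt; apply/negP => lt.
have [v Hv] := Hd z zB.
have it0 : 0 < index_term L b F z m.
  apply: le_lt_trans lt; apply: (big_ind (fun x => 0 <= x)) => //.
    by move=> x y x0 y0; rewrite le_max x0.
  by move=> i _; rewrite (index_term_slice_coef LQ) // cabs_ge0.
have gt (f : CC R -> R) (x y : R) : f @ (0 : CC R) --> x -> y < x ->
  \forall t \near (0 : CC R), y < f t.
  by move=> fx yx; exact: (@cvgr_gt _ (CC R) (nbhs (0 : CC R)) _ f x fx y yx).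
have lt' (f : CC R -> R) (x y : R) : f @ (0 : CC R) --> x -> x < y ->
  \forall t \near (0 : CC R), f t < y.
  by move=> fx yx; exact: (@cvgr_lt _ (CC R) (nbhs (0 : CC R)) _ f x fx y yx).
(* Positivity is tracked separately because the maximum has the default value 0. *)
have N1 := gt _ _ _ (@index_term_line_cvg F z v m HF zB) it0.
have N2 : \forall t \near (0 : CC R), forall k : 'I_m0.+1,
    index_term L b F (z + t *: v) k < index_term L b F (z + t *: v) m.
  apply: (@filter_forall (CC R) _ _ (nbhs (0 : CC R)) _) => k.
  have ltk : index_term L b F z k < index_term L b F z m.
    by apply: le_lt_trans lt; apply: (le_bigmax_cond 0 (fun i :
      'I_m0.+1 => index_term L b F z i)).
  pose c := (index_term L b F z k + index_term L b F z m) / 2.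
  have [kc cm] : index_term L b F z k < c /\ c < index_term L b F z m by rewrite /c; split; lra.
  have h1 := gt _ _ _ (@index_term_line_cvg F z v m HF zB) cm.
  have h2 := lt' _ _ _ (@index_term_line_cvg F z v k HF zB) kc.
  by apply: filterS2 h2 h1 => t; apply: lt_trans.
have [e e0 He] := near0_ball (filterI N1 N2).
have [t te Gt] := Hv e e0; have [h1 h2] := He t te.
have := HG m _ Gt; apply/negP; rewrite -ltNge.
apply: (big_ind (fun x => x < index_term L b F (z + t *: v) m)) => //.
by move=> x y xl yl; rewrite gt_max xl.
Qed.

(** A point where g_0 is nonzero is regular, with t = 0. If none were near [z] on the line towards
    [w], the identity theorem would give g_0(w) = 0. *)
Lemma regular_dense (g0 : 'rV[CC R]_n -> CC R) w z : lup_ball g0 -> unit_ball w -> g0 w != 0 ->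
  unit_ball z -> exists v, forall eta : R, 0 < eta ->
     exists2 t, cabs t < eta & regular b g0 (z + t *: v).
Proof.
move=> Hg wB gw zB; exists (w - z) => eta e0.
have z1 : 0 < 1 - enorm z by rewrite subr_gt0.
have [d d0 Hd] := dirscale_lt (w - z) z1.
pose e := Num.min eta d; have ep : 0 < e by rewrite lt_min e0.
apply: contrapT => Hno; move/negP: gw; apply; apply/eqP.
apply: (identity_ball Hg zB wB ep) => t; rewrite lt_min => /andP[te td].
apply/eqP; apply: contrapT => /negP gt; apply: Hno; exists t => //.
have tB : unit_ball (z + t *: (w - z)) by apply: unit_ball_shift => //; apply: Hd; exact: ltW.
by split=> //; exists 0; rewrite scale0r addr0.
Qed.

End Density.

Theorem theorem13 (R : realType) (n : nat) (beta : R) (b : 'rV[CC R]_n)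
    (L : 'rV[CC R]_n -> R) (p : nat) (g : nat -> 'rV[CC R]_n -> CC R)
    (h : 'rV[CC R]_n -> CC R)
    (beta_gt1 : 1 < beta) (b_neq0 : b != 0) (LQ : class_Q b beta L)
    (p_gt0 : (0 < p)%N)
    (g_analytic : forall j, (j <= p)%N -> analytic_in_ball (g j))
    (g_index : forall j, (j <= p)%N -> bounded_index L b (g j))
    (h_analytic : analytic_in_ball h)
    (h_index : bounded_index L b h)
    (G_proper : @unit_ball R n `\` Gset L b beta (g 0%N) !=set0)
    (g_bound : forall r : R, 0 < r <= beta ->
      exists2 T : R, 0 < T &
        forall z, (@unit_ball R n `\` Gset L b r (g 0%N)) z ->
        forall j, (1 <= j <= p)%N ->
          cabs (g j z) <= T * L z ^+ j * cabs (g 0%N z)) :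
  forall F : 'rV[CC R]_n -> CC R, analytic_in_ball F ->
    (forall z, unit_ball z ->
      \sum_(j < p.+1) g j z * dirDn b (p - j) F z = h z) ->
    bounded_index L b F.
Proof.
move=> F F_analytic eqF.
have lupF (f : 'rV[CC R]_n -> CC R) : analytic_in_ball f -> lup_ball f.
  by move=> Hf a /Hf; exact: analytic_lup.
have g_lup j : (j <= p)%N -> lup_ball (g j) by move=> /g_analytic /lupF.
have F_lup := lupF F F_analytic.
have [rho [N0 [B [rho01 B0 H]]]] := hayman_local beta_gt1 LQ g_lup (lupF h h_analytic) F_lup
  g_index h_index g_bound eqF.
have reg_ball z : regular b (g 0%N) z -> unit_ball z by case.
have [m0 Hm0] := bounded_index_on beta_gt1 LQ F_lup reg_ball
  (fun z d => @regular_shift _ _ _ _ _ LQ _ z d) rho01 B0 H.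
(* If g_0 vanished throughout the ball, every slice would belong entirely to the exceptional set,
   which would then leave no point outside. *)
have [w wB gw] : exists2 w, @unit_ball R n w & g 0%N w != 0.
  case: G_proper => z [zB zG]; apply: contrapT => Hno; apply: zG.
  have g0 t : slice_dom b z t -> g 0%N (z + t *: b) = 0.
    move=> tB; apply/eqP; apply: contrapT => /negP gt; apply: Hno.
    by exists (z + t *: b).
  have z0 : slice_dom b z 0 by rewrite /slice_dom /= scale0r addr0.
  exists z => //; rewrite /Gset_at; case: asboolP => [E|_].
    by have : slice_zeros b (g 0%N) z 0 by [split=> //; exact: g0]; rewrite E.
  by case: asboolP => // _; exists 0; rewrite // scale0r addr0.
apply: (bounded_index_dense LQ F_lup Hm0) => z zB.
exact: (regular_dense b (g_lup 0%N isT) wB gw zB).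
Qed.
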